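(* With $\Omega,\varphi$ as in the context, the second derivatives of $\varphi$ (in the $(x,y)$-coordinates) blow up at the origin: $|D^2\varphi(p)|\to\infty$ as $p\to(0,0)$ with $p\in\Omega\setminus\{(x,y):y=x\ge0\}$.
   Context: Let $\lambda$ be Lebesgue measure on $\mathbb{R}^2$. Let $\Omega=\mathrm{Hull}\{(-\tfrac12,-\tfrac12),(-\tfrac16,-\tfrac12),(\tfrac12,\tfrac12),(-\tfrac12,-\tfrac16)\}$ and $\Theta=\mathrm{Hull}\{(-\tfrac16,-\tfrac16),(\tfrac12,-\tfrac12),(\tfrac56,-\tfrac12),(0,0)\}\cup\mathrm{Hull}\{(-\tfrac16,-\tfrac16),(-\tfrac12,\tfrac12),(-\tfrac12,\tfrac56),(0,0)\}$ (equal areas). Let $\varphi$ be the Brenier potential: a convex function on $\Omega$ whose gradient pushes $\chi_\Omega\lambda$ forward to $\chi_\Theta\lambda$ (unique up to an additive constant). It is smooth on $\Omega\setminus\{y=x\ge0\}$. *)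

(* Defs.v *)
From mathcomp Require Import all_boot all_order all_algebra.
From mathcomp Require Import all_classical all_reals all_analysis.
Set Implicit Arguments. Unset Strict Implicit. Unset Printing Implicit Defensive.
Import Order.TTheory GRing.Theory Num.Theory.
Import numFieldNormedType.Exports.
Local Open Scope classical_set_scope.
Local Open Scope ring_scope.

Section Defs.
Variable R : realType.

Definition hull4 (a b c d : R * R) : set (R * R) :=
  [set p | exists l1 l2 l3 l4 : R,
     [/\ 0 <= l1, 0 <= l2, 0 <= l3 & 0 <= l4] /\ l1 + l2 + l3 + l4 = 1 /\
     p = l1 *: a + l2 *: b + l3 *: c + l4 *: d].

Definition Omega : set (R * R) :=
  hull4 (-(1/2), -(1/2)) (-(1/6), -(1/2)) (1/2, 1/2) (-(1/2), -(1/6)).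

Definition Theta : set (R * R) :=
  hull4 (-(1/6), -(1/6)) (1/2, -(1/2)) (5/6, -(1/2)) (0, 0)
  `|` hull4 (-(1/6), -(1/6)) (-(1/2), 1/2) (-(1/2), 5/6) (0, 0).

Definition diagL : set (R * R) := [set p | p.2 = p.1 /\ 0 <= p.1].

Definition lebesgue2 : set (R * R) -> \bar R :=
  (lebesgue_measure \x lebesgue_measure)%E.

Definition e1 : R * R := (1, 0).
Definition e2 : R * R := (0, 1).

Definition pd (v : R * R) (f : R * R -> R) : R * R -> R := fun p => 'D_v f p.
Definition grad (f : R * R -> R) (p : R * R) : R * R := (pd e1 f p, pd e2 f p).

Definition convex_on (A : set (R * R)) (f : R * R -> R) : Prop :=
  forall p q (t : R), A p -> A q -> 0 <= t <= 1 ->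
    f (t *: p + (1 - t) *: q) <= t * f p + (1 - t) * f q.

Definition pushes_forward (f : R * R -> R) : Prop :=
  measurable_fun Omega (grad f) /\
  forall B : set (R * R), measurable B ->
    lebesgue2 (Omega `&` grad f @^-1` B) = lebesgue2 (Theta `&` B).

Definition brenier_potential (f : R * R -> R) : Prop :=
  convex_on Omega f /\ pushes_forward f.

Definition twice_differentiable_on (U : set (R * R)) (f : R * R -> R) : Prop :=
  forall p, U p ->
    [/\ differentiable f p, differentiable (pd e1 f) p & differentiable (pd e2 f) p].

Definition hess_norm (f : R * R -> R) (p : R * R) : R :=
  Num.max (Num.max `|pd e1 (pd e1 f) p| `|pd e1 (pd e2 f) p|)
          (Num.max `|pd e2 (pd e1 f) p| `|pd e2 (pd e2 f) p|).

End Defs.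

(* Main.v *)
(* On each half of [Omega] cut along the diagonal use the area preserving
   coordinates [x = s - n/2, y = s - 3n/2]: the half becomes the triangle
   [0 < n, 2|s| < 1 - 3n], the diagonal becomes [n = 0], and the gradient [(P, Q)]
   takes values in the cone [|P| <= Q <= 1/2 - |P|/2].  Triangle and cone are
   both symmetric under the reflection of the first coordinate, so by uniqueness
   of the Brenier map the potential is even in [s].

   The Hessian has determinant 1, so the partial Legendre transform in [s] is
   harmonic; its conjugate [W(a, n)] has gradient [(Q, s)] in the variables
   [a = P] and [n], and boundary values [a|a|/2].  The harmonic function
   [- Im ((n + i a)^2 log (n + i a)) / pi] has the same boundary values, and its
   mixed derivative [- (2 log |n + i a| + 3) / pi] tends to infinity at the origin.
   The difference vanishes on [n = 0], so its mixed difference quotients stay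
   bounded.  Hence [ds/da] tends to infinity at the origin, i.e. [P_s] tends to 0.

   A symmetric positive Hessian with entries [A, B, C] whose map preserves area
   has [B^2 <= A C] and [1 <= (|A| + |B|) (|B| + |C|)], so [A -> 0] forces
   [C] to infinity. *)
Require Import Defs.
From mathcomp Require Import all_boot all_order all_algebra.
From mathcomp Require Import all_classical all_reals all_analysis.
From mathcomp Require Import ring lra measurable_realfun.
Set Implicit Arguments. Unset Strict Implicit. Unset Printing Implicit Defensive.
Import Order.TTheory GRing.Theory Num.Theory.
Import numFieldNormedType.Exports.
Local Open Scope classical_set_scope.
Local Open Scope ring_scope.

(** The second derivatives of the potential exist pointwise only, and mass balance is an identity of
    areas, so neither a pointwise Monge-Ampere equation nor the closedness of the form [Q da + s dn]
    is at hand. Therefore [W] is built as an area: its increments in [n] are measured in the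
    triangle and yield [s], its increments in [a] are carried by the area identity into the cone and
    yield [Q]. Area preservation is spent there; harmonicity then follows from the symmetry of the
    Hessian. For the same lack of regularity, the harmonic estimates bound finite differences by
    means of the minimum principle and quadratic barriers, without a Poisson kernel. Two degenerate
    configurations would ruin the change of variables near the origin: a corner of the potential
    along the diagonal, where [P] would not tend to 0, and a flat piece of the diagonal, where [P]
    could not be inverted on a fixed rectangle. Each is excluded by comparing areas. Points of the
    diagonal with negative coordinates also lie in the domain of the claim; they belong to neither
    open half and are reached by continuity of the gradient. *)

Lemma exists_pos_lt3 (R : realType) (a b c : R) : 0 < a -> 0 < b -> 0 < c ->
  exists2 t, 0 < t & [/\ t < a, t < b & t < c].
Proof.
move=> a0 b0 c0; have m0 : 0 < Num.min a (Num.min b c) by rewrite !lt_min a0 b0.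
have : Num.min a (Num.min b c) / 2 < Num.min a (Num.min b c) by rewrite gtr_pMr // invf_lt1 // ltr1n.
by rewrite !lt_min => /andP[? /andP[? ?]]; exists (Num.min a (Num.min b c) / 2); rewrite ?divr_gt0.
Qed.

(** * One-variable derivatives in epsilon-delta form *)

Section Derivatives.
Variable R : realType.
Implicit Types (g h : R -> R) (u v : R -> R -> R).

Lemma near_ballP (x : R) (A : R -> Prop) :
  (\forall z \near x, A z) <-> exists2 d : R, 0 < d & forall z, `|z - x| < d -> A z.
Proof.
split; last first.
  by move=> [d d0 H]; apply/nbhs_ballP; exists d => //= z; rewrite /ball /= distrC; exact: H.
move/nbhs_ballP => [d /= d0 H]; exists d => // z zd.
by apply: H; rewrite /ball /= distrC.
Qed.

(** Multiplying out the difference quotient removes the division, and the non-strict bound makes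
    [z = x] harmless; most derivatives below are handled in this form. *)
Lemma is_deriveP g (x c : R) :
  is_derive x 1 g c <->
  forall e, 0 < e -> exists2 d : R, 0 < d &
    forall z, `|z - x| < d -> `|g z - g x - c * (z - x)| <= e * `|z - x|.
Proof.
split.
  move=> [dg gc] e e0; have /cvg_ex[l gl] := dg.
  have lc : l = c by rewrite -gc; apply/esym/cvg_lim.
  move: gl; rewrite {}lc => /cvgrPdist_le /(_ e e0).
  rewrite near_withinE => /near_ballP [d d0 H].
  exists d => // z zd; have [->|zx] := eqVneq z x.
    by rewrite !subrr mulr0 subr0 normr0 mulr0.
  have := H (z - x); rewrite subr0 => /(_ zd).
  rewrite subr_eq0 => /(_ zx).
  rewrite /= [_%:A]mulr1 subrK => H1.
  have zx0 : z - x != 0 by rewrite subr_eq0.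
  have -> : g z - g x - c * (z - x) = - (z - x) * (c - (z - x)^-1 * (g z - g x)).
    by field.
  by rewrite normrM normrN mulrC ler_wpM2r.
move=> H.
have cv : (fun t : R => t^-1 *: (g (t *: (1:R) + x) - g x)) @ 0^' --> c.
  apply/cvgrPdist_le => e e0; have [d d0 K] := H e e0.
  rewrite near_withinE; apply/near_ballP; exists d => // z; rewrite subr0 => zd z0.
  have := K (z + x); rewrite addrK => /(_ zd).
  rewrite [_%:A]mulr1 => H1.
  have -> : c - z^-1 *: (g (z + x) - g x) = - z^-1 * (g (z + x) - g x - c * z).
    by rewrite /GRing.scale /=; field.
  rewrite normrM normrN normfV ler_pdivrMl ?normr_gt0//.
  by rewrite [leRHS]mulrC.
apply: DeriveDef; first exact: (cvgP _ cv).
exact/cvg_lim.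
Qed.

Lemma is_derive_cont g (x c : R) : is_derive x 1 g c -> {for x, continuous g}.
Proof.
by move=> [dg _]; apply/differentiable_continuous/derivable1_diffP.
Qed.

Lemma MVT_derive g (dg : R -> R) (a b : R) : a < b ->
  (forall x, a <= x <= b -> is_derive x 1 g (dg x)) ->
  exists2 c, a < c < b & g b - g a = dg c * (b - a).
Proof.
move=> ab H; have [] := @MVT R g dg a b ab.
- by move=> x; rewrite in_itv /= => /andP[h1 h2]; apply: H; rewrite !ltW.
- apply: continuous_in_subspaceT => x; rewrite inE /= in_itv /= => xab.
  exact: is_derive_cont (H x xab).
- by move=> c; rewrite in_itv /= => cab E; exists c.
Qed.

(** A second derivative at one point: the first derivative must exist nearby, the second only at
    [x]. Nothing stronger is available for [W]. *)
Definition has_d2 g (x c : R) : Prop :=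
  exists2 dg : R -> R,
    (\forall z \near x, is_derive (z : R) 1 g (dg z)) & is_derive x 1 dg c.

(** If [c] were negative, then [dg], which vanishes at the minimum, would be negative just to the
    right of [x], and the mean value theorem would push [g] below [g x]. *)
Lemma has_d2_min g (x c : R) :
  has_d2 g x c -> (\forall z \near x, g x <= g z) -> 0 <= c.
Proof.
move=> [dg Hg Hdg] Hmin; rewrite leNgt; apply/negP => c0.
have [d1 d10 D1] := (near_ballP x _).1 Hg.
have [d2 d20 D2] := (near_ballP x _).1 Hmin.
have dgx0 : dg x = 0.
  have /is_deriveP K : is_derive x 1 g (dg x) by apply: D1; rewrite subrr normr0.
  apply/eqP/negP => /negP n0.
  have n0' : 0 < `|dg x| / 2 by rewrite divr_gt0 ?normr_gt0.
  have [d d0 D] := K _ n0'.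
  have [t t0 [td td2 _]] := exists_pos_lt3 d0 d20 d0.
  have n1 : dg x <= 0.
    have := D (x - t); rewrite [x - t - x]addrAC subrr add0r normrN (gtr0_norm t0) => /(_ td).
    have := D2 (x - t); rewrite [x - t - x]addrAC subrr add0r normrN (gtr0_norm t0) => /(_ td2).
    rewrite ler_norml => h1 /andP[h2 h3].
    rewrite leNgt; apply/negP => h4; move: h2 h3; rewrite (gtr0_norm h4) => h2 h3.
    nra.
  have n2 : 0 <= dg x.
    have := D (x + t); rewrite [x + t - x]addrAC subrr add0r (gtr0_norm t0) => /(_ td).
    have := D2 (x + t); rewrite [x + t - x]addrAC subrr add0r (gtr0_norm t0) => /(_ td2).
    rewrite ler_norml => h1 /andP[h2 h3].
    rewrite leNgt; apply/negP => h4; move: h2 h3; rewrite (ltr0_norm h4) => h2 h3.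
    nra.
  by move: n0; apply/negP; rewrite negbK; apply/eqP; apply/le_anti; rewrite n1.
have c20 : 0 < - c / 2 by lra.
move/is_deriveP: Hdg => /(_ _ c20)[d d0 D].
have [t t0 [td td1 td2]] := exists_pos_lt3 d0 d10 d20.
have xt : x < x + t by rewrite ltrDl.
have [|xi /andP[x1 x2] E] := @MVT_derive g dg _ _ xt.
  move=> z /andP[z1 z2]; apply: D1; rewrite ger0_norm; lra.
have := D2 (x + t); rewrite addrAC subrr add0r (gtr0_norm t0) => K.
have {}K : g x <= g (x + t) by apply: K; lra.
have := D xi; rewrite ger0_norm; last lra.
have -> : xi - x < d by lra.
move=> /(_ isT); rewrite dgx0 ler_norml => /andP[_ h].
have : dg xi < 0 by nra.
nra.
Qed.

Lemma has_d2D g h (x a b : R) :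
  has_d2 g x a -> has_d2 h x b -> has_d2 (fun z => g z + h z) x (a + b).
Proof.
move=> [dg Hg Kg] [dh Hh Kh]; exists (fun z => dg z + dh z).
  near=> z.
  have Gz : is_derive z 1 g (dg z) by near: z.
  have Hz : is_derive z 1 h (dh z) by near: z.
  exact: is_deriveD.
exact: is_deriveD.
Unshelve. all: by end_near. Qed.

Lemma has_d2Z g (x a k : R) : has_d2 g x a -> has_d2 (fun z => k * g z) x (k * a).
Proof.
move=> [dg Hg Kg]; exists (fun z => k * dg z).
  near=> z.
  have Gz : is_derive z 1 g (dg z) by near: z.
  exact: is_deriveZ.
exact: is_deriveZ.
Unshelve. all: by end_near. Qed.

Lemma is_derive_affine g (x k b c : R) :
  is_derive (k * x + b) 1 g c -> is_derive x 1 (fun z => g (k * z + b)) (c * k).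
Proof.
move=> /is_deriveP H; apply/is_deriveP => e e0.
have k0 : 0 < `|k| + 1 by rewrite ltr_wpDl.
have [d d0 D] := H (e / (`|k| + 1)) (divr_gt0 e0 k0).
exists (d / (`|k| + 1)); first exact: divr_gt0.
move=> z; rewrite ltr_pdivlMr // => zd.
have E : k * z + b - (k * x + b) = k * (z - x) by ring.
have := D (k * z + b); rewrite E normrM => K.
have {K}K := K _.
have -> : c * k * (z - x) = c * (k * (z - x)) by ring.
have nz := normr_ge0 (z - x); have nk := normr_ge0 k.
apply: le_trans (K _) _; first by nra.
rewrite mulrA ler_wpM2r // mulrAC ler_pdivrMr // ler_pM2l //; lra.
Qed.

Lemma has_d2_affine g (x k b c : R) :
  has_d2 g (k * x + b) c -> has_d2 (fun z => g (k * z + b)) x (c * k ^+ 2).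
Proof.
move=> [dg Hg Kg]; exists (fun z => dg (k * z + b) * k).
  have [d d0 D] := (near_ballP _ _).1 Hg.
  have k0 : 0 < `|k| + 1 by rewrite ltr_wpDl.
  apply/near_ballP; exists (d / (`|k| + 1)); first exact: divr_gt0.
  move=> z; rewrite ltr_pdivlMr // => zd; apply: is_derive_affine; apply: D.
  have -> : k * z + b - (k * x + b) = k * (z - x) by ring.
  rewrite normrM; have := normr_ge0 (z - x); have := normr_ge0 k; nra.
have -> : (fun z => dg (k * z + b) * k) = (fun z => k * dg (k * z + b)).
  by apply/funext => z; rewrite mulrC.
have -> : c * k ^+ 2 = k *: (c * k) by rewrite /GRing.scale /=; ring.
by apply: is_deriveZ; exact: is_derive_affine.
Qed.

Lemma has_d2_quad (x p q r : R) : has_d2 (fun z => p * z ^+ 2 + q * z + r) x (2 * p).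
Proof.
exists (fun z => 2 * p * z + q).
  near=> z; apply/is_deriveP => e e0; exists (e / (`|p| + 1)).
    by rewrite divr_gt0 // ltr_wpDl.
  move=> y; rewrite ltr_pdivlMr ?ltr_wpDl // => yd.
  have -> : p * y ^+ 2 + q * y + r - (p * z ^+ 2 + q * z + r) - (2 * p * z + q) * (y - z)
    = p * (y - z) * (y - z) by ring.
  rewrite normrM ler_wpM2r // normrM.
  have := normr_ge0 (y - z); nra.
apply/is_deriveP => e e0; exists 1 => // z _.
have -> : 2 * p * z + q - (2 * p * x + q) - 2 * p * (z - x) = 0 by ring.
by rewrite normr0 mulr_ge0 // ltW.
Unshelve. all: by end_near. Qed.

End Derivatives.

(** * Harmonic functions and the minimum principle on rectangles *)

Section Harmonic.
Variable R : realType.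
Implicit Types (u v : R -> R -> R).

Definition cont2 u : Prop := continuous (fun p : R * R => u p.1 p.2).

(** The Laplace equation through the two pure second derivatives at the point, which is all that the
    minimum principle consumes. *)
Definition harmonic_at u (x y : R) : Prop :=
  exists2 c, has_d2 (u ^~ y) x c & has_d2 (u x) y (- c).

Lemma cont2D u v : cont2 u -> cont2 v -> cont2 (fun x y => u x y + v x y).
Proof. by move=> cu cv p; apply: continuousD; [exact: cu|exact: cv]. Qed.

Lemma cont2Z u (k : R) : cont2 u -> cont2 (fun x y => k * u x y).
Proof. by move=> cu p; apply: continuousM; [exact: cst_continuous|exact: cu]. Qed.

Lemma cont2_fst (g : R -> R) : continuous g -> cont2 (fun x _ => g x).
Proof.
move=> cg p; apply: (@continuous_comp _ _ _ fst g); [exact: cvg_fst|exact: cg].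
Qed.

Lemma cont2_snd (g : R -> R) : continuous g -> cont2 (fun _ y => g y).
Proof.
move=> cg p; apply: (@continuous_comp _ _ _ snd g); [exact: cvg_snd|exact: cg].
Qed.

Lemma cont2_affine u (k b l c : R) :
  cont2 u -> cont2 (fun x y => u (k * x + b) (l * y + c)).
Proof.
move=> cu p.
apply: (@continuous_comp _ _ _ (fun p : R * R => (k * p.1 + b, l * p.2 + c))
  (fun p : R * R => u p.1 p.2)); last exact: cu.
have c1 : (fun p : R * R => k * p.1 + b) @ p --> k * p.1 + b.
  apply: cvgD; last exact: cvg_cst.
  by apply: cvgM; [exact: cvg_cst|exact: cvg_fst].
have c2 : (fun p : R * R => l * p.2 + c) @ p --> l * p.2 + c.
  apply: cvgD; last exact: cvg_cst.
  by apply: cvgM; [exact: cvg_cst|exact: cvg_snd].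
exact: (cvg_pair c1 c2).
Qed.

Lemma harmonicD u v (x y : R) : harmonic_at u x y -> harmonic_at v x y ->
  harmonic_at (fun x y => u x y + v x y) x y.
Proof.
move=> [c u1 u2] [d v1 v2]; exists (c + d); first exact: has_d2D.
by rewrite opprD; exact: has_d2D.
Qed.

Lemma harmonicZ u (x y k : R) : harmonic_at u x y ->
  harmonic_at (fun x y => k * u x y) x y.
Proof.
move=> [c u1 u2]; exists (k * c); first exact: has_d2Z.
by rewrite -mulrN; exact: has_d2Z.
Qed.

Lemma harmonic_affine u (x y k b l c : R) : k ^+ 2 = l ^+ 2 ->
  harmonic_at u (k * x + b) (l * y + c) ->
  harmonic_at (fun x y => u (k * x + b) (l * y + c)) x y.
Proof.
move=> kl [d u1 u2]; exists (d * k ^+ 2).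
  exact: (@has_d2_affine _ (u^~ (l * y + c))).
by rewrite kl -mulNr; exact: (@has_d2_affine _ (u (k * x + b))).
Qed.

(** The strictly concave perturbation [q], a multiple of [(x - x1) * (x2 - x)], is non-negative on
    the rectangle. At an interior minimum of [u + q] the two second derivatives would be
    non-negative, yet they add up to [- 2 * e]. *)
Lemma min_principle u (x1 x2 y1 y2 : R) : cont2 u ->
  (forall x y, x1 < x < x2 -> y1 < y < y2 -> harmonic_at u x y) ->
  (forall x y, x1 <= x <= x2 -> y1 <= y <= y2 ->
     [\/ x = x1, x = x2, y = y1 | y = y2] -> 0 <= u x y) ->
  forall x y, x1 <= x <= x2 -> y1 <= y <= y2 -> 0 <= u x y.
Proof.
move=> cu hu bu x0 y0 x0x y0y; rewrite leNgt; apply/negP => neg.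
(* [L] exceeds [(x - x1) * (x2 - x)], so with this [e] the perturbed value at [(x0, y0)] stays
   negative. *)
pose L := (x2 - x1) ^+ 2 + 1.
have L0 : 0 < L by rewrite /L; have := sqr_ge0 (x2 - x1); lra.
pose e := - u x0 y0 / L.
have e0 : 0 < e by rewrite divr_gt0 // oppr_gt0.
have eL : e * L = - u x0 y0 by rewrite /e divfK // gt_eqF.
pose q x := (- e) * x ^+ 2 + e * (x1 + x2) * x + (- e * x1 * x2).
have qE x : q x = e * ((x - x1) * (x2 - x)) by rewrite /q; ring.
pose v x y := u x y + q x.
have cv : cont2 v.
  apply: cont2D => //; apply: cont2_fst => x.
  have [dq Hq _] := has_d2_quad x (- e) (e * (x1 + x2)) (- e * x1 * x2).
  by have [d d0 /(_ x)] := (near_ballP _ _).1 Hq; rewrite subrr normr0 => /(_ d0) /is_derive_cont.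
have cA : compact ([set` `[x1, x2]] `*` [set` `[y1, y2]]).
  by apply: compact_setX; exact: segment_compact.
have [||[a b]] := compact_EVT_min _ cA (f := fun p : R * R => v p.1 p.2).
- by exists (x0, y0); split; rewrite /= in_itv.
- exact: continuous_subspaceT.
rewrite inE => -[/=]; rewrite !in_itv /= => ax bx vmin.
have {}vmin x y : x1 <= x <= x2 -> y1 <= y <= y2 -> v a b <= v x y.
  by move=> hx hy; apply: (vmin (x, y)); rewrite inE; split; rewrite /= in_itv.
have vab : v a b < 0.
  apply: le_lt_trans (vmin _ _ x0x y0y) _.
  rewrite /v qE.
  have : (x0 - x1) * (x2 - x0) < L by rewrite /L; nra.
  by rewrite -(ltr_pM2l e0) eL; lra.
have q0 : 0 <= q a.
  by rewrite qE; apply: mulr_ge0; [lra|apply: mulr_ge0; lra].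
have nb : ~ [\/ a = x1, a = x2, b = y1 | b = y2].
  by move=> /bu H; move: vab; rewrite /v; have := H ax bx; lra.
have ax' : x1 < a < x2.
  move: ax => /andP[h1 h2]; rewrite !lt_neqAle h1 h2 !andbT.
  by apply/andP; split; apply/eqP => E; apply: nb; [constructor 1|constructor 2].
have bx' : y1 < b < y2.
  move: bx => /andP[h1 h2]; rewrite !lt_neqAle h1 h2 !andbT.
  by apply/andP; split; apply/eqP => E; apply: nb; [constructor 3|constructor 4].
have [c d1 d2] := hu a b ax' bx'.
have H1 : 0 <= c + 2 * (- e).
  apply: (@has_d2_min _ (v ^~ b) a).
    by apply: has_d2D => //; exact: has_d2_quad.
  apply/near_ballP; exists (Num.min (a - x1) (x2 - a)).
    by rewrite lt_min; apply/andP; split; lra.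
  move=> z; rewrite lt_min => /andP[h1 h2]; apply: vmin => //.
  by move: h1 h2; rewrite !ltr_norml; lra.
have H2 : 0 <= - c.
  apply: (@has_d2_min _ (u a) b) => //.
  apply/near_ballP; exists (Num.min (b - y1) (y2 - b)).
    by rewrite lt_min; apply/andP; split; lra.
  move=> z; rewrite lt_min => /andP[h1 h2].
  have : v a b <= v a z by apply: vmin => //; move: h1 h2; rewrite !ltr_norml; lra.
  by rewrite /v; lra.
lra.
Qed.

End Harmonic.

(** * Difference estimates for harmonic functions *)

Section InteriorEstimates.
Variable R : realType.
Implicit Types (u v w : R -> R -> R).

Lemma cont2_swap u : cont2 u -> cont2 (fun x y => u y x).
Proof.
move=> cu p.
apply: (@continuous_comp _ _ _ (fun p : R * R => (p.2, p.1))
  (fun p : R * R => u p.1 p.2)); last exact: cu.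
have c1 : (@snd R R) @ p --> p.2 by exact: cvg_snd.
have c2 : (@fst R R) @ p --> p.1 by exact: cvg_fst.
exact: (cvg_pair c1 c2).
Qed.

Lemma harmonic_swap u (x y : R) :
  harmonic_at u y x -> harmonic_at (fun x y => u y x) x y.
Proof. by move=> [c u1 u2]; exists (- c) => //; rewrite opprK. Qed.

Lemma min_principle_abs u v (x1 x2 y1 y2 : R) : cont2 u -> cont2 v ->
  (forall x y, x1 < x < x2 -> y1 < y < y2 -> harmonic_at u x y) ->
  (forall x y, x1 < x < x2 -> y1 < y < y2 -> harmonic_at v x y) ->
  (forall x y, x1 <= x <= x2 -> y1 <= y <= y2 ->
     [\/ x = x1, x = x2, y = y1 | y = y2] -> `|u x y| <= v x y) ->
  forall x y, x1 <= x <= x2 -> y1 <= y <= y2 -> `|u x y| <= v x y.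
Proof.
move=> cu cv hu hv b x y hx hy; rewrite ler_norml; apply/andP; split.
  rewrite -subr_ge0 opprK.
  apply: (@min_principle _ (fun x y => u x y + v x y) x1 x2 y1 y2) => //.
  - exact: cont2D.
  - by move=> *; apply: harmonicD; [exact: hu|exact: hv].
  - by move=> x' y' h1 h2 /b; rewrite ler_norml => /(_ h1 h2)/andP[h3 h4]; lra.
suff : 0 <= v x y + (-1) * u x y by lra.
apply: (@min_principle _ (fun x y => v x y + (-1) * u x y) x1 x2 y1 y2) => //.
- by apply: cont2D => //; exact: cont2Z.
- by move=> *; apply: harmonicD; [exact: hv|apply: harmonicZ; exact: hu].
- by move=> x' y' h1 h2 /b; rewrite ler_norml => /(_ h1 h2)/andP[h3 h4]; lra.
Qed.

(* Comparison with the harmonic barrier [M (y^2 - x^2 + 2 rho x) / rho^2]. *)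
Lemma harmonic_lipschitz_at_zero w (M rho y1 y2 : R) : 0 < rho -> cont2 w ->
  (forall x y, 0 < x < rho -> y1 < y < y2 -> harmonic_at w x y) ->
  (forall x y, 0 <= x <= rho -> y1 <= y <= y2 -> `|w x y| <= M) ->
  (forall y, w 0 y = 0) ->
  y1 <= 0 <= y2 ->
  (y1 = - rho \/ forall x, w x y1 = 0) ->
  y2 = rho ->
  forall x, 0 <= x <= rho -> `|w x 0| <= 2 * M / rho * x.
Proof.
move=> rho0 cw hw bw w0 y12 Hy1 Hy2 x hx.
have M0 : 0 <= M.
  by apply: le_trans (bw 0 0 _ _) => //; rewrite lexx ltW.
pose k := M / rho ^+ 2.
have k0 : 0 <= k by rewrite divr_ge0 // sqr_ge0.
have kM : k * rho ^+ 2 = M by rewrite divfK // expf_neq0 // gt_eqF.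
pose q1 (x : R) := (- k) * x ^+ 2 + (2 * k * rho) * x + 0.
pose q2 (y : R) := k * y ^+ 2 + 0 * y + 0.
pose B (x y : R) := q1 x + q2 y.
have cq (p q r : R) : continuous (fun z : R => p * z ^+ 2 + q * z + r).
  move=> z; have [dq Hq _] := has_d2_quad z p q r.
  have [d d0 /(_ z)] := (near_ballP _ _).1 Hq.
  by rewrite subrr normr0 => /(_ d0) /is_derive_cont.
have cB : cont2 B by apply: cont2D; [apply: cont2_fst; exact: cq|apply: cont2_snd; exact: cq].
have hB a b : harmonic_at B a b.
  exists (2 * - k).
    have -> : B ^~ b = (fun z => - k * z ^+ 2 + (2 * k * rho) * z + q2 b).
      by apply/funext => z; rewrite /B /q1; ring.
    exact: has_d2_quad.
  have -> : B a = (fun z => k * z ^+ 2 + 0 * z + q1 a).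
    by apply/funext => z; rewrite /B /q2; ring.
  by rewrite mulrN opprK; exact: has_d2_quad.
have Bge0 a b : 0 <= a <= rho -> 0 <= B a b.
  move=> ha; have -> : B a b = k * (a * (rho - a) + a * rho + b ^+ 2).
    by rewrite /B /q1 /q2; ring.
  apply: mulr_ge0 => //; have := sqr_ge0 b; nra.
have : `|w x 0| <= B x 0.
  apply: (@min_principle_abs w B 0 rho y1 y2) => //.
  move=> a b ha hb [Ea|Ea|Eb|Eb].
  - by rewrite Ea w0 normr0 Bge0 // lexx ltW.
  - apply: le_trans (bw _ _ ha hb) _; rewrite Ea -kM /B /q1 /q2.
    have -> : - k * rho ^+ 2 + 2 * k * rho * rho + 0 + (k * b ^+ 2 + 0 * b + 0)
      = k * rho ^+ 2 + k * b ^+ 2 by ring.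
    by rewrite lerDl mulr_ge0 // sqr_ge0.
  (* The lower side is either at distance [rho], where the barrier is at least [M], or a line on
     which [w] vanishes. *)
  - case: Hy1 => [E|E]; last by rewrite Eb E normr0 Bge0.
    apply: le_trans (bw _ _ ha hb) _; rewrite Eb E -kM /B /q1 /q2.
    have -> : - k * a ^+ 2 + 2 * k * rho * a + 0 + (k * (- rho) ^+ 2 + 0 * - rho + 0)
      = k * rho ^+ 2 + k * (a * (rho - a) + rho * a) by ring.
    by rewrite lerDl mulr_ge0 //; nra.
  - apply: le_trans (bw _ _ ha hb) _; rewrite Eb Hy2 -kM /B /q1 /q2.
    have -> : - k * a ^+ 2 + 2 * k * rho * a + 0 + (k * rho ^+ 2 + 0 * rho + 0)
      = k * rho ^+ 2 + k * (a * (rho - a) + rho * a) by ring.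
    by rewrite lerDl mulr_ge0 //; nra.
move/le_trans; apply; rewrite /B /q1 /q2.
have -> : 2 * M / rho * x = 2 * k * rho * x by rewrite -kM; field; rewrite gt_eqF.
have := mulr_ge0 k0 (sqr_ge0 x); nra.
Qed.

(** The one-sided Lipschitz bound is used three times, each time for a difference that is harmonic
    and vanishes on one side: in [h], giving size [h]; then in [y] from the axis, giving size
    [h * y]; then in [t] on a square of half-side [y], which trades the factor [y] for [t]. The
    constant is [8 * 8 * 8]. *)
Lemma mixed_difference_bound u (L M : R) : 0 < L -> cont2 u ->
  (forall x y, - L < x < L -> 0 < y < L -> harmonic_at u x y) ->
  (forall x y, - L <= x <= L -> 0 <= y <= L -> `|u x y| <= M) ->
  (forall x, u x 0 = 0) ->
  forall x y h t, - (L / 8) <= x <= L / 8 -> 0 < y <= L / 8 ->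
    0 <= h <= L / 2 -> 0 <= t <= y ->
  `|u (x + h) (y + t) - u (x - h) (y + t) - (u (x + h) (y - t) - u (x - h) (y - t))|
    <= 512 * M / L ^+ 2 * h * t.
Proof.
move=> L0 cu hu bu u0.
have L2 : 0 < L / 2 by rewrite divr_gt0.
have L4 : 0 < L / 4 by rewrite divr_gt0.
have affE (a : R) (b : R) : (1 * a + b = b + a) * ((-1) * a + b = b - a) by split; ring.
have A x y h : - (L / 2) <= x <= L / 2 -> 0 <= y <= L / 2 -> 0 <= h <= L / 2 ->
    `|u (x + h) y - u (x - h) y| <= 8 * M / L * h.
  move=> hx hy hh.
  pose w t s := u (1 * t + x) (1 * s + y) + (-1) * u ((-1) * t + x) (1 * s + y).
  have E t s : w t s = u (x + t) (y + s) - u (x - t) (y + s).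
    by rewrite /w !affE mulN1r.
  have -> : 8 * M / L * h = 2 * (2 * M) / (L / 2) * h by field; rewrite gt_eqF.
  have -> : u (x + h) y - u (x - h) y = w h 0 by rewrite E addr0.
  (* In shifted coordinates the lower side [- y] is the axis, where [u] vanishes; this is what the
     second alternative of the lemma is for. *)
  apply: (@harmonic_lipschitz_at_zero w (2 * M) (L / 2) (- y) (L / 2)) => //.
  - apply: cont2D; first exact: cont2_affine.
    by apply: cont2Z; exact: cont2_affine.
  - move=> a b ha hb; apply: harmonicD; last apply: harmonicZ.
      by apply: harmonic_affine => //; apply: hu; move: ha hb hx hy; clear - L0 => *; lra.
    by apply: harmonic_affine; [rewrite sqrrN|apply: hu; move: ha hb hx hy; clear - L0 => *; lra].
  - move=> a b ha hb; rewrite E; apply: le_trans (ler_normB _ _) _.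
    have := bu (x + a) (y + b); have := bu (x - a) (y + b); lra.
  - by move=> b; rewrite E addr0 subr0 subrr.
  - lra.
  - by right => a; rewrite E subrr !u0 subrr.
move=> x y h t hx hy hh ht.
pose M1 := 8 * M / L * h.
pose v a b := u (1 * a + h) (1 * b + 0) + (-1) * u (1 * a + - h) (1 * b + 0).
have vE a b : v a b = u (a + h) b - u (a - h) b.
  by rewrite /v !mul1r !addr0 mulN1r.
have cv : cont2 v.
  apply: cont2D; first exact: cont2_affine.
  by apply: cont2Z; exact: cont2_affine.
have hv a b : - (L / 2) < a < L / 2 -> 0 < b < L / 2 -> harmonic_at v a b.
  move=> ha hb; apply: harmonicD; last apply: harmonicZ.
    by apply: harmonic_affine => //; apply: hu; move: ha hb hh; clear - L0 => *; lra.
  by apply: harmonic_affine => //; apply: hu; move: ha hb hh; clear - L0 => *; lra.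
have bv a b : - (L / 2) <= a <= L / 2 -> 0 <= b <= L / 2 -> `|v a b| <= M1.
  by move=> ha hb; rewrite vE; exact: A.
have B a b : - (L / 4) <= a <= L / 4 -> 0 <= b <= L / 4 -> `|v a b| <= 8 * M1 / L * b.
  move=> ha hb.
  pose w s r := v (1 * r + a) (1 * s + 0).
  have wE s r : w s r = v (a + r) s by rewrite /w !affE add0r.
  have -> : 8 * M1 / L * b = 2 * M1 / (L / 4) * b by field; rewrite gt_eqF.
  have -> : v a b = w b 0 by rewrite (wE b 0) addr0.
  apply: (@harmonic_lipschitz_at_zero w M1 (L / 4) (- (L / 4)) (L / 4)) => //.
  - by apply: (@cont2_swap (fun r s => v (1 * r + a) (1 * s + 0))); exact: cont2_affine.
  - move=> s r hs hr; apply: (@harmonic_swap (fun r s => v (1 * r + a) (1 * s + 0))).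
    by apply: harmonic_affine => //; apply: hv; move: hs hr ha hb; clear - L0 => *; lra.
  - by move=> s r hs hr; rewrite wE; apply: bv; move: hs hr ha hb; clear - L0 => *; lra.
  - by move=> r; rewrite wE vE !u0 subrr.
  - lra.
  - by left.
have y0 : 0 < y by lra.
have M10 : 0 <= M1.
  by apply: le_trans (bv 0 0 _ _) => //; clear - L0; lra.
pose w s r := v (1 * r + x) (1 * s + y) + (-1) * v (1 * r + x) ((-1) * s + y).
have wE s r : w s r = v (x + r) (y + s) - v (x + r) (y - s).
  by rewrite /w !affE mulN1r.
have -> : u (x + h) (y + t) - u (x - h) (y + t) - (u (x + h) (y - t) - u (x - h) (y - t))
  = w t 0 by rewrite wE !vE addr0.
have -> : 512 * M / L ^+ 2 * h * t = 2 * (32 * M1 / L * y) / y * t.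
  by rewrite /M1; field; rewrite !gt_eqF.
(* The bound on [w] is proportional to [y], and so is the size of the square; the quotient does not
   degenerate as [y] tends to 0. *)
apply: (@harmonic_lipschitz_at_zero w (32 * M1 / L * y) y (- y) y) => //.
- apply: (@cont2_swap (fun r s => v (1 * r + x) (1 * s + y) + (-1) * v (1 * r + x) ((-1) * s + y))).
  apply: cont2D; first exact: cont2_affine.
  by apply: cont2Z; exact: cont2_affine.
- move=> s r hs hr.
  apply: (@harmonic_swap (fun r s => v (1 * r + x) (1 * s + y) + (-1) * v (1 * r + x) ((-1) * s + y))).
  apply: harmonicD; last apply: harmonicZ.
    by apply: harmonic_affine => //; apply: hv; move: hs hr hx hy; clear - L0 => *; lra.
  by apply: harmonic_affine; [rewrite sqrrN|apply: hv; move: hs hr hx hy; clear - L0 => *; lra].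
- move=> s r hs hr; rewrite wE; apply: le_trans (ler_normB _ _) _.
  have k0 : 0 <= 8 * M1 / L by apply: divr_ge0; [exact: mulr_ge0|exact: ltW].
  have -> : 32 * M1 / L * y = 8 * M1 / L * (2 * y) + 8 * M1 / L * (2 * y) by ring.
  apply: lerD.
    have := B (x + r) (y + s); have := @ler_wpM2l _ _ k0 (y + s) (2 * y).
    by move: (v _ _) hs hr hx hy; clear - L0 => *; lra.
  have := B (x + r) (y - s); have := @ler_wpM2l _ _ k0 (y - s) (2 * y).
  by move: (v _ _) hs hr hx hy; clear - L0 => *; lra.
- by move=> r; rewrite wE addr0 subr0 subrr.
- lra.
- by left.
Qed.

End InteriorEstimates.

(** * The explicit singular harmonic function *)

Section SingularSolution.
Variable R : realType.
Implicit Types (a n x y z : R).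

(* Unlike [is_derive], not a class: [apply:] does not start an instance search. *)
Definition derive_at (f : R -> R) x c : Prop := is_derive x 1 f c.

Lemma derive_at_mul (f g : R -> R) x a b : derive_at f x a -> derive_at g x b ->
  derive_at (fun z => f z * g z) x (f x * b + g x * a).
Proof. by rewrite /derive_at => fa gb; apply: is_derive_eq. Qed.

Lemma derive_at_add (f g : R -> R) x a b : derive_at f x a -> derive_at g x b ->
  derive_at (fun z => f z + g z) x (a + b).
Proof. by rewrite /derive_at => fa gb; apply: is_derive_eq. Qed.

Lemma derive_at_sub (f g : R -> R) x a b : derive_at f x a -> derive_at g x b ->
  derive_at (fun z => f z - g z) x (a - b).
Proof. by rewrite /derive_at => fa gb; apply: is_derive_eq. Qed.

Lemma derive_at_scale (f : R -> R) x k a : derive_at f x a ->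
  derive_at (fun z => k * f z) x (k * a).
Proof. by rewrite /derive_at => fa; apply: is_derive_eq. Qed.

Lemma derive_at_const x (k : R) : derive_at (fun=> k) x 0.
Proof. exact: is_derive_cst. Qed.

Lemma derive_at_comp (f g : R -> R) x a b : derive_at f (g x) a -> derive_at g x b ->
  derive_at (fun z => f (g z)) x (a * b).
Proof. exact: is_derive1_comp. Qed.

Lemma derive_at_near (f g : R -> R) x c : (\forall z \near x, f z = g z) ->
  derive_at f x c -> derive_at g x c.
Proof.
move=> /near_ballP [d d0 D] /is_deriveP H; apply/is_deriveP => e e0.
have [d1 d10 D1] := H e e0; exists (Num.min d d1); first by rewrite lt_min d0.
by move=> z; rewrite lt_min => /andP[h1 h2]; rewrite -!D ?subrr ?normr0 //; exact: D1.
Qed.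

Lemma derive_at_sqr x : derive_at (fun z : R => z ^+ 2) x (2 * x).
Proof.
apply/is_deriveP => e e0; exists e => // z ze.
have -> : z ^+ 2 - x ^+ 2 - 2 * x * (z - x) = (z - x) * (z - x) by ring.
by rewrite normrM ler_wpM2r // ltW.
Qed.

Lemma derive_at_lin x k b : derive_at (fun z : R => k * z + b) x k.
Proof.
apply/is_deriveP => e e0; exists e => // z ze.
have -> : k * z + b - (k * x + b) - k * (z - x) = 0 by ring.
by rewrite normr0 mulr_ge0 // ltW.
Qed.

Lemma derive_at_inv x : 0 < x -> derive_at (fun z : R => z^-1) x (- x ^- 2).
Proof.
move=> x0; have -> : - x ^- 2 = - x ^- 2 *: (1 : R) by rewrite /GRing.scale /= mulr1.
by apply: (@is_deriveV R id); rewrite ?gt_eqF.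
Qed.

Lemma sqD_gt0 a n : 0 < n -> 0 < a ^+ 2 + n ^+ 2.
Proof. by move=> n0; rewrite ltr_wpDl ?sqr_ge0 // exprn_gt0. Qed.

Lemma derive_atan_a a n : 0 < n ->
  derive_at (fun z => atan (z / n)) a (n / (a ^+ 2 + n ^+ 2)).
Proof.
move=> n0; have r0 := sqD_gt0 a n0.
have -> : n / (a ^+ 2 + n ^+ 2) = (1 + (a / n) ^+ 2)^-1 * n^-1.
  by field; rewrite !gt_eqF //= addrC.
apply: (@derive_at_comp (@atan R) (fun z => z / n)); first exact: is_derive1_atan.
apply: derive_at_near (derive_at_lin a n^-1 0).
by near=> z; rewrite addr0 mulrC.
Unshelve. all: by end_near. Qed.

Lemma derive_atan_n a n : 0 < n ->
  derive_at (fun z => atan (a / z)) n (- a / (a ^+ 2 + n ^+ 2)).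
Proof.
move=> n0; have r0 := sqD_gt0 a n0.
have -> : - a / (a ^+ 2 + n ^+ 2) = (1 + (a / n) ^+ 2)^-1 * (a * (- n ^- 2)).
  by field; rewrite !gt_eqF //= addrC.
apply: (@derive_at_comp (@atan R) (fun z => a / z)); first exact: is_derive1_atan.
by apply: (@derive_at_scale (fun z => z^-1)); exact: derive_at_inv.
Qed.

Lemma derive_ln_a a n : 0 < n ->
  derive_at (fun z => ln (z ^+ 2 + n ^+ 2)) a (2 * a / (a ^+ 2 + n ^+ 2)).
Proof.
move=> n0; have r0 := sqD_gt0 a n0; rewrite mulrC.
apply: (@derive_at_comp (@ln R) (fun z => z ^+ 2 + n ^+ 2)).
  exact: is_derive1_ln.
rewrite -[2 * a]addr0.
by apply: (@derive_at_add (fun z => z ^+ 2) (fun=> n ^+ 2)); [exact: derive_at_sqr|exact: derive_at_const].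
Qed.

Lemma derive_ln_n a n : 0 < n ->
  derive_at (fun z => ln (a ^+ 2 + z ^+ 2)) n (2 * n / (a ^+ 2 + n ^+ 2)).
Proof.
move=> n0; have r0 := sqD_gt0 a n0; rewrite mulrC.
apply: (@derive_at_comp (@ln R) (fun z => a ^+ 2 + z ^+ 2)).
  exact: is_derive1_ln.
rewrite -[2 * n]add0r.
by apply: (@derive_at_add (fun=> a ^+ 2) (fun z => z ^+ 2)); [exact: derive_at_const|exact: derive_at_sqr].
Qed.

(* [- Im (z^2 log z)] with [z = n + i a], extended to [n = 0] by its limit. *)
Definition sing a n : R :=
  if 0 < n then (a ^+ 2 - n ^+ 2) * atan (a / n) - a * n * ln (a ^+ 2 + n ^+ 2)
  else pi / 2 * (a * `|a|).

Definition sing_a a n : R := 2 * a * atan (a / n) - n * ln (a ^+ 2 + n ^+ 2) - n.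
Definition sing_n a n : R := - 2 * n * atan (a / n) - a * ln (a ^+ 2 + n ^+ 2) - a.

Lemma derive_sing_a a n : 0 < n -> derive_at (sing ^~ n) a (sing_a a n).
Proof.
move=> n0; have r0 := sqD_gt0 a n0; have r0' := gt_eqF r0.
have -> : sing ^~ n = (fun z => (z ^+ 2 - n ^+ 2) * atan (z / n) - z * n * ln (z ^+ 2 + n ^+ 2)).
  by apply/funext => z; rewrite /sing n0.
have -> : sing_a a n = ((a ^+ 2 - n ^+ 2) * (n / (a ^+ 2 + n ^+ 2)) + atan (a / n) * (2 * a))
   - (a * n * (2 * a / (a ^+ 2 + n ^+ 2)) + ln (a ^+ 2 + n ^+ 2) * n).
  by rewrite /sing_a; field; rewrite r0'.
apply: (@derive_at_sub (fun z => (z ^+ 2 - n ^+ 2) * atan (z / n))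
   (fun z => z * n * ln (z ^+ 2 + n ^+ 2))).
  apply: (@derive_at_mul (fun z => z ^+ 2 - n ^+ 2) (fun z => atan (z / n))); last exact: derive_atan_a.
  rewrite -[2 * a]subr0.
  by apply: (@derive_at_sub (fun z => z ^+ 2) (fun=> n ^+ 2)); [exact: derive_at_sqr|exact: derive_at_const].
apply: (@derive_at_mul (fun z => z * n) (fun z => ln (z ^+ 2 + n ^+ 2))); last exact: derive_ln_a.
apply: derive_at_near (derive_at_lin a n 0).
by near=> z; rewrite addr0 mulrC.
Unshelve. all: by end_near. Qed.

Lemma near_gt0 n : 0 < n -> \forall z \near n, 0 < (z : R).
Proof.
move=> n0; apply/near_ballP; exists n => // z; rewrite ltr_norml; lra.
Qed.

Lemma derive_sing_n a n : 0 < n -> derive_at (sing a) n (sing_n a n).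
Proof.
move=> n0; have r0 := sqD_gt0 a n0; have r0' := gt_eqF r0.
apply: (@derive_at_near (fun z => (a ^+ 2 - z ^+ 2) * atan (a / z) - a * z * ln (a ^+ 2 + z ^+ 2))).
  near=> z; rewrite /sing ifT //; near: z; exact: near_gt0.
have -> : sing_n a n = ((a ^+ 2 - n ^+ 2) * (- a / (a ^+ 2 + n ^+ 2)) + atan (a / n) * (- (2 * n)))
   - (a * n * (2 * n / (a ^+ 2 + n ^+ 2)) + ln (a ^+ 2 + n ^+ 2) * a).
  by rewrite /sing_n; field; rewrite r0'.
apply: (@derive_at_sub (fun z => (a ^+ 2 - z ^+ 2) * atan (a / z))
   (fun z => a * z * ln (a ^+ 2 + z ^+ 2))).
  apply: (@derive_at_mul (fun z => a ^+ 2 - z ^+ 2) (fun z => atan (a / z))); last exact: derive_atan_n.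
  rewrite -[- (2 * n)]sub0r.
  by apply: (@derive_at_sub (fun=> a ^+ 2) (fun z => z ^+ 2)); [exact: derive_at_const|exact: derive_at_sqr].
apply: (@derive_at_mul (fun z => a * z) (fun z => ln (a ^+ 2 + z ^+ 2))); last exact: derive_ln_n.
apply: derive_at_near (derive_at_lin n a 0).
by near=> z; rewrite addr0.
Unshelve. all: by end_near. Qed.

Lemma derive_sing_aa a n : 0 < n -> derive_at (sing_a ^~ n) a (2 * atan (a / n)).
Proof.
move=> n0; have r0 := sqD_gt0 a n0; have r0' := gt_eqF r0.
have -> : 2 * atan (a / n) = (2 * a * (n / (a ^+ 2 + n ^+ 2)) + atan (a / n) * 2)
   - n * (2 * a / (a ^+ 2 + n ^+ 2)) - 0.
  by field; rewrite r0'.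
apply: (@derive_at_sub (fun z => 2 * z * atan (z / n) - n * ln (z ^+ 2 + n ^+ 2)) (fun=> n)); last exact: derive_at_const.
apply: (@derive_at_sub (fun z => 2 * z * atan (z / n)) (fun z => n * ln (z ^+ 2 + n ^+ 2))).
  apply: (@derive_at_mul (fun z => 2 * z) (fun z => atan (z / n))); last exact: derive_atan_a.
  apply: derive_at_near (derive_at_lin a 2 0).
  by near=> z; rewrite addr0.
apply: (@derive_at_scale (fun z => ln (z ^+ 2 + n ^+ 2))); exact: derive_ln_a.
Unshelve. all: by end_near. Qed.

Lemma derive_sing_nn a n : 0 < n -> derive_at (sing_n a) n (- (2 * atan (a / n))).
Proof.
move=> n0; have r0 := sqD_gt0 a n0; have r0' := gt_eqF r0.
have -> : - (2 * atan (a / n)) = (- 2 * n * (- a / (a ^+ 2 + n ^+ 2)) + atan (a / n) * (- 2))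
   - a * (2 * n / (a ^+ 2 + n ^+ 2)) - 0.
  by field; rewrite r0'.
apply: (@derive_at_sub (fun z => - 2 * z * atan (a / z) - a * ln (a ^+ 2 + z ^+ 2)) (fun=> a)); last exact: derive_at_const.
apply: (@derive_at_sub (fun z => - 2 * z * atan (a / z)) (fun z => a * ln (a ^+ 2 + z ^+ 2))).
  apply: (@derive_at_mul (fun z => - 2 * z) (fun z => atan (a / z))); last exact: derive_atan_n.
  apply: derive_at_near (derive_at_lin n (- 2) 0).
  by near=> z; rewrite addr0.
apply: (@derive_at_scale (fun z => ln (a ^+ 2 + z ^+ 2))); exact: derive_ln_n.
Unshelve. all: by end_near. Qed.

Lemma derive_sing_na a n : 0 < n ->
  derive_at (sing_n ^~ n) a (- ln (a ^+ 2 + n ^+ 2) - 3).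
Proof.
move=> n0; have r0 := sqD_gt0 a n0; have r0' := gt_eqF r0.
have -> : - ln (a ^+ 2 + n ^+ 2) - 3 = - 2 * n * (n / (a ^+ 2 + n ^+ 2))
   - (a * (2 * a / (a ^+ 2 + n ^+ 2)) + ln (a ^+ 2 + n ^+ 2) * 1) - 1.
  by field; rewrite r0'.
apply: (@derive_at_sub (fun z => - 2 * n * atan (z / n) - z * ln (z ^+ 2 + n ^+ 2)) id); last exact: is_derive_id.
apply: (@derive_at_sub (fun z => - 2 * n * atan (z / n)) (fun z => z * ln (z ^+ 2 + n ^+ 2))).
  apply: (@derive_at_scale (fun z => atan (z / n))); exact: derive_atan_a.
apply: (@derive_at_mul id (fun z => ln (z ^+ 2 + n ^+ 2))); [exact: is_derive_id|exact: derive_ln_a].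
Qed.

Lemma sing_harmonic a n : 0 < n -> harmonic_at sing a n.
Proof.
move=> n0; exists (2 * atan (a / n)).
  exists (sing_a ^~ n); last exact: derive_sing_aa.
  by near=> z; exact: derive_sing_a.
exists (sing_n a); last exact: derive_sing_nn.
by near=> z; apply: derive_sing_n; near: z; exact: near_gt0.
Unshelve. all: by end_near. Qed.

(** The function [atan y + y^-1] is non-increasing on the positive axis, since
    [1 / (1 + y^2) <= 1 / y^2], and [atan] tends to [pi / 2]. *)
Lemma atan_pihalf x : 0 < x -> pi / 2 - atan x <= x^-1.
Proof.
move=> x0; rewrite lerBlDr.
have K z : x < z -> atan z <= x^-1 + atan x.
  move=> xz; pose g (y : R) := atan y + y^-1.
  have dg y : 0 < y -> derive_at g y ((1 + y ^+ 2)^-1 + - y ^- 2).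
    move=> y0; apply: (@derive_at_add (@atan R) (fun z => z^-1)); last exact: derive_at_inv.
    exact: is_derive1_atan.
  have [y hy|c hc] := @MVT_derive R g (fun y => (1 + y ^+ 2)^-1 + - y ^- 2) x z xz.
    by apply: dg; lra.
  have c0 : 0 < c by lra.
  have h : (1 + c ^+ 2)^-1 <= c ^- 2.
    have c20 : 0 < c ^+ 2 by rewrite exprn_gt0.
    by rewrite lef_pV2 ?posrE ?addr_gt0 //; lra.
  have z0 : 0 < z^-1 by rewrite invr_gt0; lra.
  rewrite /g => E.
  have : ((1 + c ^+ 2)^-1 + - c ^- 2) * (z - x) <= 0 by apply: mulr_le0_ge0; lra.
  lra.
apply: (cvgr_to_le (@cvgy_atan R)).
by exists x; split; [exact: num_real|exact: K].
Qed.

Lemma ln_bound y : 0 < y -> `|ln y| <= y + y^-1.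
Proof.
move=> y0; have iy0 : 0 < y^-1 by rewrite invr_gt0.
have := ln_sublinear y0; have := ln_sublinear iy0.
rewrite lnV ?posrE // ler_norml; lra.
Qed.

(** This serves twice: for the continuity of [sing] at the axis and for the boundedness of the
    excess of [W]. As [sing] is odd in [a], take [0 <= a]; then [atan (a / n)] misses [pi / 2] by at
    most [n / a], and [a <= r] tames the logarithm of [r]. *)
Lemma sing_near_axis a n : 0 < n ->
  `|sing a n - pi / 2 * (a * `|a|)| <= n * (`|a| + 2 * n + 2 * (1 + a ^+ 2 + n ^+ 2)).
Proof.
wlog a0 : a / 0 <= a => [H|n0].
  have [|a0 n0] := leP 0 a; first exact: H.
  have := H (- a) _ n0; rewrite normrN sqrrN => /(_ _)K.
  have -> : sing a n - pi / 2 * (a * `|a|) = - (sing (- a) n - pi / 2 * (- a * `|a|)).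
    by rewrite /sing n0 sqrrN mulNr atanN; ring.
  by rewrite normrN; apply: K; lra.
rewrite (ger0_norm a0) /sing ifT //.
pose r := Num.sqrt (a ^+ 2 + n ^+ 2).
have r20 := sqD_gt0 a n0.
have r0 : 0 < r by rewrite sqrtr_gt0.
have r2E : r ^+ 2 = a ^+ 2 + n ^+ 2 by rewrite sqr_sqrtr // ltW.
have ar : a <= r by rewrite -(ler_pXn2r (n := 2)) ?nnegrE ?(ltW r0) // r2E lerDl sqr_ge0.
have lnE : ln (a ^+ 2 + n ^+ 2) = ln r + ln r by rewrite -r2E lnXn // mulr2n.
rewrite lnE.
have lnr := ln_bound r0.
have h1 : `|a * (ln r + ln r)| <= 2 * (1 + r ^+ 2).
  rewrite normrM (ger0_norm a0).
  have h : `|ln r + ln r| <= 2 * (r + r^-1) by apply: le_trans (ler_normD _ _) _; lra.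
  apply: le_trans (ler_wpM2l a0 h) _.
  have : 0 <= 2 * (r + r^-1) by apply: mulr_ge0 => //; rewrite addr_ge0 // ?invr_ge0 ltW.
  move=> /ler_wpM2r /(_ _ _ ar) /le_trans; apply.
  have -> : r * (2 * (r + r^-1)) = 2 * (1 + r ^+ 2) by field; rewrite gt_eqF.
  exact: lexx.
have h2 : `|a ^+ 2 * (pi / 2 - atan (a / n))| <= n * a.
  have [->|an] := eqVneq a 0; first by rewrite expr0n mul0r normr0 mulr0.
  have {}a0 : 0 < a by rewrite lt_neqAle eq_sym an.
  have p0 : 0 <= pi / 2 - atan (a / n) by rewrite subr_ge0 ltW // atan_ltpi2.
  rewrite ger0_norm; last by apply: mulr_ge0 => //; exact: sqr_ge0.
  have -> : n * a = a ^+ 2 * (a / n)^-1 by field; rewrite !gt_eqF.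
  by rewrite ler_wpM2l ?sqr_ge0 // atan_pihalf // divr_gt0.
have h3 : `|n ^+ 2 * atan (a / n)| <= n * (2 * n).
  rewrite normrM ger0_norm ?sqr_ge0 //.
  have : `|atan (a / n)| <= 2.
    rewrite ler_norml; have := atan_ltpi2 (a / n); have := atan_gtNpi2 (a / n).
    have := @pihalf_lt2 R; lra.
  move=> /(ler_wpM2l (sqr_ge0 n)); nra.
have -> : (a ^+ 2 - n ^+ 2) * atan (a / n) - a * n * (ln r + ln r) - pi / 2 * (a * a)
  = - (a ^+ 2 * (pi / 2 - atan (a / n))) - n ^+ 2 * atan (a / n) - n * (a * (ln r + ln r)) by ring.
apply: le_trans (ler_normB _ _) _; apply: le_trans (lerD (ler_normB _ _) (lexx _)) _.
rewrite normrN [`|n * _|]normrM (gtr0_norm n0).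
have := ler_wpM2l (ltW n0) h1; rewrite r2E; nra.
Qed.

End SingularSolution.

(** * Continuity of the singular function in the whole plane *)

Section SingularContinuity.
Variable R : realType.

Lemma near_prodP (p : R * R) (A : R -> R -> Prop) :
  (\forall q \near p, A q.1 q.2) <->
  exists2 d : R, 0 < d & forall x y, `|x - p.1| < d -> `|y - p.2| < d -> A x y.
Proof.
split.
  move=> /nbhs_ballP [d /= d0 H]; exists d => // x y xd yd.
  by apply: (H (x, y)); split; rewrite /= /ball /= distrC.
move=> [d d0 H]; apply/nbhs_ballP; exists d => //= -[x y] [] /=.
by rewrite /ball /= => h1 h2; apply: H; rewrite distrC.
Qed.

Lemma cont2P (u : R -> R -> R) : (forall x y e, 0 < e -> exists2 d : R, 0 < d &
    forall x' y', `|x' - x| < d -> `|y' - y| < d -> `|u x' y' - u x y| <= e) -> cont2 u.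
Proof.
move=> H p; apply/cvgrPdist_le => e e0.
apply/(near_prodP p (fun x y => `|u p.1 p.2 - u x y| <= e)).
have [d d0 D] := H p.1 p.2 e e0; exists d => // x y h1 h2.
by rewrite distrC; exact: D.
Qed.

Lemma sing_cont2 : cont2 (@sing R).
Proof.
have ck : continuous (fun a : R => a * `|a|).
  by move=> a; apply: continuousM => //; exact: norm_continuous.
have -> : @sing R = (fun a n : R => pi / 2 * (a * `|a|) + (sing a n - pi / 2 * (a * `|a|))).
  by apply/funext => a; apply/funext => n; rewrite addrC subrK.
apply: cont2D.
  apply: (cont2_fst (g := fun a => pi / 2 * (a * `|a|))) => a.
  by apply: cvgM; [exact: cvg_cst|exact: ck].
move=> [a n]; pose F (p : R * R) := sing p.1 p.2 - pi / 2 * (p.1 * `|p.1|).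
suff [l lE Fl] : exists2 l, F (a, n) = l & F @ (a, n) --> l by move: Fl; rewrite -lE.
have [n0|n0] := ltP 0 n; last first.
  (* [(|n| + n) / 2] is the positive part of [n]: with it the estimate near the axis holds on both
     sides, because for [n <= 0] the function equals its boundary trace. *)
  pose g (p : R * R) : R := (`|p.2| + p.2) / 2 * (`|p.1| + 2 * p.2 + 2 * (1 + p.1 ^+ 2 + p.2 ^+ 2)).
  have c1 : (fst : R * R -> R) @ (a, n) --> a by exact: cvg_fst.
  have c2 : (snd : R * R -> R) @ (a, n) --> n by exact: cvg_snd.
  have cg : g @ (a, n) --> (0 : R).
    have <- : (`|n| + n) / 2 * (`|a| + 2 * n + 2 * (1 + a ^+ 2 + n ^+ 2)) = 0.
      by rewrite ler0_norm // addrC subrr !mul0r.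
    apply: cvgM.
      by apply: cvgM; [apply: cvgD => //; exact: cvg_norm|exact: cvg_cst].
    apply: cvgD; first apply: cvgD.
    - exact: cvg_norm.
    - by apply: cvgM; [exact: cvg_cst|exact: c2].
    - apply: cvgM; first exact: cvg_cst.
      apply: cvgD; first apply: cvgD; first exact: cvg_cst.
        exact: (cvgM c1 c1).
      exact: (cvgM c2 c2).
  have E0 : sing a n - pi / 2 * (a * `|a|) = 0 by rewrite /sing ltNge n0 /= subrr.
  exists 0 => //; apply/norm_cvg0P.
  have cN : (fun p => - g p) @ (a, n) --> (0 : R) by rewrite -oppr0; exact: cvgN.
  apply: (squeeze_cvgr _ (cvg_cst 0) cg).
  near=> p; rewrite normr_ge0 /= /g /F.
  have [p0|p0] := ltP 0 p.2; last by rewrite /sing ltNge p0 /= subrr normr0 ler0_norm // addrC subrr !mul0r.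
  have -> : (`|p.2| + p.2) / 2 = p.2 by rewrite gtr0_norm //; field.
  exact: sing_near_axis.
have cn : {for (a, n), continuous (fun p : R * R => (p.1 ^+ 2 - p.2 ^+ 2) * atan (p.1 / p.2)
    - p.1 * p.2 * ln (p.1 ^+ 2 + p.2 ^+ 2) - pi / 2 * (p.1 * `|p.1|))}.
  have c1 : (fst : R * R -> R) @ (a, n) --> a by exact: cvg_fst.
  have c2 : (snd : R * R -> R) @ (a, n) --> n by exact: cvg_snd.
  have s1 : (fun p : R * R => p.1 ^+ 2) @ (a, n) --> a ^+ 2 by exact: (cvgM c1 c1).
  have s2 : (fun p : R * R => p.2 ^+ 2) @ (a, n) --> n ^+ 2 by exact: (cvgM c2 c2).
  apply: cvgB; first apply: cvgB.
  - apply: cvgM; first exact: cvgB.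
    apply: (@cvg_comp _ _ _ (fun p : R * R => p.1 / p.2) (@atan R) _ (nbhs (a / n))).
      by apply: cvgM => //; apply: cvgV => //; rewrite gt_eqF.
    exact: continuous_atan.
  - apply: cvgM; first exact: cvgM.
    apply: (@cvg_comp _ _ _ (fun p : R * R => p.1 ^+ 2 + p.2 ^+ 2) (@ln R) _ (nbhs (a ^+ 2 + n ^+ 2))).
      exact: cvgD.
    by apply: continuous_ln; exact: sqD_gt0.
  - apply: cvgM; first exact: cvg_cst.
    by apply: cvgM => //; exact: cvg_norm.
have En : sing a n = (a ^+ 2 - n ^+ 2) * atan (a / n) - a * n * ln (a ^+ 2 + n ^+ 2).
  by rewrite /sing n0.
exists ((a ^+ 2 - n ^+ 2) * atan (a / n) - a * n * ln (a ^+ 2 + n ^+ 2) - pi / 2 * (a * `|a|)).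
  by rewrite /F En.
apply: cvg_trans cn; apply: near_eq_cvg.
apply/(near_prodP (a, n) (fun x y => (x ^+ 2 - y ^+ 2) * atan (x / y)
    - x * y * ln (x ^+ 2 + y ^+ 2) - pi / 2 * (x * `|x|) = sing x y - pi / 2 * (x * `|x|))).
exists n => // x y _ /=; rewrite ltr_norml /sing => h.
by rewrite ifT //; lra.
Unshelve. all: by end_near. Qed.

End SingularContinuity.

(** * Plane Lebesgue measure and area preserving maps *)

Section Area.
Variable R : realType.
Implicit Types (A B : set (R * R)).

(** The sigma-algebra here is generated by measurable rectangles, so an open set is exhibited as a
    countable union of squares with rational centre and radius. *)
Lemma open2_measurable A : open A -> measurable A.
Proof.
move=> oA.
pose rect (q1 q2 r : rat) : set (R * R) :=
  [set x : R | `|x - ratr q1| < ratr r] `*` [set y : R | `|y - ratr q2| < ratr r].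
have mb (q r : rat) : measurable [set x : R | `|x - ratr q| < ratr r].
  apply: open_measurable; rewrite (_ : mkset _ = ball (ratr q : R) (ratr r)).
    exact: ball_open.
  by apply/seteqP; split => x; rewrite /ball /= distrC.
have -> : A = \bigcup_q1 \bigcup_q2 \bigcup_r
    (if `[< rect q1 q2 r `<=` A >] then rect q1 q2 r else set0).
  apply/seteqP; split => [p Ap|p [q1 _ [q2 _ [r _]]]]; last first.
    by case: asboolP => // H /H.
  have [d /= d0 D] := (nbhs_ballP _ _).1 (open_nbhs_nbhs (conj oA Ap)).
  have [r hr] : exists r : rat, d / 4 < ratr r < d / 2.
    have : d / 4 < d / 2 by lra.
    by move=> /rat_in_itvoo[r]; rewrite in_itv /= => hr; exists r.
  have [q1 h1] : exists q : rat, p.1 - d / 4 < ratr q < p.1.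
    have : p.1 - d / 4 < p.1 by lra.
    by move=> /rat_in_itvoo[q]; rewrite in_itv /= => hr'; exists q.
  have [q2 h2] : exists q : rat, p.2 - d / 4 < ratr q < p.2.
    have : p.2 - d / 4 < p.2 by lra.
    by move=> /rat_in_itvoo[q]; rewrite in_itv /= => hr'; exists q.
  exists q1 => //; exists q2 => //; exists r => //.
  case: asboolP => [_|[]]; first by split => /=; rewrite ger0_norm; lra.
  move=> x [] /=; rewrite !ltr_norml => x1 x2; apply: D.
  by split; rewrite /ball /= ltr_norml; lra.
apply: bigcupT_measurable_rat => q1; apply: bigcupT_measurable_rat => q2.
apply: bigcupT_measurable_rat => r; case: ifPn => // _.
by apply: measurableX; exact: mb.
Qed.

Lemma closed2_measurable A : closed A -> measurable A.
Proof. by move/closed_openC/open2_measurable/measurableC; rewrite setCK. Qed.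

Lemma area_ge0 A : (0 <= lebesgue2 A)%E.
Proof. exact: measure_ge0. Qed.

Lemma le_area A B : measurable A -> measurable B -> A `<=` B ->
  (lebesgue2 A <= lebesgue2 B)%E.
Proof. by move=> mA mB AB; apply: le_measure; rewrite ?inE. Qed.

Lemma areaX (X Y : set R) : measurable X -> measurable Y ->
  lebesgue2 (X `*` Y) = (lebesgue_measure X * lebesgue_measure Y)%E.
Proof. by move=> mX mY; rewrite /lebesgue2 product_measure1E. Qed.

Lemma area_null_sub A B : measurable A -> measurable B -> A `<=` B ->
  lebesgue2 B = 0%E -> lebesgue2 A = 0%E.
Proof.
by move=> mA mB AB B0; apply/eqP; rewrite eq_le area_ge0 andbT -B0 le_area.
Qed.

Lemma area_nullU A B : measurable A -> measurable B ->
  lebesgue2 A = 0%E -> lebesgue2 B = 0%E -> lebesgue2 (A `|` B) = 0%E.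
Proof.
move=> mA mB A0 B0; apply/eqP; rewrite eq_le area_ge0 andbT.
have : (lebesgue2 (A `|` B) <= lebesgue2 A + lebesgue2 B)%E by apply: measureU2.
by rewrite A0 B0 adde0.
Qed.

Lemma area_sections0 A : (forall x, lebesgue_measure (xsection A x) = 0%E) ->
  lebesgue2 A = 0%E.
Proof. by move=> H; rewrite /lebesgue2 /product_measure1 integral0_eq // => x _ /=. Qed.

Lemma area_graph0 (g : R -> R) : lebesgue2 [set p | p.2 = g p.1] = 0%E.
Proof.
apply: area_sections0 => x.
have -> : xsection [set p : R * R | p.2 = g p.1] x = [set g x].
  by apply/seteqP; split => y; rewrite /xsection /= inE.
exact: lebesgue_measure_set1.
Qed.

Lemma area_rect (a b c d : R) : a <= b -> c <= d ->
  lebesgue2 [set p | a < p.1 < b /\ c < p.2 < d] = ((b - a) * (d - c))%:E.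
Proof.
move=> ab cd.
have -> : [set p : R * R | a < p.1 < b /\ c < p.2 < d] = `]a, b[ `*` `]c, d[.
  by apply/seteqP; split => -[x y] /=; rewrite !in_itv.
rewrite areaX //.
have E (x y : R) : x <= y -> lebesgue_measure `]x, y[ = (y - x)%:E :> \bar R.
  by rewrite lebesgue_measure_itv /= lte_fin; case: ltgtP => // -> _; rewrite subrr.
by rewrite !E // EFinM.
Qed.

Lemma area_crect (a b c d : R) : a <= b -> c <= d ->
  lebesgue2 [set p | a <= p.1 <= b /\ c <= p.2 <= d] = ((b - a) * (d - c))%:E.
Proof.
move=> ab cd.
have -> : [set p : R * R | a <= p.1 <= b /\ c <= p.2 <= d] = `[a, b] `*` `[c, d].
  by apply/seteqP; split => -[x y] /=; rewrite !in_itv.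
rewrite areaX //.
have E (x y : R) : x <= y -> lebesgue_measure `[x, y] = (y - x)%:E :> \bar R.
  by rewrite lebesgue_measure_itv /= lte_fin; case: ltgtP => // -> _; rewrite subrr.
by rewrite !E // EFinM.
Qed.

Lemma measurable_rect (a b c d : R) :
  measurable [set p : R * R | a < p.1 < b /\ c < p.2 < d].
Proof.
have -> : [set p : R * R | a < p.1 < b /\ c < p.2 < d] = `]a, b[ `*` `]c, d[.
  by apply/seteqP; split => -[x y] /=; rewrite !in_itv.
exact: measurableX.
Qed.

Lemma measurable_crect (a b c d : R) :
  measurable [set p : R * R | a <= p.1 <= b /\ c <= p.2 <= d].
Proof.
have -> : [set p : R * R | a <= p.1 <= b /\ c <= p.2 <= d] = `[a, b] `*` `[c, d].
  by apply/seteqP; split => -[x y] /=; rewrite !in_itv.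
exact: measurableX.
Qed.

(** Lebesgue measure is determined by its values on half-open intervals, and a translation preserves
    these. *)
Lemma lebesgue_measure_shift (b : R) (X : set R) : measurable X ->
  lebesgue_measure ((fun y => y + b) @^-1` X) = lebesgue_measure X.
Proof.
move=> mX; pose f : R -> measurableTypeR R := fun y => y + b.
have mf : measurable_fun setT f.
  by apply: measurable_funD; [exact: measurable_id|exact: measurable_cst].
have := @lebesgue_measure_unique R (pushforward lebesgue_measure f).
move=> H; apply/esym; apply: H => // _ [[u v]] _ <-.
rewrite /= /pushforward.
rewrite (_ : f @^-1` _ = `]u - b, v - b]%classic); last first.
  by apply/seteqP; split => y /=; rewrite /f !in_itv /= ltrBlDr lerBrDr.
rewrite !lebesgue_measure_itv /= !lte_fin ltrD2r.
by case: ifP => // _; rewrite -!EFinB; congr (_%:E); ring.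
Qed.

Lemma lebesgue_measure_reflect (b : R) (X : set R) : measurable X ->
  lebesgue_measure ((fun y => b - y) @^-1` X) = lebesgue_measure X.
Proof.
move=> mX; pose f : R -> measurableTypeR R := fun y => b - y.
have mf : measurable_fun setT f.
  by apply: measurable_funB; [exact: measurable_cst|exact: measurable_id].
rewrite -[RHS](lebesgue_measure_shift b mX).
have mX' : measurable ((fun y => y + b) @^-1` X).
  rewrite -[X in measurable X]setTI.
  by apply: (measurable_funD (f := id) (g := cst b)).
rewrite -[RHS](lebesgue_measureN mX') /pushforward.
by congr (lebesgue_measure _); apply/seteqP; split => y /=; rewrite addrC.
Qed.

(** On each vertical section a shear is a translation. Shears, sheared reflections and the exchange
    of coordinates generate all the linear changes of variables needed below, which avoids a general
    determinant formula. *)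
Lemma area_shear (k : R -> R) A : measurable A ->
  lebesgue2 ((fun p => (p.1, p.2 + k p.1)) @^-1` A) = lebesgue2 A.
Proof.
move=> mA; rewrite /lebesgue2 /product_measure1; apply: eq_integral => x _ /=.
rewrite -(lebesgue_measure_shift (k x) (measurable_xsection x mA)).
by congr (lebesgue_measure _); apply/seteqP; split => y; rewrite /xsection /= !inE.
Qed.

Lemma area_shear_reflect (k : R -> R) A : measurable A ->
  lebesgue2 ((fun p => (p.1, k p.1 - p.2)) @^-1` A) = lebesgue2 A.
Proof.
move=> mA; rewrite /lebesgue2 /product_measure1; apply: eq_integral => x _ /=.
rewrite -(lebesgue_measure_reflect (k x) (measurable_xsection x mA)).
by congr (lebesgue_measure _); apply/seteqP; split => y; rewrite /xsection /= !inE.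
Qed.

Definition flip (p : R * R) : R * R := (p.2, p.1).

Lemma area_flip A : measurable A -> lebesgue2 (flip @^-1` A) = lebesgue2 A.
Proof.
move=> mA.
pose f : measurableTypeR R * measurableTypeR R -> measurableTypeR R * measurableTypeR R := flip.
have mf : measurable_fun setT f.
  by apply: measurable_fun_pair; [exact: measurable_snd|exact: measurable_fst].
have := @product_measure_unique _ _ _ _ R lebesgue_measure lebesgue_measure
  (pushforward (lebesgue_measure \x lebesgue_measure)%E f).
move=> H; apply/esym; apply: H => // X Y mX mY.
rewrite /= /pushforward.
have -> : flip @^-1` (X `*` Y) = Y `*` X by apply/seteqP; split => -[x y] [].
by rewrite product_measure1E // muleC.
Qed.

Lemma continuous_measurable2 (f : R * R -> R * R) A :
  continuous f -> measurable A -> measurable (f @^-1` A).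
Proof.
move=> cf mA.
have m (g : R * R -> R) : continuous g -> measurable_fun setT g.
  move=> cg; apply: (measurability _ (RGenOpens.measurableE R)).
  move=> _ [_ [a [b ->] <-]]; rewrite setTI; apply: open2_measurable.
  by move/continuousP: cg; apply; exact: interval_open.
have mf : measurable_fun setT f.
  rewrite (_ : f = (fun p => ((f p).1, (f p).2))); last by apply/funext => p; case: (f p).
  apply: measurable_fun_pair; apply: m => p.
    by apply: (@continuous_comp _ _ _ f fst); [exact: cf|exact: cvg_fst].
  by apply: (@continuous_comp _ _ _ f snd); [exact: cf|exact: cvg_snd].
by rewrite -[X in measurable X]setTI; exact: mf.
Qed.

End Area.

(** * Uniqueness of the gradient of a convex potential with given push-forward *)

Section GradientUniqueness.
Variable R : realType.
Implicit Types (x y z p v : R * R).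

Definition dot x y : R := x.1 * y.1 + x.2 * y.2.

Lemma near_along p v (A : set (R * R)) : (\forall x \near p, A x) ->
  exists2 t, 0 < t & A (p + t *: v).
Proof.
move=> /nbhs_ballP [d /= d0 D].
have s0 : 0 < 2 * (`|v.1| + `|v.2| + 1).
  by have := normr_ge0 v.1; have := normr_ge0 v.2; lra.
have t0 : 0 < d / (2 * (`|v.1| + `|v.2| + 1)) by exact: divr_gt0.
exists (d / (2 * (`|v.1| + `|v.2| + 1))) => //; apply: D.
have K (w : R) : `|w| <= `|v.1| + `|v.2| -> `|d / (2 * (`|v.1| + `|v.2| + 1)) * w| < d.
  move=> hw; rewrite normrM (gtr0_norm t0) mulrAC ltr_pdivrMr //.
  by have := normr_ge0 v.1; have := normr_ge0 v.2; have := normr_ge0 w; nra.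
split; rewrite /ball /= opprD addNKr normrN; apply: K.
  by rewrite lerDl.
by rewrite lerDr.
Qed.

Lemma area_open_gt0 (A : set (R * R)) p : open A -> A p -> (0 < lebesgue2 A)%E.
Proof.
move=> oA Ap; have [d /= d0 D] := (nbhs_ballP _ _).1 (open_nbhs_nbhs (conj oA Ap)).
have := @area_rect R (p.1 - d) (p.1 + d) (p.2 - d) (p.2 + d).
have -> : p.1 - d <= p.1 + d by lra.
have -> : p.2 - d <= p.2 + d by lra.
move=> /(_ isT isT) E.
set Q := [set q : R * R | _] in E.
have : (lebesgue2 Q <= lebesgue2 A)%E.
  apply: le_area; [exact: measurable_rect|exact: open2_measurable|].
  by move=> x [/= h1 h2]; apply: D; split; rewrite /ball /= ltr_norml; lra.
by apply: lt_le_trans; rewrite E lte_fin; apply: mulr_gt0; lra.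
Qed.

Lemma open_preimage_in (T : topologicalType) (U : set (R * R)) (f : R * R -> T) (B : set T) :
  open U -> (forall x, U x -> {for x, continuous f}) -> open B ->
  open (U `&` f @^-1` B).
Proof.
move=> oU cf oB; rewrite openE => x [Ux Bx]; apply: filterI.
  exact: open_nbhs_nbhs.
by apply: (cf x Ux); exact: open_nbhs_nbhs.
Qed.

Lemma continuous_dot (f g : R * R -> R * R) x : {for x, continuous f} ->
  {for x, continuous g} -> {for x, continuous (fun z => dot (f z) (g z))}.
Proof.
move=> cf cg.
have c1 (h : R * R -> R * R) : {for x, continuous h} -> (fun z => (h z).1) @ x --> (h x).1.
  by move=> ch; apply: (@continuous_comp _ _ _ h fst); [exact: ch|exact: cvg_fst].
have c2 (h : R * R -> R * R) : {for x, continuous h} -> (fun z => (h z).2) @ x --> (h x).2.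
  by move=> ch; apply: (@continuous_comp _ _ _ h snd); [exact: ch|exact: cvg_snd].
by apply: cvgD; apply: cvgM; [exact: c1|exact: c1|exact: c2|exact: c2].
Qed.

Lemma dot_gt0 x : x != 0 -> 0 < dot x x.
Proof.
case: x => a b; rewrite /dot /= => ab.
have [a0|a0] := eqVneq a 0; last by rewrite -!expr2 ltr_pwDl ?sqr_ge0 // exprn_even_gt0.
have b0 : b != 0 by apply: contraNneq ab => ->; rewrite a0.
by rewrite -!expr2 ltr_wpDl ?sqr_ge0 // exprn_even_gt0.
Qed.

Lemma dot_forth x p v (t : R) : dot x (p + t *: v - p) = t * dot x v.
Proof. by rewrite addrAC subrr add0r /dot /= /GRing.scale /=; ring. Qed.

Lemma dot_back x p v (t : R) : dot x (p - (p + t *: v)) = - (t * dot x v).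
Proof. by rewrite opprD addNKr /dot /= /GRing.scale /=; ring. Qed.

(* Aleksandrov's argument: if [G p <> H p], normalise [phi p = psi p] and let
   [M = {phi > psi}].  The open set [B] of slopes at which the conjugate of
   [psi] exceeds that of [phi] pulls back to a superset of [M] under [G], but
   to a subset of [M] missing a neighbourhood of [p] under [H]. *)
Lemma gradient_unique (U : set (R * R)) (K : R) (phi psi : R * R -> R) (G H : R * R -> R * R) :
  open U -> (lebesgue2 U < +oo)%E ->
  (forall x, U x -> `|x.1| <= K /\ `|x.2| <= K) ->
  (forall x, U x -> [/\ {for x, continuous phi}, {for x, continuous psi},
     {for x, continuous G} & {for x, continuous H}]) ->
  (forall x z, U x -> U z -> phi x + dot (G x) (z - x) <= phi z) ->
  (forall x z, U x -> U z -> psi x + dot (H x) (z - x) <= psi z) ->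
  (forall B, open B -> lebesgue2 (U `&` G @^-1` B) = lebesgue2 (U `&` H @^-1` B)) ->
  forall p, U p -> G p = H p.
Proof.
move=> oU finU bU cont sphi spsi mU p Up; apply/eqP/negPn/negP => GH.
pose v : R * R := G p - H p.
have v0 : 0 < dot v v by apply: dot_gt0; rewrite subr_eq0.
pose Phi x := phi x - phi p; pose Psi x := psi x - psi p.
pose M : set (R * R) := U `&` (fun x => Phi x - Psi x) @^-1` [set r | 0 < r].
pose B : set (R * R) := [set y | exists z (e : R), [/\ U z, 0 < e &
  forall x, U x -> dot x y - Phi x + e <= dot z y - Psi z]].
have cPhi x : U x -> {for x, continuous Phi}.
  by move=> /cont[c _ _ _]; apply: cvgB => //; exact: cvg_cst.
have cPsi x : U x -> {for x, continuous Psi}.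
  by move=> /cont[_ c _ _]; apply: cvgB => //; exact: cvg_cst.
have [cGp cHp] : {for p, continuous G} /\ {for p, continuous H} by have [] := cont p Up.
have nU : \forall x \near p, U x by exact: open_nbhs_nbhs.
(* The margin [e] in the definition of [B] survives a small change of the slope, because [U] is
   bounded. *)
have oB : open B.
  rewrite openE => y0 [z [e [Uz e0 Hz]]].
  have K0 : 0 <= K by have [h _] := bU z Uz; exact: le_trans h.
  have d0 : 0 < e / (8 * (K + 1)) by apply: divr_gt0 => //; lra.
  apply/nbhs_ballP; exists (e / (8 * (K + 1))) => //= y [/= h1 h2].
  exists z, (e / 2); split => //; first by rewrite divr_gt0.
  move=> x Ux; have := Hz x Ux.
  have [x1 x2] := bU x Ux; have [z1 z2] := bU z Uz.
  move: h1 h2; rewrite /ball /= => h1 h2.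
  have S (a b c : R) : `|a| <= K -> `|b| <= K -> `|c| < e / (8 * (K + 1)) -> (a - b) * c <= e / 4.
    move=> ha hb hc; apply: le_trans (ler_norm _) _; rewrite normrM.
    have hab : `|a - b| <= 2 * K by apply: le_trans (ler_normB _ _) _; lra.
    have E : e / (8 * (K + 1)) * (2 * (K + 1)) = e / 4 by field; rewrite gt_eqF //; lra.
    rewrite -E; have := normr_ge0 (a - b); have := normr_ge0 c; nra.
  have := S _ _ _ x1 z1 h1; have := S _ _ _ z1 x1 h1.
  have := S _ _ _ x2 z2 h2; have := S _ _ _ z2 x2 h2.
  rewrite /dot; lra.
have lim_dot (F : R * R -> R * R) (w : R * R) : {for p, continuous F} ->
    (fun x => dot (F x) w) @ p --> dot (F p) w.
  by move=> cF; apply: (@continuous_dot F (fun=> w)) => //; exact: cvg_cst.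
(* Moving from [p] against [v], the potential [Phi] drops below the plane of slope [H p], which
   supports [Psi] at [p]. *)
have [x1 Ux1 Hx1] : exists2 x1, U x1 & Phi x1 < dot (H p) (x1 - p).
  pose w := - v.
  have h : dot (G p) w < dot (H p) w.
    by move: v0; rewrite /w /v /dot /=; lra.
  have [t t0 [Ut Ht]] : exists2 t, 0 < t & (U `&` [set x | dot (G x) w < dot (H p) w]) (p + t *: w).
    apply: near_along; apply: filterI => //.
    exact: (cvgr_lt _ (lim_dot G w cGp) _ h).
  exists (p + t *: w) => //.
  have := sphi _ _ Ut Up; rewrite /Phi dot_back dot_forth.
  by move: Ht; rewrite /= -(ltr_pM2l t0); lra.
(* On [N] the supporting plane of [Psi] at [x] lies above [Phi] at [x1], so the conjugate of [Phi]
   at [H x] exceeds that of [Psi] and [H x] is not in [B]. *)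
pose N : set (R * R) := U `&` (fun x => dot (H x) (x1 - x) + Psi x - Phi x1) @^-1` [set r | 0 < r].
have oM : open M.
  apply: open_preimage_in => //.
  by move=> x Ux; apply: cvgB; [exact: cPhi|exact: cPsi].
have oN : open N.
  apply: open_preimage_in => //.
  move=> x Ux; have [_ _ _ cH] := cont x Ux.
  apply: cvgB; last exact: cvg_cst.
  apply: cvgD; last exact: cPsi.
  by apply: (@continuous_dot H (fun z => x1 - z)) => //; apply: cvgB; [exact: cvg_cst|exact: cvg_id].
have Np : N p by split => //=; rewrite /Psi subrr addr0 subr_gt0.
(* Moving along [v] instead, [Phi] outgrows [Psi]; hence the open set [M] meets [N] and loses
   positive area. *)
have [q Mq Nq] : exists2 q, M q & N q.
  have h : dot (H p) v < dot (G p) v by move: v0; rewrite /v /dot /=; lra.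
  have [t t0 [Nt Ht]] : exists2 t, 0 < t & (N `&` [set x | dot (H x) v < dot (G p) v]) (p + t *: v).
    apply: near_along; apply: filterI; first exact: open_nbhs_nbhs.
    exact: (cvgr_lt _ (lim_dot H v cHp) _ h).
  have Ut : U (p + t *: v) by case: Nt.
  exists (p + t *: v) => //; split => //=.
  have := spsi _ _ Ut Up; have := sphi _ _ Up Ut; rewrite /Phi /Psi dot_back dot_forth.
  by move: Ht; rewrite /= -(ltr_pM2l t0); lra.
have mM := open2_measurable oM; have mN := open2_measurable oN.
have oGB : open (U `&` G @^-1` B).
  by apply: open_preimage_in => // x /cont[].
have oHB : open (U `&` H @^-1` B).
  by apply: open_preimage_in => // x /cont[].
have MG : M `<=` U `&` G @^-1` B.
  move=> m [Um /= mPos]; split => //; exists m, (Phi m - Psi m); split => // x Ux.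
  have := sphi m x Um Ux; rewrite /Phi /Psi /dot /=; lra.
have HM : U `&` H @^-1` B `<=` M `\` N.
  move=> x [Ux [z [e [Uz e0 Hz]]]]; have sz := spsi x z Ux Uz; split.
    split => //=; have := Hz x Ux.
    by move: sz; rewrite /Phi /Psi /dot /=; lra.
  move=> [_ /=]; have := Hz x1 Ux1; move: sz; rewrite /Phi /Psi /dot /=; lra.
have finM : (lebesgue2 M < +oo)%E.
  by apply: le_lt_trans finU; apply: le_area => // [|x []//]; exact: open2_measurable.
have l1 : (lebesgue2 M <= lebesgue2 (M `\` N))%E.
  apply: le_trans (le_area mM (open2_measurable oGB) MG) _; rewrite mU //.
  by apply: le_area => //; [exact: open2_measurable oHB|exact: measurableD].
have MN0 : (0 < lebesgue2 (M `&` N))%E.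
  by apply: (@area_open_gt0 _ q); [exact: openI|split].
have E : lebesgue2 M = (lebesgue2 (M `\` N) + lebesgue2 (M `&` N))%E.
  exact: measureDI.
have finD : lebesgue2 (M `\` N) \is a fin_num.
  rewrite ge0_fin_numE; last exact: area_ge0.
  apply: le_lt_trans finM.
  by apply: le_area => //; exact: measurableD.
move: l1; rewrite E -[X in (_ <= X)%E]adde0 leeD2lE // => /(lt_le_trans MN0).
by rewrite ltxx.
Qed.

End GradientUniqueness.

(** * The potential on one half: behaviour near the diagonal and the origin *)

Section HalfPotential.
Variable R : realType.

(** Total differentiability of a curried function at a point, with the gradient [(A, B)] given
    explicitly. *)
Definition frechet (g : R -> R -> R) (x y A B : R) : Prop :=
  forall e, 0 < e -> exists2 d : R, 0 < d &
    forall x' y', `|x' - x| < d -> `|y' - y| < d ->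
      `|g x' y' - g x y - A * (x' - x) - B * (y' - y)| <= e * (`|x' - x| + `|y' - y|).

Lemma frechet_cont (g : R -> R -> R) (x y A B : R) : frechet g x y A B ->
  forall e, 0 < e -> exists2 d : R, 0 < d &
    forall x' y', `|x' - x| < d -> `|y' - y| < d -> `|g x' y' - g x y| <= e.
Proof.
move=> H e e0; have [d d0 D] := H 1 ltr01.
have k0 : 0 < `|A| + `|B| + 2 by have := normr_ge0 A; have := normr_ge0 B; lra.
pose r := Num.min d (e / (`|A| + `|B| + 2)).
exists r; first by rewrite lt_min d0 divr_gt0.
move=> x' y'; rewrite !lt_min => /andP[h1 h2] /andP[h3 h4].
have := D _ _ h1 h3; move: h2 h4; rewrite !ltr_pdivlMr // mul1r => h2 h4 h5.
have -> : g x' y' - g x y = (g x' y' - g x y - A * (x' - x) - B * (y' - y))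
  + (A * (x' - x) + B * (y' - y)) by ring.
apply: le_trans (ler_normD _ _) _; apply: le_trans (lerD h5 (ler_normD _ _)) _.
rewrite !normrM; move: h2 h4.
have := normr_ge0 A; have := normr_ge0 B; have := normr_ge0 (x' - x); have := normr_ge0 (y' - y).
set a := `|A|; set b := `|B|; set s := `|x' - x|; set t := `|y' - y| => *.
have : (a + b + 2) * Num.max s t <= e by rewrite /Num.max; case: ifP => _; lra.
have : s <= Num.max s t by rewrite le_max lexx.
have : t <= Num.max s t by rewrite le_max lexx orbT.
nra.
Qed.

Lemma frechet_derive_l (g : R -> R -> R) (x y A B : R) :
  frechet g x y A B -> is_derive x 1 (g ^~ y) A.
Proof.
move=> H; apply/is_deriveP => e e0; have [d d0 D] := H e e0; exists d => // z zd.
by have := D z y zd; rewrite subrr normr0 mulr0 subr0 addr0; apply.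
Qed.

Definition tri (s n : R) : bool := (0 < n) && (2 * `|s| < 1 - 3 * n).
Definition Tri : set (R * R) := [set p | tri p.1 p.2].
Definition Quad : set (R * R) := [set p | `|p.1| <= p.2 <= 1 / 2 - `|p.1| / 2].

Lemma measurable_Quad : measurable Quad.
Proof.
have c1 (p : R * R) : (fst : R * R -> R) @ p --> p.1 by exact: cvg_fst.
have c2 (p : R * R) : (snd : R * R -> R) @ p --> p.2 by exact: cvg_snd.
have m (g : R * R -> R) : continuous g -> measurable [set p | 0 <= g p].
  move=> cg; apply: closed2_measurable.
  have -> : [set p | 0 <= g p] = g @^-1` [set r | 0 <= r] by [].
  by move/continuous_closedP: cg; apply; exact: closed_ge.
have -> : Quad = [set p | 0 <= p.2 - `|p.1|] `&` [set p | 0 <= 1 / 2 - `|p.1| / 2 - p.2].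
  apply/seteqP; split => p /=; rewrite /Quad /=; first by move=> /andP[*]; split; lra.
  by move=> [h1 h2]; apply/andP; split; lra.
apply: measurableI; apply: m => p.
  by apply: cvgB; [exact: c2|exact: (cvg_norm (c1 p))].
apply: cvgB; last exact: c2.
apply: cvgB; first exact: cvg_cst.
by apply: cvgM; [exact: (cvg_norm (c1 p))|exact: cvg_cst].
Qed.

(* [f] is the potential on one half of the kite and [(P, Q)] its gradient, in the
   area preserving coordinates [x = s - n/2, y = s - 3n/2], where the diagonal is
   [n = 0] and the half of [Theta] becomes the cone-shaped [Quad]. *)
Record half_potential (f P Q : R -> R -> R) : Prop := HalfPotential {
  hp_sub : forall s n s' n', tri s n -> 0 <= n' -> 2 * `|s'| < 1 - 3 * n' ->
    f s n + P s n * (s' - s) + Q s n * (n' - n) <= f s' n';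
  hp_hess : forall s n, tri s n ->
    exists A B C, [/\ 0 < A, frechet P s n A B & frechet Q s n B C];
  hp_cone : forall s n, tri s n -> `|P s n| <= Q s n <= 1 / 2 - `|P s n| / 2;
  hp_even : forall s n, 0 <= n -> 2 * `|s| < 1 - 3 * n -> f (- s) n = f s n;
  hp_odd : forall s n, tri s n -> P (- s) n = - P s n;
  hp_cont : forall s0 e, 2 * `|s0| < 1 -> 0 < e -> exists2 d : R, 0 < d &
    forall s n, `|s - s0| < d -> 0 <= n < d -> `|f s n - f s0 0| <= e;
  hp_meas : forall B : set (R * R), measurable B ->
    measurable (Tri `&` [set p | B (P p.1 p.2, Q p.1 p.2)]);
  hp_area : forall B : set (R * R), measurable B ->
    lebesgue2 (Tri `&` [set p | B (P p.1 p.2, Q p.1 p.2)]) = lebesgue2 (Quad `&` B) }.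

Variables f P Q : R -> R -> R.
Hypothesis H : half_potential f P Q.

Lemma hp_mono s n s' n' : tri s n -> tri s' n' ->
  0 <= (P s n - P s' n') * (s - s') + (Q s n - Q s' n') * (n - n').
Proof.
move=> h h'; have /andP[n0 hs] := h; have /andP[n0' hs'] := h'.
have := hp_sub H h (ltW n0') hs'; have := hp_sub H h' (ltW n0) hs; lra.
Qed.

Lemma hp_P0 n : tri 0 n -> P 0 n = 0.
Proof. by move=> h; have := hp_odd H h; rewrite oppr0; lra. Qed.

Lemma hp_bound s n : tri s n -> [/\ - (1 / 3) <= P s n, P s n <= 1 / 3, 0 <= Q s n & Q s n <= 1 / 2].
Proof.
move=> /(hp_cone H) h; have := normr_ge0 (P s n); have := ler_norm (P s n).
have := ler_norm (- P s n); rewrite normrN => h'; split; lra.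
Qed.

(** The subgradient inequality at the intermediate point, averaged over the two ends. Only that
    point has to be in the open triangle, so the ends may lie on the diagonal. *)
Lemma hp_convex s n s1 n1 s2 n2 (t : R) : tri s n -> 0 <= t <= 1 ->
  s = t * s1 + (1 - t) * s2 -> n = t * n1 + (1 - t) * n2 ->
  0 <= n1 -> 2 * `|s1| < 1 - 3 * n1 -> 0 <= n2 -> 2 * `|s2| < 1 - 3 * n2 ->
  f s n <= t * f s1 n1 + (1 - t) * f s2 n2.
Proof.
move=> h /andP[t0 t1] Es En a1 b1 a2 b2.
have h1 := hp_sub H h a1 b1; have h2 := hp_sub H h a2 b2.
have t1' : 0 <= 1 - t by lra.
have := ler_wpM2l t0 h1; have := ler_wpM2l t1' h2.
have -> : s1 - s = (1 - t) * (s1 - s2) by rewrite Es; ring.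
have -> : n1 - n = (1 - t) * (n1 - n2) by rewrite En; ring.
have -> : s2 - s = - t * (s1 - s2) by rewrite Es; ring.
have -> : n2 - n = - t * (n1 - n2) by rewrite En; ring.
lra.
Qed.

(* Otherwise [f >= f 0 0 + m |s| + m n], so no gradient has [|P| < m] and [Q < m]. *)
Lemma flat_slope (m : R) : 0 < m -> exists2 t, 0 < t < 1 / 2 & f t 0 - f 0 0 < m * t.
Proof.
move=> m0; apply: contrapT => notE.
have {notE} L t : 0 < t < 1 / 2 -> m * t <= f t 0 - f 0 0.
  by move=> ht; rewrite leNgt; apply/negP => h; apply: notE; exists t.
(* Just above [(s, 0)] the drop of [f] towards the origin forces [P] to be nearly [m]; the cone
   gives [Q >= |P|], and the subgradient inequality carries this slope up to height [n]. *)
have step1 s n : 0 < s -> tri s n -> f 0 0 + m * s + m * n <= f s n.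
  move=> s0 h; have /andP[n0 hs] := h; rewrite (gtr0_norm s0) in hs.
  have L1 : m * s <= f s 0 - f 0 0 by apply: L; lra.
  apply/ler_addgt0Pr => e e0.
  pose e1 := Num.min (e / 3) (e * s / 4).
  have e10 : 0 < e1 by rewrite lt_min; apply/andP; split; [lra|rewrite divr_gt0 // mulr_gt0].
  have e1a : e1 <= e / 3 by rewrite ge_min lexx.
  have e1b : e1 <= e * s / 4 by rewrite ge_min lexx orbT.
  have [|d d0 D] := @hp_cont _ _ _ H s e1 _ e10; first by rewrite gtr0_norm //; lra.
  pose n1 := Num.min (Num.min (d / 2) (n / 2)) (Num.min (e * s / 4) (e / (3 * (m + e)))).
  have n10 : 0 < n1.
    rewrite !lt_min; apply/andP; split; first by apply/andP; split; lra.
    by rewrite !divr_gt0 ?mulr_gt0 // addr_gt0.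
  have n1d : n1 <= d / 2 by rewrite !ge_min lexx.
  have n1n : n1 <= n / 2 by rewrite !ge_min lexx orbT.
  have n1e : n1 <= e * s / 4 by rewrite !ge_min lexx !orbT.
  have n1m : n1 <= e / (3 * (m + e)) by rewrite !ge_min lexx !orbT.
  have tn1 : tri s n1 by rewrite /tri n10 gtr0_norm //=; lra.
  have := D s n1; rewrite subrr normr0 d0 => /(_ isT).
  have -> : 0 <= n1 < d by apply/andP; split; lra.
  move=> /(_ isT); rewrite ler_norml => /andP[D1 D2].
  have [p1 p2 q1 q2] := hp_bound tn1.
  have : m - e <= P s n1.
    have : f s n1 + P s n1 * (0 - s) + Q s n1 * (0 - n1) <= f 0 0.
      by apply: (hp_sub H); [exact: tn1|exact: lexx|rewrite normr0; lra].
    have : Q s n1 * n1 <= 1 / 2 * n1 by rewrite ler_wpM2r // ltW.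
    by move=> h1 h2; have := mulr_gt0 e0 s0; rewrite -(ler_pM2r s0 (m - e)); lra.
  have /andP[c1 _] := hp_cone H tn1; have c2 := ler_norm (P s n1).
  move=> c3.
  have c4 : f s n1 + P s n1 * (s - s) + Q s n1 * (n - n1) <= f s n.
    by apply: (hp_sub H); [exact: tn1|exact: ltW|rewrite gtr0_norm //; lra].
  have n3 : n <= 1 / 3 by move: s0 hs; clear - H; lra.
  have c5 : (m - e) * (n - n1) <= Q s n1 * (n - n1).
    by apply: ler_wpM2r; [move: n0 n1n; clear - H; lra|exact: le_trans c3 (le_trans c2 c1)].
  have c6 : m * n1 <= e / 3.
    have me : 0 < 3 * (m + e) by rewrite mulr_gt0 // addr_gt0.
    by move: n1m m0 e0 n10; rewrite ler_pdivlMr //; clear - H; nra.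
  have c7 : 0 <= e * n1 by rewrite mulr_ge0 // ltW.
  have c8 : e * n <= e / 3 by move: n3 e0; clear - H; nra.
  lra.
(* Evenness covers negative [s], and letting a positive [s1] tend to 0 covers the axis. *)
have step2 s n : tri s n -> f 0 0 + m * `|s| + m * n <= f s n.
  move=> h; have /andP[n0 hs] := h.
  have [s0|s0|s0] := ltrgtP 0 s.
  - by rewrite gtr0_norm //; exact: step1.
  - rewrite -(hp_even H (ltW n0) hs) (ltr0_norm s0); apply: step1; first lra.
    by rewrite /tri n0 normrN.
  rewrite -s0 in h hs *; rewrite normr0 mulr0 addr0; apply/ler_addgt0Pr => e e0.
  pose s1 := Num.min e ((1 - 3 * n) / 4).
  have n3 : 0 < 1 - 3 * n by apply: le_lt_trans hs; rewrite mulr_ge0.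
  have s10 : 0 < s1 by rewrite lt_min e0 divr_gt0.
  have s1a : s1 <= e by rewrite ge_min lexx.
  have s1b : s1 <= (1 - 3 * n) / 4 by rewrite ge_min lexx orbT.
  have h1 : tri s1 n by rewrite /tri n0 gtr0_norm //=; lra.
  have := step1 _ _ s10 h1; have [p1 p2 q1 q2] := hp_bound h1.
  have : f s1 n + P s1 n * (0 - s1) + Q s1 n * (n - n) <= f 0 n.
    by apply: (hp_sub H); [exact: h1|exact: ltW|rewrite normr0 mulr0].
  have : 0 <= m * s1 by rewrite mulr_ge0 // ltW.
  have : P s1 n * s1 <= 1 / 3 * s1 by rewrite ler_wpM2r // ltW.
  lra.
(* [k <= m / 2] contradicts the growth just proved, and [k <= 1 / 10] keeps the rectangle [B] inside
   [Quad], so that its preimage should have positive area. *)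
pose k := Num.min (m / 2) (1 / 10).
have k0 : 0 < k by rewrite lt_min; apply/andP; split; lra.
have km : k <= m / 2 by rewrite ge_min lexx.
have k10 : k <= 1 / 10 by rewrite ge_min lexx orbT.
pose B : set (R * R) := [set p | - k < p.1 < k /\ k < p.2 < 2 * k].
have mB : measurable B by exact: measurable_rect.
have := hp_area H mB.
have -> : Tri `&` [set p | B (P p.1 p.2, Q p.1 p.2)] = set0.
  apply/seteqP; split => // -[s n] [] /=; rewrite /Tri /= => h [] /= hP hQ.
  have /andP[n0 hs] := h.
  have : f s n + P s n * (0 - s) + Q s n * (0 - n) <= f 0 0.
    by apply: (hp_sub H); [exact: h|exact: lexx|rewrite normr0; lra].
  have := step2 s n h.
  have : P s n * s <= k * `|s|.
    apply: le_trans (ler_norm _) _; rewrite normrM ler_wpM2r // ler_norml; lra.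
  have : Q s n * n < m * n by rewrite ltr_pM2r //; lra.
  have : k * `|s| <= m * `|s| by rewrite ler_wpM2r //; lra.
  by by move=> *; suff : False by []; lra.
have -> : Quad `&` B = B.
  apply/seteqP; split => [p []//|p [h1 h2]]; split => //=.
  have : `|p.1| < k by rewrite ltr_norml.
  by have := normr_ge0 p.1; move=> *; apply/andP; split; lra.
rewrite /B area_rect; [|lra|lra].
rewrite /lebesgue2 measure0 => -[].
have : 0 < (k - - k) * (2 * k - k) by apply: mulr_gt0; lra.
lra.
Qed.

(** A large [P] near the origin would, by the subgradient inequality tested at [(t, 0)], make [f]
    rise by more along the diagonal than [flat_slope] permits; oddness gives the other sign. *)
Lemma P_vanishes_at_0 (e : R) : 0 < e -> exists2 d : R, 0 < d &
  forall s n, tri s n -> `|s| < d -> n < d -> `|P s n| <= e.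
Proof.
move=> e0; have e8 : 0 < e / 8 by lra.
have [t /andP[t0 t1] Ht] := flat_slope e8.
have et : 0 < e * t / 8 by rewrite divr_gt0 // mulr_gt0.
have [|d d0 D] := @hp_cont _ _ _ H 0 _ _ et; first by rewrite normr0; lra.
pose r := Num.min d (Num.min (t / 2) (e * t / 8)).
have r0 : 0 < r by rewrite !lt_min d0 et divr_gt0.
have rd : r <= d by rewrite !ge_min lexx.
have rt : r <= t / 2 by rewrite !ge_min lexx orbT.
have re : r <= e * t / 8 by rewrite !ge_min lexx !orbT.
exists r => //.
have K s n : tri s n -> `|s| < r -> n < r -> P s n <= e.
  move=> h hs hn; have /andP[n0 _] := h.
  have := D s n; rewrite subr0.
  have -> : `|s| < d by lra.
  have -> : 0 <= n < d by apply/andP; split; lra.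
  move=> /(_ isT isT); rewrite ler_norml => /andP[D1 D2].
  have h1 : f s n + P s n * (t - s) + Q s n * (0 - n) <= f t 0.
    by apply: (hp_sub H); [exact: h|exact: lexx|rewrite gtr0_norm //; lra].
  have [p1 p2 q1 q2] := hp_bound h.
  have hn' : Q s n * n <= 1 / 2 * n by rewrite ler_wpM2r // ltW.
  have ts : t / 2 <= t - s by move: hs; rewrite ltr_norml; lra.
  have P1 : P s n * (t - s) <= e * t / 2 by lra.
  rewrite leNgt; apply/negP => eP.
  have : e * (t / 2) < P s n * (t - s).
    apply: (@lt_le_trans _ _ (P s n * (t / 2))); first by rewrite ltr_pM2r //; lra.
    by rewrite ler_wpM2l // (le_trans (ltW e0)) // ltW.
  lra.
move=> s n h hs hn; rewrite ler_norml K // andbT.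
have h' : tri (- s) n by rewrite /tri normrN.
have := K (- s) n h'; rewrite normrN (hp_odd H h) => /(_ hs hn); lra.
Qed.

Lemma f_axis_ge n : 0 < n <= 1 / 8 -> f 0 0 <= f 0 n.
Proof.
move=> /andP[n0 n8]; apply/ler_addgt0Pr => e e0.
have [|d d0 D] := @hp_cont _ _ _ H 0 e _ e0; first by rewrite normr0; lra.
pose n1 := Num.min (d / 2) n.
have n10 : 0 < n1 by rewrite lt_min n0 divr_gt0.
have n1d : n1 <= d / 2 by rewrite ge_min lexx.
have n1n : n1 <= n by rewrite ge_min lexx orbT.
have h : tri 0 n1 by rewrite /tri n10 normr0 mulr0 /=; lra.
have := D 0 n1; rewrite subrr normr0 d0.
have -> : 0 <= n1 < d by apply/andP; split; lra.
move=> /(_ isT isT); rewrite ler_norml => /andP[D1 D2].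
have h1 : f 0 n1 + P 0 n1 * (0 - 0) + Q 0 n1 * (n - n1) <= f 0 n.
  by apply: (hp_sub H); [exact: h|exact: ltW|rewrite normr0; lra].
have [_ _ q1 _] := hp_bound h.
have : 0 <= Q 0 n1 * (n - n1) by apply: mulr_ge0; lra.
lra.
Qed.

(** Chord slopes of a convex function from a fixed end increase. *)
Lemma axis_slope_mono n n' : 0 < n -> n <= n' -> n' <= 1 / 8 ->
  (f 0 n - f 0 0) / n <= (f 0 n' - f 0 0) / n'.
Proof.
move=> n0 nn' n8; have n0' : 0 < n' by lra.
have t1 : n / n' <= 1 by rewrite ler_pdivrMr // mul1r.
have h : tri 0 n by rewrite /tri n0 normr0 mulr0 /=; lra.
have : f 0 n <= n / n' * f 0 n' + (1 - n / n') * f 0 0.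
  apply: hp_convex => //.
  - by rewrite t1 divr_ge0 // ltW.
  - by ring.
  - by field; rewrite gt_eqF.
  - exact: ltW.
  - by rewrite normr0 mulr0; lra.
  - by rewrite normr0; lra.
move=> K; rewrite ler_pdivrMr //.
have -> : (f 0 n' - f 0 0) / n' * n = n / n' * (f 0 n' - f 0 0) by ring.
lra.
Qed.

(* If [f] were constant on the segment, [P] would be [o(n)] above it, which is
   incompatible with [(P, Q)] preserving area. *)
Lemma diagonal_strict : f 0 0 < f (1 / 4) 0.
Proof.
rewrite ltNge; apply/negP => flat.
pose g n := f 0 n - f 0 0.
have g0 n : 0 < n <= 1 / 8 -> 0 <= g n by move=> /f_axis_ge; rewrite subr_ge0.
(* [(s, n)] lies on the segment from [(1 / 4, 0)], where [f] is at most [f 0 0] by assumption, to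
   the axis point [(0, n / (1 - t))], whose height is at most [2 * n]. *)
have up s n : 0 <= s <= 1 / 8 -> 0 < n <= 1 / 16 -> f s n <= f 0 0 + g (2 * n) / 2.
  move=> /andP[s0 s8] /andP[n0 n16].
  pose t := 4 * s; have t0 : 0 <= t by rewrite /t; lra.
  have t2 : 0 < 1 - t by rewrite /t; lra.
  have t3 : 1 / 2 <= 1 - t by rewrite /t; lra.
  have m0 : 0 < n / (1 - t) by rewrite divr_gt0.
  have m2 : n / (1 - t) <= 2 * n by rewrite ler_pdivrMr //; nra.
  have h : tri s n by rewrite /tri n0 ger0_norm //=; lra.
  have K : f s n <= t * f (1 / 4) 0 + (1 - t) * f 0 (n / (1 - t)).
    apply: hp_convex => //.
    - by apply/andP; split; lra.
    - by rewrite /t; field.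
    - by field; rewrite gt_eqF.
    - by rewrite gtr0_norm; lra.
    - exact: ltW.
    - by rewrite normr0 mulr0; lra.
  have := @axis_slope_mono (n / (1 - t)) (2 * n) m0 m2.
  have -> : 2 * n <= 1 / 8 by lra.
  move=> /(_ isT); rewrite -/(g _) -/(g _) => S.
  have E1 : g (n / (1 - t)) / (n / (1 - t)) * n = (1 - t) * g (n / (1 - t)).
    by field; rewrite !gt_eqF.
  have E2 : g (2 * n) / (2 * n) * n = g (2 * n) / 2 by field; rewrite gt_eqF.
  have {S} : g (n / (1 - t)) / (n / (1 - t)) * n <= g (2 * n) / (2 * n) * n.
    by rewrite ler_wpM2r // ltW.
  rewrite E1 E2 /g.
  have := ler_wpM2l t0 flat; lra.
have low s n : 0 <= s <= 1 / 8 -> 0 < n <= 1 / 16 -> f 0 0 + g n <= f s n.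
  move=> /andP[s0 s8] /andP[n0 n16].
  have h : tri 0 n by rewrite /tri n0 normr0 mulr0 /=; lra.
  have : f 0 n + P 0 n * (s - 0) + Q 0 n * (n - n) <= f s n.
    by apply: (hp_sub H); [exact: h|exact: ltW|rewrite ger0_norm //; lra].
  by rewrite (hp_P0 h) /g; lra.
(* The infimum of [E] is the right derivative of [g] at 0. Below [n2] all chord slopes agree up to
   [1 / 256], so [f (1 / 8) n - f s n <= n / 256]; as [1 / 8 - s] is at least [1 / 16], this gives
   [P <= n / 16]. *)
pose E := [set r | exists2 n, 0 < n <= 1 / 8 & r = g n / n].
have hE : has_inf E.
  split; first by exists (g (1 / 8) / (1 / 8)), (1 / 8) => //; apply/andP; split; lra.
  exists 0 => _ [n hn ->]; rewrite divr_ge0 ?g0 //; lra.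
have [_ [n2 /andP[n20 n28] ->] Hr] := @inf_adherent R E (1 / 256) (ltac:(lra)) hE.
pose n1 := n2 / 2.
have n10 : 0 < n1 by rewrite /n1; lra.
have n1E : 2 * n1 = n2 by rewrite /n1; field.
have bP s n : 0 <= s -> s < 1 / 16 -> 0 < n -> n < n1 -> 0 <= P s n <= n1 / 16.
  move=> s0 s16 n0 nn1.
  have h : tri s n by rewrite /tri n0 ger0_norm //=; lra.
  have h0 : tri 0 n by rewrite /tri n0 normr0 mulr0 /=; lra.
  apply/andP; split.
    have [->|sn0] := eqVneq s 0; first by rewrite hp_P0.
    have sp : 0 < s by rewrite lt_neqAle eq_sym sn0.
    have := hp_mono h h0; rewrite (hp_P0 h0) !subr0 subrr mulr0 addr0.
    by rewrite pmulr_lge0.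
  have h1 : f s n + P s n * (1 / 8 - s) + Q s n * (n - n) <= f (1 / 8) n.
    by apply: (hp_sub H); [exact: h|exact: ltW|rewrite gtr0_norm; lra].
  have u1 := up (1 / 8) n _ _; have l1 := low s n _ _.
  have hn : 0 < n <= 1 / 16 by move: n0 nn1 n28; clear - n1E H; lra.
  have n2n : 2 * n <= n2 by move: nn1; clear - n1E H; lra.
  have r1 : g (2 * n) / (2 * n) <= g n2 / n2 by apply: axis_slope_mono; rewrite ?mulr_gt0 // (le_trans n2n).
  have r2 : inf E <= g n / n.
    by apply: ge_inf; [case: hE|exists n => //; move: hn; clear - H; lra].
  have : g (2 * n) / 2 - g n <= n * (1 / 256).
    have -> : g (2 * n) / 2 - g n = n * (g (2 * n) / (2 * n) - g n / n).
      by field; rewrite gt_eqF.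
    by move: r1 r2 Hr; clear - n0 H; rewrite ler_pM2l //; lra.
  have {}u1 : f (1 / 8) n <= f 0 0 + g (2 * n) / 2 by apply: u1 => //; clear - H; lra.
  have {}l1 : f 0 0 + g n <= f s n by apply: l1 => //; move: s0 s16; clear - H; lra.
  move=> h2; have h3 : P s n * (1 / 8 - s) <= n / 256 by lra.
  rewrite leNgt; apply/negP => h4.
  have : n1 / 16 * (1 / 16) < P s n * (1 / 8 - s).
    apply: (@lt_le_trans _ _ (P s n * (1 / 16))); first by rewrite ltr_pM2r //; lra.
    by rewrite ler_wpM2l //; [by apply: ltW; apply: lt_trans h4; rewrite divr_gt0|move: s16; clear - H; lra].
  by move: nn1 n0 h3; clear - H; lra.
(* The gradient maps [A], of area [n1 / 8], into [B], of area only [n1 / 16]. *)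
pose B : set (R * R) := [set p | - (n1 / 16) <= p.1 <= n1 / 16 /\ 0 <= p.2 <= 1 / 2].
have mB : measurable B by exact: measurable_crect.
pose A : set (R * R) := [set p | - (1 / 16) < p.1 < 1 / 16 /\ 0 < p.2 < n1].
have AB : A `<=` Tri `&` [set p | B (P p.1 p.2, Q p.1 p.2)].
  move=> [s n] [/= hs hn].
  have h : tri s n.
    have hs' : `|s| < 1 / 16 by rewrite ltr_norml; lra.
    by apply/andP; split; [case/andP: hn|have /andP[] := hn; lra].
  have [_ _ q1 q2] := hp_bound h.
  split => //; split => /=; last lra.
  have [s0|s0] := leP 0 s.
    by have := bP s n; lra.
  have h' : tri (- s) n by rewrite /tri normrN.
  by have := bP (- s) n; rewrite (hp_odd H h); lra.
have := le_area (measurable_rect _ _ _ _) (hp_meas H mB) AB.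
rewrite (hp_area H mB) => K.
have {K} := le_trans K (le_area (measurableI _ _ measurable_Quad mB) mB (@subIsetr _ Quad B)).
rewrite /A /B; move: n10; clear - H => n10; rewrite area_rect ?area_crect ?lee_fin; lra.
Qed.

(** Uniformity in [n] matters: every small slope [a] is then attained by [P ^~ n] within
    [|s| < 1 / 4], so the inverse of [P] is defined on a full rectangle. The bound is the
    subgradient inequality at [(1 / 4, n)] tested at the origin. *)
Lemma P_lower_at_quarter : exists2 r, 0 < r &
  forall n, 0 < n < r -> r < P (1 / 4) n.
Proof.
have S := diagonal_strict; pose c := f (1 / 4) 0 - f 0 0.
have c0 : 0 < c by rewrite subr_gt0.
have c4 : 0 < c / 4 by rewrite divr_gt0.
have [|d d0 D] := @hp_cont _ _ _ H (1 / 4) _ _ c4; first by rewrite gtr0_norm; lra.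
pose r := Num.min (Num.min d (1 / 8)) (c / 2).
have r0 : 0 < r by rewrite !lt_min d0 divr_gt0 // andbT; lra.
have rd : r <= d by rewrite !ge_min lexx.
have r8 : r <= 1 / 8 by rewrite !ge_min lexx orbT.
have rc : r <= c / 2 by rewrite !ge_min lexx !orbT.
exists r => // n /andP[n0 nr].
have h : tri (1 / 4) n by rewrite /tri n0 gtr0_norm /=; lra.
have := D (1 / 4) n; rewrite subrr normr0 d0.
have -> : 0 <= n < d by apply/andP; split; lra.
move=> /(_ isT isT); rewrite ler_norml => /andP[D1 D2].
have h1 : f (1 / 4) n + P (1 / 4) n * (0 - 1 / 4) + Q (1 / 4) n * (0 - n) <= f 0 0.
  by apply: (hp_sub H); [exact: h|exact: lexx|rewrite normr0; lra].
have [_ _ q1 q2] := hp_bound h.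
have : 0 <= Q (1 / 4) n * n by apply: mulr_ge0; lra.
have : Q (1 / 4) n * n <= 1 / 2 * n by rewrite ler_wpM2r // ltW.
rewrite /c in c0 c4 rc D1 D2 *; lra.
Qed.

End HalfPotential.

(** * Inverting [P] in the first variable *)

Section PartialLegendre.
Variable R : realType.
Variables f P Q : R -> R -> R.
Hypothesis H : half_potential f P Q.
Implicit Types (s n a v e : R).

Lemma P_derive s n : tri s n -> exists2 A, 0 < A & is_derive s 1 (P ^~ n) A.
Proof.
by move=> /(hp_hess H) [A [B [C [A0 hP _]]]]; exists A => //; exact: frechet_derive_l hP.
Qed.

Lemma tri_between s1 s2 s n : tri s1 n -> tri s2 n -> s1 <= s <= s2 -> tri s n.
Proof.
move=> /andP[n0 h1] /andP[_ h2] hs; rewrite /tri n0 /=.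
have := ler_norm (- s1); have := ler_norm s2; rewrite normrN => ? ?.
suff : `|s| <= Num.max `|s1| `|s2|.
  by rewrite le_max => /orP[]; lra.
rewrite ler_norml le_max lerNl le_max.
by apply/andP; split; apply/orP; [left|right]; lra.
Qed.

Lemma P_increasing s1 s2 n : tri s1 n -> tri s2 n -> s1 < s2 -> P s1 n < P s2 n.
Proof.
move=> h1 h2 s12.
have D x : s1 <= x <= s2 -> exists2 A, 0 < A & is_derive x 1 (P ^~ n) A.
  by move=> hx; apply: P_derive; exact: tri_between hx.
have [|c hc E] := @MVT_derive R (P ^~ n) (fun x => 'D_1 (P ^~ n) x) s1 s2 s12.
  by move=> x /D[A A0 dA]; rewrite (derive_val (is_derive := dA)).
have [|A A0 dA] := D c; first by case/andP: hc => *; apply/andP; split; exact: ltW.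
move: E; rewrite (derive_val (is_derive := dA)) => E.
by rewrite -subr_gt0 E mulr_gt0 // subr_gt0.
Qed.

Variable L : R.
Hypothesis L0 : 0 < L.
Hypothesis L16 : L <= 1 / 16.
Hypothesis HL : forall n, 0 < n < 2 * L -> 2 * L < P (1 / 4) n.

Lemma tri_quarter s n : 0 < n < 2 * L -> `|s| <= 1 / 4 -> tri s n.
Proof. by move=> /andP[n0 n1] hs; have := L16; rewrite /tri n0 /=; lra. Qed.

Lemma P_neg_quarter n : 0 < n < 2 * L -> P (- (1 / 4)) n < - (2 * L).
Proof.
move=> hn; rewrite (hp_odd H) ?ltrN2 ?HL //; apply: tri_quarter => //.
by rewrite gtr0_norm.
Qed.

(* The inverse of [P ^~ n]; its graph is the partial Legendre transform in [s]. *)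
Definition solve (a n : R) : R := xget 0 [set s | `|s| < 1 / 4 /\ P s n = a].

Lemma solveP a n : `|a| < 2 * L -> 0 < n < 2 * L ->
  `|solve a n| < 1 / 4 /\ P (solve a n) n = a.
Proof.
move=> ha hn; rewrite /solve; case: xgetP => [s -> //|/=].
have t1 : tri (- (1 / 4)) n by apply: tri_quarter => //; rewrite normrN gtr0_norm.
have t2 : tri (1 / 4) n by apply: tri_quarter => //; rewrite gtr0_norm.
have h1 := P_neg_quarter hn; have h2 := HL hn.
have [|||s] := @IVT R (P ^~ n) (- (1 / 4)) (1 / 4) a.
- lra.
- apply: continuous_in_subspaceT => x; rewrite inE /= in_itv /= => hx.
  have [A _ dA] : exists2 A, 0 < A & is_derive x 1 (P ^~ n) A.
    by apply: P_derive; exact: tri_between hx.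
  exact: is_derive_cont dA.
- by move: ha; rewrite ltr_norml ge_min le_max => ha; apply/andP; split; apply/orP; [left|right]; lra.
rewrite in_itv /= => /andP[s1 s2] Ps /(_ s)[]; split => //.
move: ha; rewrite !ltr_norml => ha; apply/andP; split; rewrite lt_neqAle ?s1 ?s2 andbT.
  by apply/eqP => E; rewrite -E in Ps; lra.
by apply/eqP => E; rewrite E in Ps; lra.
Qed.

Lemma solve_tri a n : `|a| < 2 * L -> 0 < n < 2 * L -> tri (solve a n) n.
Proof. by move=> ha hn; have [h _] := solveP ha hn; apply: tri_quarter => //; exact: ltW. Qed.

Lemma solve_lt a n s : `|a| < 2 * L -> 0 < n < 2 * L -> tri s n ->
  (P s n < a) = (s < solve a n).
Proof.
move=> ha hn hs; have [_ h2] := solveP ha hn; have h3 := solve_tri ha hn.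
rewrite -[X in P s n < X]h2; case: (ltrgtP s (solve a n)) => [h|h|->].
- exact: P_increasing.
- by apply/negbTE; rewrite -leNgt ltW // P_increasing.
- by rewrite ltxx.
Qed.

Lemma solve_unique a n s : `|a| < 2 * L -> 0 < n < 2 * L -> tri s n -> P s n = a ->
  s = solve a n.
Proof.
move=> ha hn hs E; have [_ h2] := solveP ha hn; have h3 := solve_tri ha hn.
case: (ltrgtP s (solve a n)) => // h.
  by have := P_increasing hs h3 h; rewrite h2 E ltxx.
by have := P_increasing h3 hs h; rewrite h2 E ltxx.
Qed.

(** Strict monotonicity puts [a] strictly between the values of [P] at [s - e1] and [s + e1]; these
    two values move continuously with [n], so the solution stays trapped. *)
Lemma solve_cont a n e : `|a| < 2 * L -> 0 < n < 2 * L -> 0 < e ->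
  exists2 d : R, 0 < d & forall a' n', `|a' - a| < d -> `|n' - n| < d ->
    [/\ `|a'| < 2 * L, 0 < n' < 2 * L & `|solve a' n' - solve a n| < e].
Proof.
move=> ha hn e0; have [hs1 hs2] := solveP ha hn; have hs3 := solve_tri ha hn.
set s := solve a n in hs1 hs2 hs3 *.
have s4 : 0 < 1 / 4 - `|s| by rewrite subr_gt0.
have [e1 e10 [e1e e1s _]] := exists_pos_lt3 e0 s4 e0.
have bnd x : `|x - s| <= e1 -> `|x| <= 1 / 4.
  move=> hx; have -> : x = (x - s) + s by ring.
  by apply: le_trans (ler_normD _ _) _; lra.
have bp : `|s + e1| <= 1 / 4 by apply: bnd; rewrite addrAC subrr add0r gtr0_norm.
have bm : `|s - e1| <= 1 / 4 by apply: bnd; rewrite addrAC subrr add0r normrN gtr0_norm.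
have tp := tri_quarter hn bp; have tm := tri_quarter hn bm.
have ip : a < P (s + e1) n by rewrite -hs2; apply: P_increasing => //; lra.
have im : P (s - e1) n < a by rewrite -hs2; apply: P_increasing => //; lra.
have [Ap [Bp [Cp [_ fp _]]]] := hp_hess H tp.
have [Am [Bm [Cm [_ fm _]]]] := hp_hess H tm.
have [|dp dp0 Dp] := frechet_cont fp (e := (P (s + e1) n - a) / 2); first by rewrite divr_gt0 // subr_gt0.
have [|dm dm0 Dm] := frechet_cont fm (e := (a - P (s - e1) n) / 2); first by rewrite divr_gt0 // subr_gt0.
pose d := Num.min (Num.min (Num.min dp dm) (Num.min (2 * L - `|a|) (Num.min n (2 * L - n))))
  (Num.min ((P (s + e1) n - a) / 2) ((a - P (s - e1) n) / 2)).
have /andP[n0 n2] := hn.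
exists d; first by rewrite !lt_min dp0 dm0 n0 !divr_gt0 ?subr_gt0 // ha n2.
move=> a' n'; rewrite !lt_min => /andP[/andP[/andP[a1 a2] /andP[a3 a4]] /andP[a5 a6]].
move=> /andP[/andP[/andP[b1 b2] /andP[b3 /andP[b4 b5]]] /andP[b6 b7]].
have ha' : `|a'| < 2 * L.
  have -> : a' = (a' - a) + a by ring.
  by apply: le_lt_trans (ler_normD _ _) _; rewrite -ltrBrDr.
have hn' : 0 < n' < 2 * L by move: b4 b5; clear - H L0 L16 HL; rewrite !ltr_norml; lra.
split => //.
have tp' := tri_quarter hn' bp; have tm' := tri_quarter hn' bm.
have : s - e1 < solve a' n'.
  rewrite -(solve_lt ha' hn' tm').
  have := Dm (s - e1) n'; rewrite subrr normr0 => /(_ dm0 b2).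
  by move: a6; clear - H L0 L16 HL; rewrite ler_norml ltr_norml; lra.
have : solve a' n' < s + e1.
  have [_ E] := solveP ha' hn'.
  rewrite ltNge; apply/negP => h.
  have : P (s + e1) n' <= a'.
    move: h; rewrite le_eqVlt => /orP[/eqP ->|h]; first by rewrite E.
    by rewrite -[leRHS]E; apply: ltW; apply: P_increasing => //; exact: solve_tri.
  have := Dp (s + e1) n'; rewrite subrr normr0 => /(_ dp0 b1).
  by move: a5; clear - H L0 L16 HL; rewrite ler_norml ltr_norml; lra.
by move: e1e; clear - H L0 L16 HL; rewrite ltr_norml; lra.
Qed.

(** The implicit function theorem at a single point. Continuity of [solve] brings the new solution
    within reach of the expansion of [P], which gives the Lipschitz constant [K]; then the remainder
    is divided by [A]. *)
Lemma solve_frechet a n A B : `|a| < 2 * L -> 0 < n < 2 * L -> 0 < A ->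
  frechet P (solve a n) n A B -> frechet solve a n A^-1 (- B / A).
Proof.
move=> ha hn A0 hP e e0; have [hs1 hs2] := solveP ha hn.
set s := solve a n in hs1 hs2 hP *.
pose K := 2 * (1 + `|B| + A) / A.
have K0 : 0 < K by rewrite divr_gt0 // mulr_gt0 //; have := normr_ge0 B; lra.
pose eta := Num.min (A / 2) (e * A / (K + 1)).
have eta0 : 0 < eta by rewrite lt_min !divr_gt0 // ?mulr_gt0 // addr_gt0.
have etaA : eta <= A / 2 by rewrite ge_min lexx.
have etae : eta <= e * A / (K + 1) by rewrite ge_min lexx orbT.
have [d1 d10 D1] := hP eta eta0.
have [d2 d20 D2] := solve_cont ha hn d10.
exists (Num.min d1 d2); first by rewrite lt_min d10.
move=> a' n'; rewrite !lt_min => /andP[a1 a2] /andP[b1 b2].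
have [ha' hn' hs'] := D2 a' n' a2 b2.
have [_ hs2'] := solveP ha' hn'.
have := D1 _ _ hs' b1; rewrite hs2 hs2'; set s' := solve a' n'.
set x := s' - s; set y := n' - n; set z := a' - a => E.
have b : `|x| <= K * (`|z| + `|y|).
  have h : A * `|x| <= `|z| + `|B| * `|y| + eta * (`|x| + `|y|).
    rewrite -[A in A * _]gtr0_norm // -!normrM.
    have -> : A * x = z - B * y - (z - A * x - B * y) by ring.
    apply: le_trans (ler_normB _ _) _; apply: lerD => //.
    exact: ler_normB.
  have : eta * `|x| <= A / 2 * `|x| by rewrite ler_wpM2r.
  have : eta * `|y| <= A / 2 * `|y| by rewrite ler_wpM2r.
  have -> : K * (`|z| + `|y|) = (2 * (1 + `|B| + A) * (`|z| + `|y|)) / A by rewrite /K; ring.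
  rewrite ler_pdivlMr //.
  have := mulr_ge0 (normr_ge0 B) (normr_ge0 z); have := mulr_ge0 (ltW A0) (normr_ge0 z).
  have := mulr_ge0 (ltW A0) (normr_ge0 y); have := normr_ge0 y; have := normr_ge0 z; have := mulr_ge0 (normr_ge0 B) (normr_ge0 y).
  lra.
have -> : x - A^-1 * z - - B / A * y = - (z - A * x - B * y) / A by field; rewrite gt_eqF.
rewrite normrM normrN normfV (gtr0_norm A0) ler_pdivrMr //.
apply: le_trans E _.
have : eta * (`|x| + `|y|) <= e * A / (K + 1) * ((K + 1) * (`|z| + `|y|)).
  apply: ler_pM => //; [exact: ltW|].
  have := normr_ge0 z; have := normr_ge0 y; lra.
have -> : e * A / (K + 1) * ((K + 1) * (`|z| + `|y|)) = e * (`|z| + `|y|) * A.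
  by field; rewrite gt_eqF // addr_gt0.
by [].
Qed.

Lemma frechet_derive_r (g : R -> R -> R) (x y A B : R) :
  frechet g x y A B -> is_derive y 1 (g x) B.
Proof.
move=> hg; apply/is_deriveP => e e0; have [d d0 D] := hg e e0; exists d => // z zd.
by have := D x z; rewrite subrr normr0 mulr0 subr0 add0r; apply.
Qed.

Definition slope a n : R := Q (solve a n) n.

(** One Cauchy-Riemann equation: symmetry of the Hessian puts the same [B] in the derivatives of [P]
    and [Q], and both values are [B / A] up to sign. *)
Lemma solve_slope_derive a n : `|a| < 2 * L -> 0 < n < 2 * L -> exists c,
  is_derive a 1 (slope ^~ n) c /\ is_derive n 1 (solve a) (- c).
Proof.
move=> ha hn; have [A [B [C [A0 hP hQ]]]] := hp_hess H (solve_tri ha hn).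
have hS := solve_frechet ha hn A0 hP.
exists (B * A^-1); split.
  apply: (@derive_at_comp R (Q ^~ n) (solve ^~ n)).
    exact: frechet_derive_l hQ.
  exact: frechet_derive_l hS.
by rewrite -mulNr; exact: frechet_derive_r hS.
Qed.

(** On a level set of [P], monotonicity of the gradient says that [Q] increases with [v]. So the
    part below height [n] of a level set corresponds to the values of [Q] below [slope a n]. *)
Lemma slope_compare s v a n : `|a| < 2 * L -> 0 < n < 2 * L -> tri s v -> P s v = a ->
  (v < n -> Q s v <= slope a n) /\ (Q s v < slope a n -> v < n).
Proof.
move=> ha hn h E; have [h1 h2] := solveP ha hn; have h3 := solve_tri ha hn.
have := hp_mono H h h3; rewrite h2 E subrr mul0r add0r -/(slope a n) => M; split.
  move=> vn; rewrite leNgt; apply/negP => K.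
  have : (Q s v - slope a n) * (v - n) < 0 by rewrite pmulr_rlt0 ?subr_gt0 // subr_lt0.
  by rewrite ltNge M.
move=> K; move: M; rewrite nmulr_rge0 ?subr_lt0 // subr_le0 le_eqVlt.
move=> /orP[/eqP vE|//]; move: K; rewrite /slope.
by rewrite vE in h E *; rewrite -(solve_unique ha hn h E) ltxx.
Qed.

End PartialLegendre.

(** * Areas as real numbers *)

Section RealArea.
Variable R : realType.
Implicit Types (X Y : set (R * R)) (a b c d : R).

Definition box11 : set (R * R) := [set p | -1 <= p.1 <= 1 /\ 0 <= p.2 <= 1].

Definition ar X : R := fine (lebesgue2 X).

Lemma ar_fin X : measurable X -> X `<=` box11 -> lebesgue2 X \is a fin_num.
Proof.
move=> mX XB; rewrite ge0_fin_numE ?area_ge0 //.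
apply: le_lt_trans (le_area mX (measurable_crect _ _ _ _) XB) _.
by rewrite area_crect ?ltry //; lra.
Qed.

Lemma ar_mono X Y : measurable X -> measurable Y -> X `<=` Y -> Y `<=` box11 ->
  ar X <= ar Y.
Proof.
move=> mX mY XY YB; apply: fine_le; last exact: le_area.
  by apply: ar_fin => //; exact: subset_trans XY YB.
exact: ar_fin.
Qed.

Lemma ar_diff X Y : measurable X -> measurable Y -> X `<=` Y -> Y `<=` box11 ->
  ar Y - ar X = ar (Y `\` X).
Proof.
move=> mX mY XY YB.
have mD : measurable (Y `\` X) by exact: measurableD.
have fX : lebesgue2 X \is a fin_num by apply: ar_fin => //; exact: subset_trans XY YB.
have fD : lebesgue2 (Y `\` X) \is a fin_num by apply: ar_fin => // p [/YB].
have E : lebesgue2 Y = (lebesgue2 (Y `\` X) + lebesgue2 (Y `&` X))%E by exact: measureDI.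
rewrite /ar E (_ : Y `&` X = X); last by apply/setIidPr.
by rewrite fineD // addrK.
Qed.

Lemma ar_rect_le X a b c d : measurable X -> X `<=` box11 -> a <= b -> c <= d ->
  [set p | a < p.1 < b /\ c < p.2 < d] `<=` X -> (b - a) * (d - c) <= ar X.
Proof.
move=> mX XB ab cd rX; have := ar_mono (measurable_rect _ _ _ _) mX rX XB.
by rewrite {1}/ar area_rect.
Qed.

Lemma ar_crect_ge X a b c d : measurable X -> a <= b -> c <= d ->
  X `<=` [set p | a <= p.1 <= b /\ c <= p.2 <= d] -> ar X <= (b - a) * (d - c).
Proof.
move=> mX ab cd Xr.
have l : (lebesgue2 X <= ((b - a) * (d - c))%:E)%E.
  by rewrite -area_crect //; apply: le_area => //; exact: measurable_crect.
rewrite -lee_fin /ar fineK // ge0_fin_numE ?area_ge0 //.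
by apply: le_lt_trans l _; rewrite ltry.
Qed.

Lemma ar_ge0 X : 0 <= ar X.
Proof. by apply: fine_ge0; exact: area_ge0. Qed.

End RealArea.

(** * The conjugate function as an area, and its two derivatives *)

Section ConjugateHarmonic.
Variable R : realType.
Variables f P Q : R -> R -> R.
Hypothesis H : half_potential f P Q.
Implicit Types (s n a v e m k : R).

Local Notation pull B := (@Tri R `&` [set p | B (P p.1 p.2, Q p.1 p.2)]).

Lemma Tri_box : @Tri R `<=` @box11 R.
Proof.
move=> [s n] h; have /andP[n0 hs] : tri s n by [].
have := normr_ge0 s => s0; have : `|s| <= 1 by lra.
by rewrite ler_norml => s1; split => //=; apply/andP; split; lra.
Qed.

(* Up to the harmless term [n/4], [W_n = solve]; the area formula gives
   [W_a = slope], so [W] is conjugate to the partial Legendre transform. *)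
Definition below a n : set (R * R) :=
  @Tri R `&` [set p | - (1 / 4) < p.1 /\ p.2 < n /\ P p.1 p.2 < a].
Definition V a n : R := ar (below a n).
Definition W a n : R := V a n + (- (1 / 4) * n + a * `|a| / 2).

Lemma measurable_below a n : measurable (below a n).
Proof.
have -> : below a n = (`]- (1 / 4), +oo[ `*` setT) `&` (setT `*` `]-oo, n[) `&` pull (`]-oo, a[ `*` setT).
  apply/seteqP; split => -[s v] /=; rewrite !in_itv /= ?andbT.
    by move=> [h [h1 [h2 h3]]]; split; split => //; split; rewrite /= ?in_itv.
  by move=> [[[h1 _] [_ h2]] [h [h3 _]]]; split => //; move: h3; rewrite in_itv.
by apply: measurableI; [apply: measurableI; exact: measurableX|apply: (hp_meas H); exact: measurableX].
Qed.

Lemma below_box a n : below a n `<=` @box11 R.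
Proof. by move=> p [/Tri_box]. Qed.

Lemma below_a a1 a2 n : a1 <= a2 -> below a1 n `<=` below a2 n.
Proof. by move=> h p [h1 [h2 [h3 h4]]]; do !split => //; exact: lt_le_trans h. Qed.

Lemma below_n a n1 n2 : n1 <= n2 -> below a n1 `<=` below a n2.
Proof. by move=> h p [h1 [h2 [h3 h4]]]; do !split => //; exact: lt_le_trans h. Qed.

Definition incr_a a1 a2 n := below a2 n `\` below a1 n.
Definition incr_n a n1 n2 := below a n2 `\` below a n1.

Lemma incr_aE a1 a2 n : a1 <= a2 -> V a2 n - V a1 n = ar (incr_a a1 a2 n).
Proof.
by move=> h; apply: ar_diff (below_a h) (@below_box _ _); exact: measurable_below.
Qed.

Lemma incr_nE a n1 n2 : n1 <= n2 -> V a n2 - V a n1 = ar (incr_n a n1 n2).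
Proof.
by move=> h; apply: ar_diff (below_n h) (@below_box _ _); exact: measurable_below.
Qed.

Lemma measurable_incr_a a1 a2 n : measurable (incr_a a1 a2 n).
Proof. by apply: measurableD; exact: measurable_below. Qed.

Lemma measurable_incr_n a n1 n2 : measurable (incr_n a n1 n2).
Proof. by apply: measurableD; exact: measurable_below. Qed.

Lemma incr_aP a1 a2 n s v : incr_a a1 a2 n (s, v) ->
  [/\ tri s v, - (1 / 4) < s, v < n & a1 <= P s v < a2].
Proof.
move=> [[/= h [h1 [h2 h3]]]] h4; split => //; rewrite h3 andbT leNgt.
by apply/negP => h5; apply: h4.
Qed.

Lemma incr_nP a n1 n2 s v : incr_n a n1 n2 (s, v) ->
  [/\ tri s v, - (1 / 4) < s, n1 <= v < n2 & P s v < a].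
Proof.
move=> [[/= h [h1 [h2 h3]]]] h4; split => //; rewrite h2 andbT leNgt.
by apply/negP => h5; apply: h4.
Qed.

(** The area identity turns an inclusion of gradient values in a rectangle into a bound on the area
    of [X] itself. *)
Lemma ar_pull_le X a b c d : measurable X -> a <= b -> c <= d ->
  (forall s v, X (s, v) -> tri s v /\ (a <= P s v <= b /\ c <= Q s v <= d)) ->
  ar X <= (b - a) * (d - c).
Proof.
move=> mX ab cd hX; pose B : set (R * R) := [set p | a <= p.1 <= b /\ c <= p.2 <= d].
have mB : measurable B by exact: measurable_crect.
apply: (@le_trans _ _ (ar (pull B))).
  apply: ar_mono => //; first exact: (hp_meas H).
    by move=> [s v] /hX[].
  by move=> p [/Tri_box].
have -> : ar (pull B) = ar (@Quad R `&` B) by rewrite /ar (hp_area H mB).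
apply: ar_crect_ge => //.
by apply: measurableI => //; exact: measurable_Quad.
Qed.

Lemma V_lipschitz_a a1 a2 n : a1 <= a2 -> 0 <= V a2 n - V a1 n <= a2 - a1.
Proof.
move=> h; rewrite incr_aE // ar_ge0 /=.
apply: (@le_trans _ _ ((a2 - a1) * (1 / 2 - 0))); last lra.
apply: ar_pull_le => //; first exact: measurable_incr_a.
move=> s v /incr_aP[t _ _ /andP[p1 p2]]; split => //.
by have [_ _ q1 q2] := hp_bound H t; split; apply/andP; split => //; exact: ltW.
Qed.

Lemma V_lipschitz_n a n1 n2 : n1 <= n2 -> 0 <= V a n2 - V a n1 <= 2 * (n2 - n1).
Proof.
move=> h; rewrite incr_nE // ar_ge0 /=.
apply: (@le_trans _ _ ((1 - -1) * (n2 - n1))); last lra.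
apply: ar_crect_ge => //; first exact: measurable_incr_n.
move=> [s v] /incr_nP[t _ /andP[p1 p2] _]; have [t1 _] := @Tri_box (s, v) t.
by split => //=; rewrite p1 ltW.
Qed.

Lemma V_n0 a n : n <= 0 -> V a n = 0.
Proof.
move=> n0; rewrite /V (_ : below a n = set0); first by rewrite /ar /lebesgue2 measure0.
apply/seteqP; split => // -[s v] [/= /andP[v0 _] [_ [v1 _]]].
by move: v0; rewrite ltNge; have -> : v <= 0 by exact: ltW (lt_le_trans v1 n0).
Qed.

Lemma V_cont2 : cont2 V.
Proof.
apply: cont2P => a n e e0; exists (e / 3); first by rewrite divr_gt0.
move=> a' n' ha hn.
have nrm (x y : R) : 0 <= x <= y -> `|x| <= `|y|.
  by move=> /andP[x0 xy]; rewrite !ger0_norm // (le_trans x0).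
have K1 : `|V a' n' - V a n'| <= `|a' - a|.
  have [h|h] := leP a a'; first by apply: nrm; exact: V_lipschitz_a.
  by rewrite distrC [leRHS]distrC; apply: nrm; exact: V_lipschitz_a (ltW h).
have K2 : `|V a n' - V a n| <= 2 * `|n' - n|.
  have E (x : R) : 2 * `|x| = `|2 * x| by rewrite normrM ger0_norm.
  have [h|h] := leP n n'; first by rewrite E; apply: nrm; exact: V_lipschitz_n.
  rewrite distrC [`|n' - n|]distrC E; apply: nrm.
  exact: (V_lipschitz_n a (ltW h)).
move: (V a' n') (V a n') (V a n) K1 K2 => x y z K1 K2.
have -> : x - z = (x - y) + (y - z) by ring.
by apply: le_trans (ler_normD _ _) _; lra.
Qed.

Variable L : R.
Hypothesis L0 : 0 < L.
Hypothesis L16 : L <= 1 / 16.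
Hypothesis HL : forall n, 0 < n < 2 * L -> 2 * L < P (1 / 4) n.

Local Notation solve := (solve P).
Local Notation slope := (slope P Q).

(** The rectangle of values [a1 < P < a2], [k < Q < m] lies inside [Quad], so its preimage has its
    full area, and [slope_compare] places this preimage in the increment. *)
Lemma V_a_lower a1 a2 n m k : - (2 * L) < a1 -> a1 < a2 -> a2 < 2 * L -> 0 < n < 2 * L ->
  (forall a, a1 < a < a2 -> `|a| <= k /\ m <= slope a n) ->
  (a2 - a1) * (m - k) <= V a2 n - V a1 n.
Proof.
move=> a1L a12 a2L hn hmk.
have [mk|km] := leP m k.
  apply: (@le_trans _ _ 0); last by have /andP[] := V_lipschitz_a n (ltW a12).
  by apply: mulr_ge0_le0; rewrite ?subr_ge0 ?subr_le0 // ltW.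
rewrite incr_aE ?(ltW a12) //.
pose B : set (R * R) := [set p | a1 < p.1 < a2 /\ k < p.2 < m].
have mB : measurable B by exact: measurable_rect.
have small a : a1 < a < a2 -> `|a| < 2 * L by rewrite ltr_norml; lra.
have QB : @Quad R `&` B = B.
  apply/seteqP; split => [p []//|[a b] [/= h1 h2]]; split => //.
  have [h3 h4] := hmk _ h1; have ha := small _ h1.
  have [_ c1] := solveP H L16 HL ha hn.
  have := hp_cone H (solve_tri H L16 HL ha hn); rewrite c1 -/(slope a n) => /andP[c2 c3].
  by rewrite /Quad /=; apply/andP; split; lra.
have E : (a2 - a1) * (m - k) = ar (pull B).
  by rewrite /ar (hp_area H mB) QB area_rect // ltW.
rewrite E; apply: ar_mono.
- exact: (hp_meas H).
- exact: measurable_incr_a.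
- move=> [s v] [/= t [/= h1 h2]]; have [h3 h4] := hmk _ h1; have ha := small _ h1.
  have [_ sc] := slope_compare H L16 HL ha hn t erefl.
  have vn : v < n by apply: sc; lra.
  have hv : 0 < v < 2 * L by have /andP[-> _] := t; have /andP[_ n2] := hn; apply: lt_trans n2.
  (* Left of [- (1 / 4)] the slope [P] is below [- (2 * L)], hence outside the range considered: the
     cut-off in [below] removes nothing here. *)
  have s4 : - (1 / 4) < s.
    rewrite ltNge; apply/negP => s4.
    have t4 : tri (- (1 / 4)) v by apply: (tri_quarter L16) => //; rewrite normrN gtr0_norm.
    have := P_neg_quarter H L16 HL hv.
    move: s4; rewrite le_eqVlt => /orP[/eqP E'|s4]; first by rewrite -E'; lra.
    by have := P_increasing H t t4 s4; lra.
  split; first by do !split => //=; case/andP: h1.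
  by move=> [_ [_ [_ /=]]]; lra.
- by move=> p [/below_box].
Qed.

Lemma V_a_upper a1 a2 n m k : - (2 * L) < a1 -> a1 < a2 -> a2 < 2 * L -> 0 < n < 2 * L ->
  (forall a, a1 <= a < a2 -> k <= `|a| /\ slope a n <= m) ->
  V a2 n - V a1 n <= (a2 - a1) * (m - k).
Proof.
move=> a1L a12 a2L hn hmk; rewrite incr_aE ?(ltW a12) //.
have small a : a1 <= a < a2 -> `|a| < 2 * L by rewrite ltr_norml; lra.
have cone a : `|a| < 2 * L -> `|a| <= slope a n.
  move=> ha; have [_ c1] := solveP H L16 HL ha hn.
  by have := hp_cone H (solve_tri H L16 HL ha hn); rewrite c1 => /andP[].
apply: ar_pull_le; [exact: measurable_incr_a|exact: ltW| |].
  have h : a1 <= a1 < a2 by rewrite lexx.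
  by have [h1 h2] := hmk _ h; have := cone _ (small _ h); lra.
move=> s v /incr_aP[t s4 vn h1]; split => //.
have [h2 h3] := hmk _ h1.
have [sc _] := slope_compare H L16 HL (small _ h1) hn t erefl.
have := sc vn; have /andP[c1 _] := hp_cone H t.
by have /andP[p1 p2] := h1; move=> ?; split; apply/andP; split; lra.
Qed.

Lemma V_n_lower a n1 n2 c : `|a| < 2 * L -> 0 < n1 -> n1 < n2 -> n2 < 2 * L ->
  (forall n, n1 < n < n2 -> c <= solve a n) ->
  (n2 - n1) * (c + 1 / 4) <= V a n2 - V a n1.
Proof.
move=> ha n10 n12 n2L hc; have [c4|c4] := leP c (- (1 / 4)).
  apply: (@le_trans _ _ 0); last by have /andP[] := V_lipschitz_n a (ltW n12).
  by apply: mulr_ge0_le0; lra.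
rewrite incr_nE ?(ltW n12) // mulrC -[1 / 4]opprK.
apply: ar_rect_le; [exact: measurable_incr_n|by move=> p [/below_box]|exact: ltW|exact: ltW|].
move=> [s v] [/= h1 h2].
have hv : 0 < v < 2 * L by apply/andP; split; lra.
have [b1 _] := solveP H L16 HL ha hv; have c1 := hc _ h2.
have t : tri s v.
  by apply: (tri_quarter L16) => //; move: b1; rewrite ltr_norml ler_norml; lra.
split.
  split => //; do !split => /=; [by case/andP: h1|by case/andP: h2|].
  by rewrite (solve_lt H L16 HL) //; lra.
by move=> [_ [_ [/= ]]]; lra.
Qed.

Lemma V_n_upper a n1 n2 c : `|a| < 2 * L -> 0 < n1 -> n1 < n2 -> n2 < 2 * L ->
  (forall n, n1 <= n < n2 -> solve a n <= c) ->
  V a n2 - V a n1 <= (n2 - n1) * (c + 1 / 4).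
Proof.
move=> ha n10 n12 n2L hc; rewrite incr_nE ?(ltW n12) // mulrC -[1 / 4]opprK.
apply: ar_crect_ge; [exact: measurable_incr_n| |exact: ltW|].
  have h : n1 <= n1 < n2 by rewrite lexx.
  have hv : 0 < n1 < 2 * L by apply/andP; split; lra.
  have [b1 _] := solveP H L16 HL ha hv; have := hc _ h.
  by move: b1; rewrite ltr_norml; lra.
move=> [s v] /incr_nP[t s4 h1 h2] /=.
have hv : 0 < v < 2 * L by apply/andP; split; lra.
by move: h2; rewrite (solve_lt H L16 HL) // => h2; have := hc _ h1; split; apply/andP; split; lra.
Qed.

(** At slope [a] the increment fills the values of [Q] from the edge [|a|] of the cone up to
    [slope a n]. The rectangles inside and around it differ little, by continuity of [slope]. *)
Lemma V_derive_a a n : `|a| < 2 * L -> 0 < n < 2 * L ->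
  is_derive a 1 (V ^~ n) (slope a n - `|a|).
Proof.
move=> ha hn; apply/is_deriveP => e e0.
have [c [dS _]] := solve_slope_derive H L16 HL ha hn.
have /cvgrPdist_lt /(_ (e / 2)) := is_derive_cont dS.
have e2 : 0 < e / 2 by rewrite divr_gt0.
move=> /(_ e2) /near_ballP [d d0 D].
pose r := Num.min d (Num.min (e / 2) (2 * L - `|a|)).
have r0 : 0 < r by rewrite !lt_min d0 e2 subr_gt0.
have rd : r <= d by rewrite ge_min lexx.
have re : r <= e / 2 by rewrite !ge_min lexx orbT.
have rL : r <= 2 * L - `|a| by rewrite !ge_min lexx !orbT.
have near x : `|x - a| < r -> [/\ `|x| < 2 * L, `|a| - e / 2 <= `|x|, `|x| <= `|a| + e / 2,
    slope a n - e / 2 <= slope x n & slope x n <= slope a n + e / 2].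
  move=> hx; have := D x (lt_le_trans hx rd); rewrite ltr_norml => h.
  have h1 := ler_normD (x - a) a; rewrite subrK in h1.
  have h2 := ler_normD (a - x) x; rewrite subrK distrC in h2.
  move: h h1 h2 hx re rL; move: (slope x n) (slope a n); clear - H L0 L16 HL => u v *.
  by split; lra.
exists r => // z hz; have [zL _ _ _ _] := near z hz.
have [az|za|->] := ltrgtP a z; last by rewrite !subrr mulr0 subr0 normr0 mulr0.
- have K x : a <= x <= z -> `|x - a| < r.
    by move=> hx; apply: le_lt_trans hz; move: az hx; clear - H L0 L16 HL => *; rewrite !ger0_norm; lra.
  have aL : - (2 * L) < a by move: ha; rewrite ltr_norml; lra.
  have zL' : z < 2 * L by move: zL; rewrite ltr_norml; lra.
  have l := @V_a_lower a z n (slope a n - e / 2) (`|a| + e / 2) aL az zL' hn.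
  have u := @V_a_upper a z n (slope a n + e / 2) (`|a| - e / 2) aL az zL' hn.
  have {}l := l _; have {}u := u _.
  have l' : (z - a) * (slope a n - e / 2 - (`|a| + e / 2)) <= V z n - V a n.
    by apply: l => x hx; have [|? ? ? ? ?] := near x; [by apply: K; case/andP: hx => h1 h2; rewrite ?h1 ?h2 ?ltW|split].
  have u' : V z n - V a n <= (z - a) * (slope a n + e / 2 - (`|a| - e / 2)).
    by apply: u => x hx; have [|? ? ? ? ?] := near x; [by apply: K; case/andP: hx => h1 h2; rewrite ?h1 ?h2 ?ltW|split].
  by move: l' u'; move: (V z n) (V a n) (slope a n); clear - H L0 L16 HL => v1 v2 w *; rewrite ler_norml; lra.
- have K x : z <= x <= a -> `|x - a| < r.
    by move=> hx; apply: le_lt_trans hz; move: za hx; clear - H L0 L16 HL => *; rewrite !ler0_norm; lra.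
  have aL : a < 2 * L by move: ha; rewrite ltr_norml; lra.
  have zL' : - (2 * L) < z by move: zL; rewrite ltr_norml; lra.
  have l := @V_a_lower z a n (slope a n - e / 2) (`|a| + e / 2) zL' za aL hn.
  have u := @V_a_upper z a n (slope a n + e / 2) (`|a| - e / 2) zL' za aL hn.
  have l' : (a - z) * (slope a n - e / 2 - (`|a| + e / 2)) <= V a n - V z n.
    by apply: l => x hx; have [|? ? ? ? ?] := near x; [by apply: K; case/andP: hx => h1 h2; rewrite ?h1 ?h2 ?ltW|split].
  have u' : V a n - V z n <= (a - z) * (slope a n + e / 2 - (`|a| - e / 2)).
    by apply: u => x hx; have [|? ? ? ? ?] := near x; [by apply: K; case/andP: hx => h1 h2; rewrite ?h1 ?h2 ?ltW|split].
  by move: l' u'; move: (V z n) (V a n) (slope a n); clear - H L0 L16 HL => v1 v2 w *; rewrite ler_norml; lra.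
Qed.

(** The slice of [below] at height [n] runs from [- (1 / 4)] to [solve a n]; continuity of [solve]
    controls nearby slices. *)
Lemma V_derive_n a n : `|a| < 2 * L -> 0 < n < 2 * L ->
  is_derive n 1 (V a) (solve a n + 1 / 4).
Proof.
move=> ha hn; apply/is_deriveP => e e0.
have [d d0 D] := solve_cont H L16 HL ha hn e0.
have near x : `|x - n| < d -> [/\ 0 < x < 2 * L, solve a n - e <= solve a x & solve a x <= solve a n + e].
  move=> hx; have [||_ h1 h2] := D a x; [by rewrite subrr normr0|by []|].
  by move: h2; rewrite ltr_norml => h2; split => //; lra.
exists d => // z hz; have [zL _ _] := near z hz.
have [nz|zn|->] := ltrgtP n z; last by rewrite !subrr mulr0 subr0 normr0 mulr0.
- have K x : n <= x <= z -> `|x - n| < d.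
    by move=> hx; apply: le_lt_trans hz; move: nz hx; clear - H L0 L16 HL => *; rewrite !ger0_norm; lra.
  have n0 : 0 < n by case/andP: hn.
  have z2 : z < 2 * L by case/andP: zL.
  have l : (z - n) * (solve a n - e + 1 / 4) <= V a z - V a n.
    by apply: V_n_lower => // x hx; have [|? ? ?] := near x; [by apply: K; case/andP: hx => h1 h2; rewrite ?h1 ?h2 ?ltW|].
  have u : V a z - V a n <= (z - n) * (solve a n + e + 1 / 4).
    by apply: V_n_upper => // x hx; have [|? ? ?] := near x; [by apply: K; case/andP: hx => h1 h2; rewrite ?h1 ?h2 ?ltW|].
  by move: l u; move: (V a z) (V a n) (solve a n) => v1 v2 w *; rewrite ler_norml; lra.
- have K x : z <= x <= n -> `|x - n| < d.
    by move=> hx; apply: le_lt_trans hz; move: zn hx; clear - H L0 L16 HL => *; rewrite !ler0_norm; lra.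
  have n2 : n < 2 * L by case/andP: hn.
  have z0 : 0 < z by case/andP: zL.
  have l : (n - z) * (solve a n - e + 1 / 4) <= V a n - V a z.
    by apply: V_n_lower => // x hx; have [|? ? ?] := near x; [by apply: K; case/andP: hx => h1 h2; rewrite ?h1 ?h2 ?ltW|].
  have u : V a n - V a z <= (n - z) * (solve a n + e + 1 / 4).
    by apply: V_n_upper => // x hx; have [|? ? ?] := near x; [by apply: K; case/andP: hx => h1 h2; rewrite ?h1 ?h2 ?ltW|].
  by move: l u; move: (V a z) (V a n) (solve a n) => v1 v2 w *; rewrite ler_norml; lra.
Qed.

End ConjugateHarmonic.

(** * Comparison of the conjugate function with the singular one *)

Section Growth.
Variable R : realType.
Variables f P Q : R -> R -> R.
Hypothesis H : half_potential f P Q.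
Implicit Types (s n a v e m k : R).

Lemma derive_sqr_abs a : derive_at (fun z => z * `|z| / 2) a `|a|.
Proof.
apply/is_deriveP => e e0; exists e => // z ze.
suff K : `|z * `|z| / 2 - a * `|a| / 2 - `|a| * (z - a)| <= `|z - a| * `|z - a|.
  by apply: le_trans K _; rewrite ler_wpM2r // ltW.
rewrite -normrM -expr2 [leRHS]ger0_norm ?sqr_ge0 // ler_norml.
have q1 := sqr_ge0 (z - a); have q2 := sqr_ge0 z; have q3 := sqr_ge0 a.
case: (ger0P z) => hz; case: (ger0P a) => ha.
- by apply/andP; split; lra.
- have q4 : 0 <= z * - a by apply: mulr_ge0; lra.
  by apply/andP; split; lra.
- have q4 : 0 <= - z * a by apply: mulr_ge0; lra.
  by apply/andP; split; lra.
- by apply/andP; split; lra.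
Qed.

(** The mixed difference estimate bounds only centred differences in [n]; where the derivative
    exists, that is enough to bound it. *)
Lemma symmetric_difference_derive (G : R -> R) n c k : 0 < n -> is_derive n 1 G c ->
  (forall t, 0 <= t <= n -> `|G (n + t) - G (n - t)| <= k * t) -> `|c| <= k / 2.
Proof.
move=> n0 /is_deriveP dG bG; rewrite leNgt; apply/negP => h.
have e0 : 0 < (`|c| - k / 2) / 2 by rewrite divr_gt0 // subr_gt0.
have [d d0 D] := dG _ e0.
pose t := Num.min (d / 2) n.
have t0 : 0 < t by rewrite lt_min n0 divr_gt0.
have td : t <= d / 2 by rewrite ge_min lexx.
have tn : t <= n by rewrite ge_min lexx orbT.
have E1 : n + t - n = t by ring.
have E2 : n - t - n = - t by ring.
have := D (n + t); rewrite E1 gtr0_norm // => /(_ (ltac:(lra))) h1.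
have := D (n - t); rewrite E2 normrN gtr0_norm // => /(_ (ltac:(lra))) h2.
have := bG t; have -> : 0 <= t <= n by rewrite tn ltW.
move=> /(_ isT) h3.
have : `|2 * (c * t)| <= k * t + 2 * ((`|c| - k / 2) / 2 * t).
  have -> : 2 * (c * t) = (G (n + t) - G (n - t)) - (G (n + t) - G n - c * t)
     + (G (n - t) - G n - c * - t) by ring.
  apply: le_trans (ler_normD _ _) _; apply: le_trans (lerD (ler_normB _ _) (lexx _)) _; lra.
rewrite !normrM (gtr0_norm t0) ger0_norm //; nra.
Qed.

Variable L : R.
Hypothesis L0 : 0 < L.
Hypothesis L16 : L <= 1 / 16.
Hypothesis HL : forall n, 0 < n < 2 * L -> 2 * L < P (1 / 4) n.

Local Notation solve := (solve P).
Local Notation slope := (slope P Q).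

Lemma W_derive_a a n : `|a| < 2 * L -> 0 < n < 2 * L -> derive_at (W P ^~ n) a (slope a n).
Proof.
move=> ha hn; have -> : slope a n = (slope a n - `|a|) + (0 + `|a|) by ring.
apply: (@derive_at_add _ (V P ^~ n) (fun z => - (1 / 4) * n + z * `|z| / 2)).
  exact: (V_derive_a H L16 HL).
apply: (@derive_at_add _ (fun=> - (1 / 4) * n) (fun z => z * `|z| / 2)).
  exact: derive_at_const.
exact: derive_sqr_abs.
Qed.

Lemma W_derive_n a n : `|a| < 2 * L -> 0 < n < 2 * L -> derive_at (W P a) n (solve a n).
Proof.
move=> ha hn; have -> : solve a n = (solve a n + 1 / 4) + - (1 / 4) by ring.
apply: (@derive_at_add _ (V P a) (fun z => - (1 / 4) * z + a * `|a| / 2)).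
  exact: (V_derive_n H L16 HL).
exact: derive_at_lin.
Qed.

Lemma near_small a : `|a| < 2 * L -> \forall z \near a, `|z : R| < 2 * L.
Proof.
move=> ha; apply/near_ballP; exists (2 * L - `|a|); first by rewrite subr_gt0.
move=> z hz; have -> : z = (z - a) + a by ring.
by apply: le_lt_trans (ler_normD _ _) _; lra.
Qed.

Lemma near_itv n : 0 < n < 2 * L -> \forall z \near n, 0 < (z : R) < 2 * L.
Proof.
move=> /andP[n0 n2]; apply/near_ballP; exists (Num.min n (2 * L - n)).
  by rewrite lt_min n0 subr_gt0.
by move=> z; rewrite lt_min !ltr_norml; lra.
Qed.

(** The first derivatives of [W] are [slope] and [solve], whose own derivatives in [a] and in [n]
    are opposite. *)
Lemma W_harmonic a n : `|a| < 2 * L -> 0 < n < 2 * L -> harmonic_at (W P) a n.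
Proof.
move=> ha hn; have [c [c1 c2]] := solve_slope_derive H L16 HL ha hn; exists c.
  exists (slope ^~ n) => //; near=> z; apply: W_derive_a => //.
  by near: z; exact: near_small.
exists (solve a) => //; near=> z; apply: W_derive_n => //.
by near: z; exact: near_itv.
Unshelve. all: by end_near. Qed.

Lemma W_cont2 : cont2 (W P).
Proof.
apply: cont2D; first exact: (V_cont2 H).
apply: cont2D; first apply: (cont2_snd (g := fun n => - (1 / 4) * n)) => n.
  exact: is_derive_cont (derive_at_scale (- (1 / 4)) (is_derive_id n 1)).
apply: (cont2_fst (g := fun a => a * `|a| / 2)) => a.
exact: is_derive_cont (derive_sqr_abs a).
Qed.

(** The factor [pi^-1] turns the trace [pi / 2 * (a * |a|)] of [sing] into the trace [a * |a| / 2]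
    of [W]. *)
Definition excess a n : R := W P a n + (- pi^-1) * sing a n.

Lemma excess_cont2 : cont2 excess.
Proof. by apply: cont2D; [exact: W_cont2|apply: cont2Z; exact: sing_cont2]. Qed.

Lemma excess0 a : excess a 0 = 0.
Proof.
rewrite /excess /W V_n0 // /sing ltxx.
by have := @pi_gt0 R; move: (pi : R) => p p0; field; rewrite gt_eqF.
Qed.

Lemma excess_bound a n : `|a| <= L -> 0 <= n <= L -> `|excess a n| <= 20.
Proof.
have l0 := L0; have l16 := L16.
move=> ha /andP[n0 n1].
have a1 : `|a| <= 1 by lra.
have hV : `|V P a n| <= 2.
  have := V_lipschitz_n H a n0; rewrite [V P a 0]V_n0 // !subr0 => /andP[h1 h2].
  by rewrite ger0_norm //; lra.
have hq : `|a * `|a| / 2| <= 1.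
  by rewrite !normrM normr_id [`|2^-1|]ger0_norm //; have := normr_ge0 a; nra.
have hs : `|sing a n - pi / 2 * (a * `|a|)| <= 12.
  have [n0'|n0'] := ltP 0 n; last first.
    have -> : n = 0 by apply/le_anti; rewrite n0 n0'.
    by rewrite /sing ltxx subrr normr0.
  apply: le_trans (sing_near_axis a n0') _.
  have a2 : a ^+ 2 <= 1 by rewrite -real_normK ?num_real // exprn_ile1.
  have n2 : n ^+ 2 <= 1 by rewrite exprn_ile1 //; lra.
  have : `|a| + 2 * n + 2 * (1 + a ^+ 2 + n ^+ 2) <= 12 by lra.
  have : 0 <= `|a| + 2 * n + 2 * (1 + a ^+ 2 + n ^+ 2).
    by have := sqr_ge0 a; have := sqr_ge0 n; have := normr_ge0 a; lra.
  nra.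
have p0 := @pi_gt0 R; have p2 := @pi_ge2 R.
have ip : 0 < pi^-1 :> R by rewrite invr_gt0.
have ip1 : pi^-1 <= 1 :> R by rewrite invf_le1 //; lra.
have -> : excess a n = V P a n + - (1 / 4) * n - pi^-1 * (sing a n - pi / 2 * (a * `|a|)).
  by rewrite /excess /W; move: (sing a n) (V P a n) (pi : R) p0 => x y p p0; field; rewrite gt_eqF.
apply: le_trans (ler_normB _ _) _; apply: le_trans (lerD (ler_normD _ _) (lexx _)) _.
have : `|- (1 / 4) * n| <= 1 by rewrite ler_norml; lra.
have : `|pi^-1 * (sing a n - pi / 2 * (a * `|a|))| <= 12.
  by rewrite normrM (gtr0_norm ip); have := normr_ge0 (sing a n - pi / 2 * (a * `|a|)); nra.
lra.
Qed.

(** The [n]-derivative of the [a]-difference of [excess] is bounded by the mixed difference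
    estimate; what remains is the contribution of [sing]. The constant is [512 * 20 / 4]: half the
    step [h], and half again from the centred difference. *)
Lemma solve_growth a1 a2 n : - (L / 8) <= a1 -> a1 < a2 -> a2 <= L / 8 -> 0 < n <= L / 8 ->
  pi^-1 * (sing_n a2 n - sing_n a1 n) - 2560 / L ^+ 2 * (a2 - a1) <= solve a2 n - solve a1 n.
Proof.
have l0 := L0; have l16 := L16.
move=> h1 h12 h2 hn; have /andP[n0 n8] := hn.
pose x := (a1 + a2) / 2; pose h := (a2 - a1) / 2.
have xh : x + h = a2 by rewrite /x /h; field.
have xh' : x - h = a1 by rewrite /x /h; field.
have M := @mixed_difference_bound R excess L 20 L0 excess_cont2.
have {}M t : 0 <= t <= n ->
  `|excess a2 (n + t) - excess a1 (n + t) - (excess a2 (n - t) - excess a1 (n - t))|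
     <= 512 * 20 / L ^+ 2 * h * t.
  move=> ht; rewrite -xh -xh'; apply: M => //.
  - move=> a v ha hv; apply: harmonicD; last by apply: harmonicZ; apply: sing_harmonic; case/andP: hv.
    by apply: W_harmonic; [rewrite ltr_norml; lra|lra].
  - by move=> a v ha hv; apply: excess_bound => //; rewrite ler_norml.
  - exact: excess0.
  - by rewrite /x; lra.
  - by rewrite /h; lra.
pose G z := excess a2 z - excess a1 z.
have s1 : `|a1| < 2 * L by rewrite ltr_norml; lra.
have s2 : `|a2| < 2 * L by rewrite ltr_norml; lra.
have hn2 : 0 < n < 2 * L by lra.
have D a : `|a| < 2 * L -> derive_at (excess a) n (solve a n + - pi^-1 * sing_n a n).
  move=> ha; apply: (@derive_at_add _ (W P a) (fun z => - pi^-1 * sing a z)).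
    exact: W_derive_n.
  by apply: derive_at_scale; exact: derive_sing_n.
have dG := derive_at_sub (D _ s2) (D _ s1).
have := symmetric_difference_derive n0 dG (k := 512 * 20 / L ^+ 2 * h).
move=> B; have {}B := B _; have : `|solve a2 n + - pi^-1 * sing_n a2 n - (solve a1 n + - pi^-1 * sing_n a1 n)| <= 512 * 20 / L ^+ 2 * h / 2.
  apply: B => t ht.
  exact: M t ht.
have -> : 512 * 20 / L ^+ 2 * h / 2 = 2560 / L ^+ 2 * (a2 - a1).
  by rewrite /h; field; rewrite gt_eqF.
rewrite ler_norml; lra.
Qed.

(** The mean value theorem for the mixed derivative [- ln (a^2 + n^2) - 3], which is at least
    [X - 3] as soon as [a^2 + n^2 <= exp (- X)]. *)
Lemma sing_n_growth a1 a2 n X d : 0 < n -> n <= d -> `|a1| <= d -> `|a2| <= d -> a1 < a2 ->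
  2 * d ^+ 2 <= expR (- X) -> (X - 3) * (a2 - a1) <= sing_n a2 n - sing_n a1 n.
Proof.
move=> n0 nd h1 h2 a12 hX.
have [x hx|c /andP[c1 c2] ->] := @MVT_derive R (fun x => sing_n x n)
  (fun x => - ln (x ^+ 2 + n ^+ 2) - 3) a1 a2 a12.
  exact: derive_sing_na.
apply: ler_wpM2r; first by rewrite subr_ge0 ltW.
rewrite lerD2r lerNr.
have hc : `|c| <= d.
  by move: h1 h2; rewrite !ler_norml; lra.
have d0 : 0 <= d by exact: le_trans (normr_ge0 c) hc.
have : c ^+ 2 + n ^+ 2 <= expR (- X).
  apply: le_trans hX.
  have : c ^+ 2 <= d ^+ 2 by rewrite -[c ^+ 2]real_normK ?num_real // lerXn2r.
  have : n ^+ 2 <= d ^+ 2 by rewrite lerXn2r // nnegrE; lra.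
  lra.
by move=> h; rewrite -[leRHS]expRK ler_ln ?posrE ?expR_gt0 // sqD_gt0.
Qed.

End Growth.

(** * Flatness of [P] in [s] at the origin *)

Section Flatness.
Variable R : realType.
Variables f P Q : R -> R -> R.
Hypothesis H : half_potential f P Q.

Lemma P_slope_vanishes (e : R) : 0 < e -> exists2 d : R, 0 < d &
  forall s1 s2 n, 0 < n < d -> `|s1| < d -> `|s2| < d -> s1 < s2 ->
    P s2 n - P s1 n <= e * (s2 - s1).
Proof.
move=> e0; have [r r0 Hr] := P_lower_at_quarter H.
pose L := Num.min (r / 2) (1 / 16).
have L0 : 0 < L by rewrite lt_min; apply/andP; split; lra.
have Lr : L <= r / 2 by rewrite ge_min lexx.
have L16 : L <= 1 / 16 by rewrite ge_min lexx orbT.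
have HL n : 0 < n < 2 * L -> 2 * L < P (1 / 4) n.
  by move=> hn; apply: le_lt_trans (Hr n _); lra.
pose K := 2560 / L ^+ 2.
(* Chosen so that [(X - 3) / pi - K = e^-1]: the logarithm absorbs the bounded error [K] and still
   stretches [solve] by [e^-1]. *)
pose X : R := pi * (e^-1 + K) + 3.
pose d1 := Num.min (L / 8) (expR (- X) / 2).
have d10 : 0 < d1 by rewrite lt_min !divr_gt0 // expR_gt0.
have d1L : d1 <= L / 8 by rewrite ge_min lexx.
have d1X : d1 <= expR (- X) / 2 by rewrite ge_min lexx orbT.
have hX : 2 * d1 ^+ 2 <= expR (- X) by nra.
have [d2 d20 D2] := P_vanishes_at_0 H d10.
pose d := Num.min d1 d2.
have d0 : 0 < d by rewrite lt_min d10.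
have dd1 : d <= d1 by rewrite ge_min lexx.
have dd2 : d <= d2 by rewrite ge_min lexx orbT.
exists d => // s1 s2 n /andP[n0 nd] h1 h2 s12.
have hn : 0 < n < 2 * L by move: n0 nd dd1 d1L L0; clear - H; lra.
have t1 : tri s1 n by apply: (tri_quarter L16) => //; lra.
have t2 : tri s2 n by apply: (tri_quarter L16) => //; lra.
have b1 := D2 _ _ t1 (lt_le_trans h1 dd2) (lt_le_trans nd dd2).
have b2 := D2 _ _ t2 (lt_le_trans h2 dd2) (lt_le_trans nd dd2).
have a12 := P_increasing H t1 t2 s12.
have E1 : s1 = solve P (P s1 n) n.
  by apply: (solve_unique H L16 HL) => //; apply: le_lt_trans b1 _; move: d1L L0; clear - H; lra.
have E2 : s2 = solve P (P s2 n) n.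
  by apply: (solve_unique H L16 HL) => //; apply: le_lt_trans b2 _; move: d1L L0; clear - H; lra.
have c1 := b1; have c2 := b2; rewrite ler_norml in c1; rewrite ler_norml in c2.
have G := @solve_growth R f P Q H L L0 L16 HL (P s1 n) (P s2 n) n.
have {G} : pi^-1 * (sing_n (P s2 n) n - sing_n (P s1 n) n) - K * (P s2 n - P s1 n) <= s2 - s1.
  move: G; rewrite -E1 -E2; apply => //.
    by move: c1; clear - H d1L; lra.
    by move: c2; clear - H d1L; lra.
  by move: n0 nd dd1; clear - H d1L; lra.
have := @sing_n_growth R (P s1 n) (P s2 n) n X d1 n0.
have -> : n <= d1 by rewrite (le_trans (ltW nd)).
move=> /(_ isT b1 b2 a12 hX).
have p0 := @pi_gt0 R; have ip : 0 < pi^-1 :> R by rewrite invr_gt0.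
rewrite -(ler_pM2l ip) => S1 S2.
have E : pi^-1 * ((X - 3) * (P s2 n - P s1 n)) = e^-1 * (P s2 n - P s1 n) + K * (P s2 n - P s1 n).
  by rewrite /X; move: (pi : R) p0 => p p0; field; rewrite !gt_eqF.
have : e^-1 * (P s2 n - P s1 n) <= s2 - s1 by move: S1 S2; rewrite E; clear - H; lra.
by rewrite ler_pdivrMl.
Qed.

End Flatness.

(** * Pointwise Hessians: symmetry, positivity, expansion *)

Section Hessian.
Variable R : realType.
Implicit Types (g u v : R -> R -> R) (x y s n a b c A B C e r : R).

Lemma frechetD g u x y A B C (D : R) : frechet g x y A B -> frechet u x y C D ->
  frechet (fun x y => g x y + u x y) x y (A + C) (B + D).
Proof.
move=> hg hu e e0; have e2 : 0 < e / 2 by rewrite divr_gt0.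
have [d1 d10 D1] := hg _ e2; have [d2 d20 D2] := hu _ e2.
exists (Num.min d1 d2); first by rewrite lt_min d10.
move=> x' y'; rewrite !lt_min => /andP[a1 a2] /andP[b1 b2].
have := D1 _ _ a1 b1; have := D2 _ _ a2 b2.
set p := g x' y'; set q := u x' y' => h1 h2.
have -> : p + q - (g x y + u x y) - (A + C) * (x' - x) - (B + D) * (y' - y)
  = (p - g x y - A * (x' - x) - B * (y' - y)) + (q - u x y - C * (x' - x) - D * (y' - y)) by ring.
by apply: le_trans (ler_normD _ _) _; lra.
Qed.

Lemma frechetZ g x y A B (k : R) : frechet g x y A B ->
  frechet (fun x y => k * g x y) x y (k * A) (k * B).
Proof.
move=> hg e e0; have k0 : 0 < `|k| + 1 by rewrite ltr_wpDl.
have [d d0 D] := hg _ (divr_gt0 e0 k0); exists d => // x' y' h1 h2.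
have := D _ _ h1 h2; set z := _ - B * _ => h.
have -> : k * g x' y' - k * g x y - k * A * (x' - x) - k * B * (y' - y) = k * z by rewrite /z; ring.
rewrite normrM; apply: le_trans (ler_wpM2l (normr_ge0 k) h) _.
set t := `|x' - x| + `|y' - y|.
have t0 : 0 <= t by rewrite addr_ge0.
have -> : `|k| * (e / (`|k| + 1) * t) = e * t * (`|k| / (`|k| + 1)) by ring.
apply: ler_piMr; first by rewrite mulr_ge0 // ltW.
by rewrite ler_pdivrMr // mul1r; lra.
Qed.

Definition skew g s n : R := g (s - n / 2) (s - 3 / 2 * n).

Lemma frechet_skew g s n A B : frechet g (s - n / 2) (s - 3 / 2 * n) A B ->
  frechet (skew g) s n (A + B) (- (1 / 2) * A - 3 / 2 * B).
Proof.
move=> hg e e0; have e4 : 0 < e / 4 by rewrite divr_gt0.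
have [d d0 D] := hg _ e4; exists (d / 3); first by rewrite divr_gt0.
move=> s' n' h1 h2.
have E1 : s' - n' / 2 - (s - n / 2) = (s' - s) - (n' - n) / 2 by ring.
have E2 : s' - 3 / 2 * n' - (s - 3 / 2 * n) = (s' - s) - 3 / 2 * (n' - n) by ring.
have N1 : `|s' - n' / 2 - (s - n / 2)| <= `|s' - s| + 1 / 2 * `|n' - n|.
  by rewrite E1; apply: le_trans (ler_normB _ _) _; rewrite normrM mulrC [`|2^-1|]ger0_norm // mul1r.
have N2 : `|s' - 3 / 2 * n' - (s - 3 / 2 * n)| <= `|s' - s| + 3 / 2 * `|n' - n|.
  by rewrite E2; apply: le_trans (ler_normB _ _) _; rewrite normrM [`|3 / 2|]ger0_norm.
have k1 := normr_ge0 (s' - s); have k2 := normr_ge0 (n' - n).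
have := D (s' - n' / 2) (s' - 3 / 2 * n').
have -> : `|s' - n' / 2 - (s - n / 2)| < d by apply: le_lt_trans N1 _; lra.
have -> : `|s' - 3 / 2 * n' - (s - 3 / 2 * n)| < d by apply: le_lt_trans N2 _; lra.
move=> /(_ isT isT); rewrite {1}E1 {1}E2 /skew.
set p := g _ _; set q := g _ _ => h.
have -> : p - q - (A + B) * (s' - s) - (- (1 / 2) * A - 3 / 2 * B) * (n' - n)
  = p - q - A * (s' - s - (n' - n) / 2) - B * (s' - s - 3 / 2 * (n' - n)) by ring.
by apply: le_trans h _; have := mulr_ge0 (ltW e0) k1; have := mulr_ge0 (ltW e0) k2; nra.
Qed.

Lemma differentiable_frechet (f : R * R -> R) (p : R * R) : differentiable f p ->
  frechet (fun x y => f (x, y)) p.1 p.2 (pd (@e1 R) f p) (pd (@e2 R) f p).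
Proof.
move=> df e e0; rewrite /pd !deriveE //.
have := diff_locally df => /eqaddoP /(_ (e / 2)).
rewrite divr_gt0 // => /(_ isT) /nbhs_ballP [d /= d0 D].
exists d => // x y hx hy.
have := D (x - p.1, y - p.2); rewrite /ball /= => K.
have {}K : `|f (x, y) - f p - 'd f p (x - p.1, y - p.2)| <= e / 2 * `|(x - p.1, y - p.2)|.
  have := K; rewrite /prod_ball /ball /= !sub0r !normrN => /(_ (conj hx hy)).
  congr (`|_| <= _).
  have E : (x - p.1, y - p.2) + p = (x, y) by rewrite [RHS]surjective_pairing; congr pair; rewrite /= subrK.
  rewrite !fctE /= E /cst opprD addrA //.
have lin : 'd f p (x - p.1, y - p.2) = 'd f p (@e1 R) * (x - p.1) + 'd f p (@e2 R) * (y - p.2).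
  have -> : (x - p.1, y - p.2) = (x - p.1) *: @e1 R + (y - p.2) *: @e2 R.
    by congr pair; rewrite /= /GRing.scale /= !mulr0 !mulr1 ?addr0 ?add0r.
  by rewrite linearD !linearZ /= /GRing.scale /= mulrC [X in _ + X]mulrC.
have -> : f (x, y) - f (p.1, p.2) - 'd f p (@e1 R) * (x - p.1) - 'd f p (@e2 R) * (y - p.2)
  = f (x, y) - f p - 'd f p (x - p.1, y - p.2) by rewrite lin -surjective_pairing; ring.
apply: le_trans K _.
have : `|(x - p.1, y - p.2)| <= `|x - p.1| + `|y - p.2|.
  by rewrite prod_normE /= ge_max; apply/andP; split; rewrite ?lerDl ?lerDr.
have := normr_ge0 (x - p.1); have := normr_ge0 (y - p.2); nra.
Qed.

(* Schwarz, from the mixed second difference over a small square. *)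
Lemma hessian_symmetric g u v x0 y0 A B B' C r : 0 < r ->
  (forall x y, `|x - x0| < r -> `|y - y0| < r ->
     is_derive x 1 (g ^~ y) (u x y) /\ is_derive y 1 (g x) (v x y)) ->
  frechet u x0 y0 A B -> frechet v x0 y0 B' C -> B = B'.
Proof.
move=> r0 dg fu fv.
suff K e : 0 < e -> `|B - B'| <= 6 * e.
  apply/eqP; rewrite -subr_eq0 -normr_eq0; apply/negPn/negP => n0.
  have h0 : 0 < `|B - B'| by rewrite lt_neqAle eq_sym n0 normr_ge0.
  by have := K (`|B - B'| / 12) (ltac:(rewrite divr_gt0 //)); lra.
move=> e0; have [d1 d10 D1] := fu e e0; have [d2 d20 D2] := fv e e0.
have [h h0 [hr hd1 hd2]] := exists_pos_lt3 r0 d10 d20.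
have sx : x0 < x0 + h by rewrite ltrDl.
have sy : y0 < y0 + h by rewrite ltrDl.
have nx z w : w <= z <= w + h -> `|z - w| <= h by move=> hz; rewrite ger0_norm; lra.
have Ex : x0 + h - x0 = h by ring.
have Ey : y0 + h - y0 = h by ring.
pose Delta := g (x0 + h) (y0 + h) - g (x0 + h) y0 - (g x0 (y0 + h) - g x0 y0).
have P1 : `|Delta - B * h ^+ 2| <= 3 * e * h ^+ 2.
  have [x hx|c /andP[c1 c2] E] := @MVT_derive R (fun x => g x (y0 + h) - g x y0)
    (fun x => u x (y0 + h) - u x y0) x0 (x0 + h) sx.
    apply: (@derive_at_sub R (g ^~ (y0 + h)) (g ^~ y0)).
      by apply: (dg _ _ _ _).1; apply: le_lt_trans hr; apply: nx => //; lra.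
    by apply: (dg _ _ _ _).1; [apply: le_lt_trans hr; apply: nx|rewrite subrr normr0].
  have {}E : Delta = (u c (y0 + h) - u c y0) * h by rewrite /Delta E; congr (_ * _); ring.
  have hc : `|c - x0| <= h by apply: nx; lra.
  have h1 := D1 c (y0 + h) (le_lt_trans hc hd1) (ltac:(rewrite Ey gtr0_norm //)).
  have h2 := D1 c y0 (le_lt_trans hc hd1) (ltac:(rewrite subrr normr0 //)).
  rewrite Ey (gtr0_norm h0) in h1; rewrite subrr normr0 mulr0 subr0 addr0 in h2.
  have -> : Delta - B * h ^+ 2 = ((u c (y0 + h) - u x0 y0 - A * (c - x0) - B * h)
     - (u c y0 - u x0 y0 - A * (c - x0))) * h by rewrite E; ring.
  rewrite normrM (gtr0_norm h0).
  have -> : 3 * e * h ^+ 2 = 3 * e * h * h by ring.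
  apply: ler_wpM2r; first exact: ltW.
  apply: le_trans (ler_normB _ _) _.
  have : e * `|c - x0| <= e * h by rewrite ler_wpM2l // ltW.
  lra.
have P2 : `|Delta - B' * h ^+ 2| <= 3 * e * h ^+ 2.
  have [y hy|c /andP[c1 c2] E] := @MVT_derive R (fun y => g (x0 + h) y - g x0 y)
    (fun y => v (x0 + h) y - v x0 y) y0 (y0 + h) sy.
    apply: (@derive_at_sub R (g (x0 + h)) (g x0)).
      by apply: (dg _ _ _ _).2; apply: le_lt_trans hr; apply: nx => //; lra.
    by apply: (dg _ _ _ _).2; [rewrite subrr normr0|apply: le_lt_trans hr; apply: nx].
  have {}E : Delta = (v (x0 + h) c - v x0 c) * h.
    have -> : Delta = g (x0 + h) (y0 + h) - g x0 (y0 + h) - (g (x0 + h) y0 - g x0 y0) by rewrite /Delta; ring.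
    by rewrite E; congr (_ * _); ring.
  have hc : `|c - y0| <= h by apply: nx; lra.
  have h1 := D2 (x0 + h) c (ltac:(rewrite Ex gtr0_norm //)) (le_lt_trans hc hd2).
  have h2 := D2 x0 c (ltac:(rewrite subrr normr0 //)) (le_lt_trans hc hd2).
  rewrite Ex (gtr0_norm h0) in h1; rewrite subrr normr0 mulr0 subr0 add0r in h2.
  have -> : Delta - B' * h ^+ 2 = ((v (x0 + h) c - v x0 y0 - B' * h - C * (c - y0))
     - (v x0 c - v x0 y0 - C * (c - y0))) * h by rewrite E; ring.
  rewrite normrM (gtr0_norm h0).
  have -> : 3 * e * h ^+ 2 = 3 * e * h * h by ring.
  apply: ler_wpM2r; first exact: ltW.
  apply: le_trans (ler_normB _ _) _.
  have : e * `|c - y0| <= e * h by rewrite ler_wpM2l // ltW.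
  lra.
have h20 : 0 < h ^+ 2 by rewrite exprn_gt0.
rewrite -(ler_pM2r h20) -[h ^+ 2 in leLHS]gtr0_norm // -normrM.
have -> : (B - B') * h ^+ 2 = (Delta - B' * h ^+ 2) - (Delta - B * h ^+ 2) by ring.
by apply: le_trans (ler_normB _ _) _; lra.
Qed.

Lemma psd_discriminant A B C :
  (forall a b, 0 <= A * a ^+ 2 + 2 * B * (a * b) + C * b ^+ 2) ->
  [/\ 0 <= A, 0 <= C & B ^+ 2 <= A * C].
Proof.
move=> h; have A0 : 0 <= A by have := h 1 0; rewrite !expr2; lra.
have C0 : 0 <= C by have := h 0 1; rewrite !expr2; lra.
split => //; have := h (- B) A; move: A0; rewrite le_eqVlt => /orP[/eqP A0|A0].
  move=> _; rewrite -A0 mul0r; have [->|B0] := eqVneq B 0; first by rewrite expr0n.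
  (* With [A = 0] the form is affine in [a] at [b = 1]; this [a] makes its value [-1]. *)
  have := h (- (C + 1) / (2 * B)) 1; rewrite -A0.
  have -> : 0 * (- (C + 1) / (2 * B)) ^+ 2 + 2 * B * (- (C + 1) / (2 * B) * 1) + C * 1 ^+ 2 = -1.
    by field.
  by rewrite oppr_ge0 ler10.
have -> : A * (- B) ^+ 2 + 2 * B * (- B * A) + C * A ^+ 2 = A * (A * C - B ^+ 2) by ring.
by rewrite pmulr_rge0 // subr_ge0.
Qed.

(** Monotonicity is tested at the displacement [t * (a, b)]. Dividing by [t ^+ 2] leaves the
    quadratic form plus an error at most [e], because the remainders are [o(t)] and are multiplied
    by components of size [O(t)]. *)
Lemma monotone_psd u v x0 y0 A B C r : 0 < r ->
  (forall x y, `|x - x0| < r -> `|y - y0| < r ->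
     0 <= (u x y - u x0 y0) * (x - x0) + (v x y - v x0 y0) * (y - y0)) ->
  frechet u x0 y0 A B -> frechet v x0 y0 B C ->
  [/\ 0 <= A, 0 <= C & B ^+ 2 <= A * C].
Proof.
move=> r0 mono fu fv; apply: psd_discriminant => a b.
apply/ler_addgt0Pr => e e0.
pose k := `|a| + `|b| + 1.
have k0 : 0 < k by have := normr_ge0 a; have := normr_ge0 b; rewrite /k; lra.
have e1 : 0 < e / k ^+ 2 by rewrite divr_gt0 // exprn_gt0.
have [d1 d10 D1] := fu _ e1; have [d2 d20 D2] := fv _ e1.
pose m := Num.min r (Num.min d1 d2).
have m0 : 0 < m by rewrite !lt_min r0 d10.
have mr : m <= r by rewrite ge_min lexx.
have md1 : m <= d1 by rewrite !ge_min lexx orbT.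
have md2 : m <= d2 by rewrite !ge_min lexx !orbT.
have [t t0 tk] : exists2 t, 0 < t & t * k = m.
  by exists (m / k); rewrite ?divr_gt0 // divfK // gt_eqF.
have na : `|t * a| < m.
  by rewrite normrM (gtr0_norm t0) -tk ltr_pM2l // /k; have := normr_ge0 b; lra.
have nb : `|t * b| < m.
  by rewrite normrM (gtr0_norm t0) -tk ltr_pM2l // /k; have := normr_ge0 a; lra.
have Ex : x0 + t * a - x0 = t * a by ring.
have Ey : y0 + t * b - y0 = t * b by ring.
have := mono (x0 + t * a) (y0 + t * b); have := D1 (x0 + t * a) (y0 + t * b).
have := D2 (x0 + t * a) (y0 + t * b); rewrite Ex Ey.
rewrite !(lt_le_trans na) // !(lt_le_trans nb) //.
move=> /(_ isT isT) h2 /(_ isT isT) h1 /(_ isT isT) h.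
have S : `|t * a| + `|t * b| <= t * k.
  by rewrite !normrM (gtr0_norm t0) -mulrDr ler_wpM2l ?(ltW t0) // /k; lra.
have ek : e / k ^+ 2 * (t * k) = e * t / k by field; rewrite gt_eqF.
have {}h1 : `|u (x0 + t * a) (y0 + t * b) - u x0 y0 - A * (t * a) - B * (t * b)| <= e * t / k.
  by apply: le_trans h1 _; rewrite -ek ler_wpM2l // ltW.
have {}h2 : `|v (x0 + t * a) (y0 + t * b) - v x0 y0 - B * (t * a) - C * (t * b)| <= e * t / k.
  by apply: le_trans h2 _; rewrite -ek ler_wpM2l // ltW.
move: h1 h2 h; set p := _ - u x0 y0; set q := _ - v x0 y0 => h1 h2 h.
have t20 : 0 < t ^+ 2 by rewrite exprn_gt0.
rewrite -(pmulr_rge0 _ t20).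
have E : t ^+ 2 * (A * a ^+ 2 + 2 * B * (a * b) + C * b ^+ 2 + e)
  = (p * (t * a) + q * (t * b)) - (p - A * (t * a) - B * (t * b)) * (t * a)
    - (q - B * (t * a) - C * (t * b)) * (t * b) + t ^+ 2 * e by ring.
rewrite E.
have b1 : (p - A * (t * a) - B * (t * b)) * (t * a) <= e * t / k * `|t * a|.
  by apply: le_trans (ler_norm _) _; rewrite normrM ler_wpM2r.
have b2 : (q - B * (t * a) - C * (t * b)) * (t * b) <= e * t / k * `|t * b|.
  by apply: le_trans (ler_norm _) _; rewrite normrM ler_wpM2r.
have b3 : e * t / k * (`|t * a| + `|t * b|) <= e * t / k * (t * k).
  by rewrite ler_wpM2l // divr_ge0 ?mulr_ge0 // ltW.
have b4 : e * t / k * (t * k) = t ^+ 2 * e by field; rewrite gt_eqF.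
by rewrite mulrDr b4 in b3; move: h b1 b2 b3; clear; lra.
Qed.

(* A map with this derivative sends a square of radius [r] into a rectangle of
   half-sides about [(|A|+|B|) r] and [(|B|+|C|) r]. *)
Lemma expansion_bound u v x0 y0 A B C r : 0 < r ->
  (forall t (a1 a2 b1 b2 : R), 0 < t < r -> a1 <= a2 -> b1 <= b2 ->
     (forall x y, `|x - x0| < t -> `|y - y0| < t -> a1 <= u x y <= a2 /\ b1 <= v x y <= b2) ->
     (2 * t) ^+ 2 <= (a2 - a1) * (b2 - b1)) ->
  frechet u x0 y0 A B -> frechet v x0 y0 B C ->
  1 <= (`|A| + `|B|) * (`|B| + `|C|).
Proof.
move=> r0 area fu fv; set X := `|A| + `|B|; set Y := `|B| + `|C|.
have X0 : 0 <= X by rewrite addr_ge0.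
have Y0 : 0 <= Y by rewrite addr_ge0.
have K e : 0 < e -> 1 <= (X + 2 * e) * (Y + 2 * e).
  move=> e0; have [d1 d10 D1] := fu e e0; have [d2 d20 D2] := fv e e0.
  have [t t0 [tr td1 td2]] := exists_pos_lt3 r0 d10 d20.
  have T1 : 0 <= (X + 2 * e) * t by rewrite mulr_ge0 ?addr_ge0 ?mulr_ge0 // ltW.
  have T2 : 0 <= (Y + 2 * e) * t by rewrite mulr_ge0 ?addr_ge0 ?mulr_ge0 // ltW.
  have bnd (p a b x y : R) : `|x| < t -> `|y| < t -> `|p - a * x - b * y| <= e * (`|x| + `|y|) ->
      `|p| <= (`|a| + `|b| + 2 * e) * t.
    move=> hx hy hp; have -> : p = (p - a * x - b * y) + (a * x + b * y) by ring.
    apply: le_trans (ler_normD _ _) _; apply: le_trans (lerD hp (ler_normD _ _)) _.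
    rewrite !normrM.
    have := ler_wpM2l (normr_ge0 a) (ltW hx); have := ler_wpM2l (normr_ge0 b) (ltW hy).
    have := ler_wpM2l (ltW e0) (ltW hx); have := ler_wpM2l (ltW e0) (ltW hy); lra.
  have := area t (u x0 y0 - (X + 2 * e) * t) (u x0 y0 + (X + 2 * e) * t)
    (v x0 y0 - (Y + 2 * e) * t) (v x0 y0 + (Y + 2 * e) * t).
  have -> : 0 < t < r by rewrite t0.
  have -> : u x0 y0 - (X + 2 * e) * t <= u x0 y0 + (X + 2 * e) * t by lra.
  have -> : v x0 y0 - (Y + 2 * e) * t <= v x0 y0 + (Y + 2 * e) * t by lra.
  move=> S; have {}S := S isT isT isT.
  have : (2 * t) ^+ 2 <= (2 * (X + 2 * e) * t) * (2 * (Y + 2 * e) * t).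
    have E1 (z w : R) : z + w * t - (z - w * t) = 2 * w * t by ring.
    rewrite !E1 in S; apply: S => x y hx hy.
    have h1 := D1 x y; have h2 := D2 x y.
    have {}h1 : `|u x y - u x0 y0 - A * (x - x0) - B * (y - y0)| <= e * (`|x - x0| + `|y - y0|).
      by apply: h1; [exact: lt_trans hx td1|exact: lt_trans hy td1].
    have {}h2 : `|v x y - v x0 y0 - B * (x - x0) - C * (y - y0)| <= e * (`|x - x0| + `|y - y0|).
      by apply: h2; [exact: lt_trans hx td2|exact: lt_trans hy td2].
    have := bnd _ _ _ _ _ hx hy h1; have := bnd _ _ _ _ _ hx hy h2.
    rewrite !ler_norml -/X -/Y; move: (u x y) (v x y) (u x0 y0) (v x0 y0) ((X + 2 * e) * t) ((Y + 2 * e) * t).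
    by clear; move=> *; lra.
  have -> : 2 * (X + 2 * e) * t * (2 * (Y + 2 * e) * t) = (2 * t) ^+ 2 * ((X + 2 * e) * (Y + 2 * e)) by ring.
  by rewrite ler_pMr // exprn_gt0 // mulr_gt0.
rewrite leNgt; apply/negP => XY.
(* The enlarged product exceeds [X * Y] by at most half of [1 - X * Y], hence remains below 1. *)
pose e := Num.min 1 ((1 - X * Y) / (4 * (X + Y + 2))).
have w0 : 0 < 4 * (X + Y + 2) by lra.
have e0 : 0 < e by rewrite lt_min ltr01 divr_gt0 // subr_gt0.
have e1 : e <= 1 by rewrite ge_min lexx.
have e2 : e * (4 * (X + Y + 2)) <= 1 - X * Y.
  by rewrite -ler_pdivlMr // ge_min lexx orbT.
have := K e e0.
have -> : (X + 2 * e) * (Y + 2 * e) = X * Y + 2 * e * (X + Y + 2 * e) by ring.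
have : 2 * e * (X + Y + 2 * e) <= 2 * e * (X + Y + 2) by rewrite ler_wpM2l //; lra.
have : 0 < e * (X + Y + 2) by rewrite mulr_gt0 //; lra.
lra.
Qed.

End Hessian.

(** * The two domains in skew coordinates *)

Section Geometry.
Variable R : realType.
Implicit Types (p q : R * R) (X Y B : set (R * R)).

Local Notation Omega := (@Omega R).
Local Notation Theta := (@Theta R).

Lemma continuous_pair_affine (a b c a' b' c' : R) :
  continuous (fun p : R * R => (a * p.1 + b * p.2 + c, a' * p.1 + b' * p.2 + c')).
Proof.
move=> p.
have k (u v w : R) : (fun p : R * R => u * p.1 + v * p.2 + w) @ p --> u * p.1 + v * p.2 + w.
  apply: cvgD; last exact: cvg_cst.
  by apply: cvgD; apply: cvgM; [exact: cvg_cst|exact: cvg_fst|exact: cvg_cst|exact: cvg_snd].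
exact: (cvg_pair (k a b c) (k a' b' c')).
Qed.

Lemma open_halfplane (a b c : R) : open [set p : R * R | 0 < a * p.1 + b * p.2 + c].
Proof.
have cg : continuous (fun p : R * R => a * p.1 + b * p.2 + c).
  move=> p; apply: cvgD; last exact: cvg_cst.
  by apply: cvgD; apply: cvgM; [exact: cvg_cst|exact: cvg_fst|exact: cvg_cst|exact: cvg_snd].
by move/continuousP: cg => /(_ [set r | 0 < r]); apply; exact: open_gt.
Qed.

Lemma measurable_halfplane (a b c : R) :
  measurable [set p : R * R | 0 <= a * p.1 + b * p.2 + c].
Proof.
rewrite (_ : mkset _ = ~` [set p | 0 < (- a) * p.1 + (- b) * p.2 + (- c)]).
  by apply: measurableC; apply: open2_measurable; exact: open_halfplane.
apply/seteqP; split => p /=; first by move=> h1 h2; lra.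
by move/negP; rewrite -leNgt; lra.
Qed.

Lemma measurable_line (a b c : R) :
  measurable [set p : R * R | a * p.1 + b * p.2 + c = 0].
Proof.
rewrite (_ : mkset _ = [set p | 0 <= a * p.1 + b * p.2 + c] `&`
   [set p | 0 <= (- a) * p.1 + (- b) * p.2 + (- c)]).
  by apply: measurableI; exact: measurable_halfplane.
by apply/seteqP; split => p /=; [move=> h; split; lra|move=> [h1 h2]; lra].
Qed.

Lemma area_line0 (a b c : R) : b != 0 ->
  lebesgue2 [set p : R * R | a * p.1 + b * p.2 + c = 0] = 0%E.
Proof.
move=> b0; rewrite (_ : mkset _ = [set p | p.2 = (fun x => - (a * x + c) / b) p.1]).
  exact: (area_graph0 (fun x => - (a * x + c) / b)).
apply/seteqP; split => p /= h.
  by rewrite -(mulKf b0 p.2) mulrC; congr (_ / _); lra.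
by rewrite h; field.
Qed.

Lemma area_ae_eq X Y Z : measurable X -> measurable Y -> measurable Z ->
  lebesgue2 Z = 0%E -> X `<=` Y `|` Z -> Y `<=` X `|` Z -> lebesgue2 X = lebesgue2 Y.
Proof.
move=> mX mY mZ Z0 XY YX.
have K X' Y' : measurable X' -> measurable Y' -> X' `<=` Y' `|` Z -> (lebesgue2 X' <= lebesgue2 Y')%E.
  move=> mX' mY' h; apply: le_trans (le_area mX' (measurableU _ _ mY' mZ) h) _.
  have : (lebesgue2 (Y' `|` Z) <= lebesgue2 Y' + lebesgue2 Z)%E by apply: measureU2.
  by rewrite Z0 adde0.
by apply/eqP; rewrite eq_le !K.
Qed.

Lemma flipK : involutive (@flip R). Proof. by case. Qed.

Lemma measurable_flip X : measurable X -> measurable (@flip R @^-1` X).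
Proof.
move=> mX; rewrite (_ : @flip R = fun p => (0 * p.1 + 1 * p.2 + 0, 1 * p.1 + 0 * p.2 + 0)).
  by apply: continuous_measurable2 => //; exact: continuous_pair_affine.
by apply/funext => -[x y]; rewrite /flip /= !mul0r !mul1r !addr0 add0r.
Qed.

Lemma measurable_affine (a b c a' b' c' : R) X : measurable X ->
  measurable ((fun p : R * R => (a * p.1 + b * p.2 + c, a' * p.1 + b' * p.2 + c')) @^-1` X).
Proof. by move=> mX; apply: continuous_measurable2 => //; exact: continuous_pair_affine. Qed.

Definition of_skew p : R * R := (p.1 - p.2 / 2, p.1 - 3 / 2 * p.2).
(** The transpose of [of_skew], which is how gradients transform under that change of variables. *)
Definition cone_coord p : R * R := (p.1 + p.2, - (1 / 2) * p.1 - 3 / 2 * p.2).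

Lemma of_skew_measurable X : measurable X -> measurable (of_skew @^-1` X).
Proof.
move=> mX; rewrite (_ : of_skew = fun p => (1 * p.1 + (- 2^-1) * p.2 + 0, 1 * p.1 + (- (3 / 2)) * p.2 + 0)).
  exact: measurable_affine.
by apply/funext => p; rewrite /of_skew; congr pair; ring.
Qed.

Lemma cone_coord_measurable X : measurable X -> measurable (cone_coord @^-1` X).
Proof.
move=> mX; rewrite (_ : cone_coord = fun p => (1 * p.1 + 1 * p.2 + 0, (- (1 / 2)) * p.1 + (- (3 / 2)) * p.2 + 0)).
  exact: measurable_affine.
by apply/funext => p; rewrite /cone_coord; congr pair; ring.
Qed.

Definition shear (k : R) p : R * R := (p.1, p.2 + k * p.1).
Definition shear_reflect (k : R) p : R * R := (p.1, k * p.1 - p.2).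

Lemma shear_measurable k X : measurable X -> measurable (shear k @^-1` X).
Proof.
move=> mX; rewrite (_ : shear k = fun p => (1 * p.1 + 0 * p.2 + 0, k * p.1 + 1 * p.2 + 0)).
  exact: measurable_affine.
by apply/funext => p; rewrite /shear; congr pair; ring.
Qed.

Lemma shear_reflect_measurable k X : measurable X -> measurable (shear_reflect k @^-1` X).
Proof.
move=> mX; rewrite (_ : shear_reflect k = fun p => (1 * p.1 + 0 * p.2 + 0, k * p.1 + (-1) * p.2 + 0)).
  exact: measurable_affine.
by apply/funext => p; rewrite /shear_reflect; congr pair; ring.
Qed.

(** The map has determinant [-1]; it factors through one shear, one sheared reflection and two
    exchanges of coordinates. *)
Lemma area_of_skew X : measurable X -> lebesgue2 (of_skew @^-1` X) = lebesgue2 X.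
Proof.
move=> mX; rewrite -(area_shear_reflect (fun x => 1 * x) mX).
have m1 := shear_reflect_measurable 1 mX.
rewrite -(area_flip m1); have m2 := measurable_flip m1.
rewrite -(area_shear (fun x => - (1 / 2) * x) m2).
have m3 := shear_measurable (- (1 / 2)) m2.
rewrite -(area_flip m3); congr lebesgue2.
apply/seteqP; split => -[s n]; rewrite /preimage /of_skew /flip /shear /shear_reflect /=.
  by congr X; congr pair; field.
by congr X; congr pair; field.
Qed.

Lemma area_cone_coord X : measurable X -> lebesgue2 (cone_coord @^-1` X) = lebesgue2 X.
Proof.
move=> mX; rewrite -(area_shear_reflect (fun x => - (1 / 2) * x) mX).
have m1 := shear_reflect_measurable (- (1 / 2)) mX.
rewrite -(area_flip m1); have m2 := measurable_flip m1.
rewrite -(area_shear (fun x => 1 * x) m2).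
have m3 := shear_measurable 1 m2.
rewrite -(area_flip m3); congr lebesgue2.
apply/seteqP; split => -[s n]; rewrite /preimage /cone_coord /flip /shear /shear_reflect /=.
  by congr X; congr pair; field.
by congr X; congr pair; field.
Qed.

Definition mirror p : R * R := (- p.1, p.2).

Lemma mirror_measurable X : measurable X -> measurable (mirror @^-1` X).
Proof.
move=> mX; rewrite (_ : mirror = fun p => ((-1) * p.1 + 0 * p.2 + 0, 0 * p.1 + 1 * p.2 + 0)).
  exact: measurable_affine.
by apply/funext => p; rewrite /mirror; congr pair; ring.
Qed.

Lemma area_mirror X : measurable X -> lebesgue2 (mirror @^-1` X) = lebesgue2 X.
Proof.
move=> mX; rewrite -(area_flip mX); have m1 := measurable_flip mX.
rewrite -(area_shear_reflect (fun x => 0 * x) m1).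
have m2 := shear_reflect_measurable 0 m1.
rewrite -(area_flip m2); congr lebesgue2.
apply/seteqP; split => -[s n]; rewrite /preimage /mirror /flip /shear_reflect /=.
  by congr X; congr pair; ring.
by congr X; congr pair; ring.
Qed.

(** The open triangle with vertices [(-1/2, -1/2)], [(-1/6, -1/2)] and [(1/2, 1/2)]: the part of the
    kite below the diagonal. *)
Definition low : set (R * R) := [set p | [/\ p.2 < p.1, 6 * p.1 - 4 * p.2 < 1 & - (1 / 2) < p.2]].
Definition clow : set (R * R) := [set p | [/\ p.2 <= p.1, 6 * p.1 - 4 * p.2 <= 1 & - (1 / 2) <= p.2]].

Lemma low_clow : low `<=` clow.
Proof. by move=> p [h1 h2 h3]; split; exact: ltW. Qed.

Lemma low_skew p : low (of_skew p) <-> tri p.1 p.2.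
Proof.
case: p => s n; rewrite /low /of_skew /tri /=; split.
  move=> [h1 h2 h3]; apply/andP; split; first lra.
  have : `|s| < (1 - 3 * n) / 2 by rewrite ltr_norml; lra.
  lra.
move=> /andP[n0 h]; have : `|s| < (1 - 3 * n) / 2 by lra.
by rewrite ltr_norml => h'; split; lra.
Qed.

Lemma clow_Omega : clow `<=` Omega.
Proof.
move=> [x y] [/= h1 h2 h3].
(* With [n = x - y] and [s = (3 * x - y) / 2] the barycentric weights are [(1 - 3 * n) / 2 - s],
   [3 * n] and [(1 - 3 * n) / 2 + s]. *)
exists ((1 - 3 * (x - y)) / 2 - (3 * x - y) / 2), (3 * (x - y)),
  ((1 - 3 * (x - y)) / 2 + (3 * x - y) / 2), 0.
split; first by split; lra.
split; first by field.
by congr pair; rewrite /= /GRing.scale /=; field.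
Qed.

Lemma Omega_flip p : Omega p -> Omega (flip p).
Proof.
move=> [l1 [l2 [l3 [l4 [[h1 h2 h3 h4] [h5 ->]]]]]].
exists l1, l4, l3, l2; split => //; split; first by rewrite -h5; ring.
by congr pair; rewrite /= /GRing.scale /=; ring.
Qed.

Lemma OmegaP p : Omega p <-> clow p \/ clow (flip p).
Proof.
split; last first.
  by move=> [/clow_Omega//|/clow_Omega/Omega_flip]; rewrite flipK.
move=> [l1 [l2 [l3 [l4 [[h1 h2 h3 h4] [h5 ->]]]]]].
rewrite /clow /flip /= /GRing.scale /=.
have [xy|xy] := leP (l1 * - (1 / 2) + l2 * - (1 / 2) + l3 * (1 / 2) + l4 * - (1 / 6))
   (l1 * - (1 / 2) + l2 * - (1 / 6) + l3 * (1 / 2) + l4 * - (1 / 2)).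
  by left; split; lra.
by right; split; lra.
Qed.

Lemma measurable_clow : measurable clow.
Proof.
rewrite (_ : clow = [set p | 0 <= 1 * p.1 + (-1) * p.2 + 0] `&`
   [set p | 0 <= (- 6) * p.1 + 4 * p.2 + 1] `&` [set p | 0 <= 0 * p.1 + 1 * p.2 + 1 / 2]).
  by apply: measurableI; [apply: measurableI|]; exact: measurable_halfplane.
by apply/seteqP; split => p; rewrite /clow /=; [move=> [*]; split; [split|]; lra|move=> [[? ?] ?]; split; lra].
Qed.

Lemma open_low : open low.
Proof.
rewrite (_ : low = [set p | 0 < 1 * p.1 + (-1) * p.2 + 0] `&`
   [set p | 0 < (- 6) * p.1 + 4 * p.2 + 1] `&` [set p | 0 < 0 * p.1 + 1 * p.2 + 1 / 2]).
  by apply: openI; [apply: openI|]; exact: open_halfplane.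
by apply/seteqP; split => p; rewrite /low /=; [move=> [*]; split; [split|]; lra|move=> [[? ?] ?]; split; lra].
Qed.

Lemma open_flip X : open X -> open (@flip R @^-1` X).
Proof.
move=> oX; rewrite (_ : @flip R = fun p => (0 * p.1 + 1 * p.2 + 0, 1 * p.1 + 0 * p.2 + 0)).
  by have /continuousP := @continuous_pair_affine 0 1 0 1 0 0; apply.
by apply/funext => -[x y]; rewrite /flip /= !mul0r !mul1r !addr0 add0r.
Qed.

Lemma OmegaE : Omega = clow `|` @flip R @^-1` clow.
Proof. by apply/seteqP; split => p /OmegaP. Qed.

Lemma measurable_Omega : measurable Omega.
Proof.
rewrite OmegaE; apply: measurableU; first exact: measurable_clow.
exact: measurable_flip measurable_clow.
Qed.

Definition halves : set (R * R) := low `|` @flip R @^-1` low.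

Lemma open_halves : open halves.
Proof. by apply: openU; [exact: open_low|apply: open_flip; exact: open_low]. Qed.

Lemma halves_flip p : halves p -> halves (flip p).
Proof. by move=> [h|h]; [right; rewrite /preimage /= flipK|left]. Qed.

Lemma halves_Omega : halves `<=` Omega.
Proof.
by move=> p; rewrite OmegaE => -[/low_clow|/low_clow]; [left|right].
Qed.

Lemma halves_interior p : halves p -> (interior Omega `\` @diagL R) p.
Proof.
move=> h; split.
  by apply: filterS (open_nbhs_nbhs (conj open_halves h)); exact: halves_Omega.
by move=> [/= E _]; case: h => -[]; rewrite /= E ltxx.
Qed.

Definition edges : set (R * R) :=
  [set p | (-1) * p.1 + 1 * p.2 + 0 = 0] `|` [set p | 6 * p.1 + (- 4) * p.2 + (- 1) = 0]
  `|` [set p | 0 * p.1 + 1 * p.2 + 1 / 2 = 0].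

Lemma measurable_edges : measurable edges.
Proof. by apply: measurableU; [apply: measurableU|]; exact: measurable_line. Qed.

Lemma area_edges : lebesgue2 edges = 0%E.
Proof.
apply: area_nullU; [apply: measurableU; exact: measurable_line|exact: measurable_line| |].
  by apply: area_nullU; [exact: measurable_line|exact: measurable_line| |]; apply: area_line0; rewrite ?oppr_eq0.
exact: area_line0.
Qed.

Lemma clow_low p : clow p -> low p \/ edges p.
Proof.
case: p => x y [/= h1 h2 h3].
have [E1|n1] := eqVneq y x; first by right; left; left => /=; lra.
have [E2|n2] := eqVneq (6 * x - 4 * y) 1; first by right; left; right => /=; lra.
have [E3|n3] := eqVneq y (- (1 / 2)); first by right; right => /=; lra.
by left; split; rewrite /= lt_neqAle ?n1 ?n2 ?h1 ?h2 ?h3 ?andbT // eq_sym.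
Qed.

(** A null set containing everything that [halves] omits from [Omega]; it lets area identities pass
    from one to the other. *)
Definition seams : set (R * R) := edges `|` @flip R @^-1` edges.

Lemma measurable_seams : measurable seams.
Proof. by apply: measurableU; [|apply: measurable_flip]; exact: measurable_edges. Qed.

Lemma area_seams : lebesgue2 seams = 0%E.
Proof.
apply: area_nullU; [exact: measurable_edges|exact: measurable_flip measurable_edges|exact: area_edges|].
by rewrite area_flip; [exact: area_edges|exact: measurable_edges].
Qed.

Lemma Omega_halves : Omega `<=` halves `|` seams.
Proof.
rewrite OmegaE => p [/clow_low[h|h]|/clow_low[h|h]].
- by left; left.
- by right; left.
- by left; right.
- by right; right.
Qed.

Definition Tlow : set (R * R) := cone_coord @^-1` (@Quad R).

Lemma Tlow_hull : Tlow = hull4 (- (1 / 6), - (1 / 6)) (1 / 2, - (1 / 2)) (5 / 6, - (1 / 2)) (0, 0).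
Proof.
apply/seteqP; split => [[a b]|p [l1 [l2 [l3 [l4 [[h1 h2 h3 h4] [h5 ->]]]]]]].
  rewrite /Tlow /cone_coord /Quad /= => /andP[h1 h2].
  (* [Quad] has vertices [(-1/3, 1/3)], [(0, 1/2)], [(1/3, 1/3)] and [(0, 0)]. Its axis splits it
     into two triangles, and the weights are barycentric in the triangle that contains the point. *)
  have [ab|ab] := leP 0 (a + b).
    rewrite (ger0_norm ab) in h1 h2.
    exists 0, (2 * (- (1 / 2) * a - 3 / 2 * b - (a + b))), (3 * (a + b)), (1 - (a + b) - 2 * (- (1 / 2) * a - 3 / 2 * b)).
    split; first by split; lra.
    split; first by ring.
    by congr pair; rewrite /= /GRing.scale /=; field.
  rewrite (ltr0_norm ab) in h1 h2.
  exists (- 3 * (a + b)), (2 * (- (1 / 2) * a - 3 / 2 * b + (a + b))), 0, (1 + (a + b) - 2 * (- (1 / 2) * a - 3 / 2 * b)).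
  split; first by split; lra.
  split; first by ring.
  by congr pair; rewrite /= /GRing.scale /=; field.
rewrite /Tlow /cone_coord /Quad /= /GRing.scale /=.
set a := (X in `|X|).
have h : `|a| <= (l1 + l3) / 3 by rewrite /a ler_norml; lra.
by apply/andP; split; lra.
Qed.

Lemma ThetaE : Theta = Tlow `|` @flip R @^-1` Tlow.
Proof.
rewrite Tlow_hull /Theta; congr (_ `|` _).
apply/seteqP; split => [p|[x y]] [l1 [l2 [l3 [l4 [h [h5 E]]]]]].
  exists l1, l2, l3, l4; split => //; split => //; rewrite E.
  by congr pair; rewrite /= /GRing.scale /=; ring.
exists l1, l2, l3, l4; split => //; split => //.
case: E => -> ->.
by congr pair; rewrite /= /GRing.scale /=; ring.
Qed.

Lemma measurable_Tlow : measurable Tlow.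
Proof. by apply: cone_coord_measurable; exact: measurable_Quad. Qed.

Lemma measurable_Theta : measurable Theta.
Proof.
rewrite ThetaE; apply: measurableU; first exact: measurable_Tlow.
exact: measurable_flip measurable_Tlow.
Qed.

Lemma Tlow_le p : Tlow p -> p.2 <= p.1.
Proof.
case: p => a b; rewrite /Tlow /cone_coord /Quad /= => /andP[h1 h2].
by have := ler_norm (- (a + b)); rewrite normrN; lra.
Qed.

Lemma Theta_flip p : Theta p -> Theta (flip p).
Proof. by rewrite ThetaE => -[h|h]; [right; rewrite /preimage /= flipK|left]. Qed.

End Geometry.

(** * Symmetries of the Brenier map and its area identity on one half *)

Section BrenierPotential.
Variable R : realType.
Variable phi : R * R -> R.
Hypothesis brenier : brenier_potential phi.
Hypothesis smooth : twice_differentiable_on (interior (@Omega R) `\` @diagL R) phi.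
Implicit Types (p q : R * R) (B : set (R * R)).

Local Notation Omega := (@Omega R).
Local Notation Theta := (@Theta R).
Local Notation flip := (@flip R).
Local Notation g := (grad phi).

Definition regular : set (R * R) := interior Omega `\` @diagL R.

Lemma open_regular : open regular.
Proof.
rewrite /regular setDE; apply: openI; first exact: open_interior.
have -> : @diagL R = [set p | 1 * p.1 + (-1) * p.2 + 0 = 0] `&` [set p | 0 <= 1 * p.1 + 0 * p.2 + 0].
  apply/seteqP; split => p; rewrite /diagL /=; first by move=> [-> h]; split; lra.
  by move=> [h1 h2]; split; lra.
rewrite setCI; apply: openU.
  rewrite (_ : ~` _ = [set p | 0 < 1 * p.1 + (-1) * p.2 + 0] `|` [set p | 0 < (-1) * p.1 + 1 * p.2 + 0]).
    by apply: openU; exact: open_halfplane.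
  apply/seteqP; split => p /=; last by move=> [h|h] E; lra.
  by move=> h; case: (ltrgtP p.1 p.2) => h'; [right|left|exfalso; apply: h]; lra.
rewrite (_ : ~` _ = [set p | 0 < (-1) * p.1 + 0 * p.2 + 0]); first exact: open_halfplane.
by apply/seteqP; split => p /=; [move/negP; rewrite -ltNge; lra|move=> h1 h2; lra].
Qed.

Lemma regular_Omega : regular `<=` Omega.
Proof. by move=> p [/interior_subset]. Qed.

Lemma halves_regular : @halves R `<=` regular.
Proof. by move=> p /halves_interior. Qed.

(** Convexity on the segment from [p] to [q], linearised by differentiability at a point close to
    [p]. The target [q] may be any point of [Omega], including its boundary and the cut, where no
    gradient is assumed. *)
Lemma subgradient p q : regular p -> Omega q -> phi p + dot (g p) (q - p) <= phi q.
Proof.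
move=> rp Oq; have [dphi _ _] := smooth rp.
have F := differentiable_frechet dphi.
apply/ler_addgt0Pr => e e0.
pose k := `|q.1 - p.1| + `|q.2 - p.2| + 1.
have k0 : 0 < k by rewrite ltr_wpDl // addr_ge0.
have [d d0 D] := F _ (divr_gt0 e0 k0).
have [t t0 [t1 tk]] : exists2 t, 0 < t & t <= 1 /\ t * k <= d / 2.
  exists (Num.min 1 (d / 2 / k)); first by rewrite lt_min ltr01 !divr_gt0.
  by split; [rewrite ge_min lexx|rewrite -ler_pdivlMr // ge_min lexx orbT].
have [convex _] := brenier.
have C := convex q p t Oq (regular_Omega rp) (ltac:(rewrite t1 ltW //)).
have E : t *: q + (1 - t) *: p = (p.1 + t * (q.1 - p.1), p.2 + t * (q.2 - p.2)).
  by rewrite [LHS]surjective_pairing; congr pair; rewrite /= /GRing.scale /=; ring.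
rewrite E in C.
have ex (a b : R) : a + t * (b - a) - a = t * (b - a) by ring.
have := D (p.1 + t * (q.1 - p.1)) (p.2 + t * (q.2 - p.2)); rewrite !ex.
have n1 : `|t * (q.1 - p.1)| <= t * (k - 1 - `|q.2 - p.2|).
  by rewrite normrM (gtr0_norm t0) ler_wpM2l ?(ltW t0) // /k; lra.
have n2 : `|t * (q.2 - p.2)| = t * `|q.2 - p.2| by rewrite normrM (gtr0_norm t0).
have n3 : 0 <= t * `|q.2 - p.2| by rewrite mulr_ge0 // ltW.
have n4 : 0 <= `|t * (q.1 - p.1)| by [].
have -> : `|t * (q.1 - p.1)| < d by lra.
have -> : `|t * (q.2 - p.2)| < d by lra.
move=> /(_ isT isT); rewrite -surjective_pairing => K.
have {}K : `|phi (p.1 + t * (q.1 - p.1), p.2 + t * (q.2 - p.2)) - phi p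
   - (g p).1 * (t * (q.1 - p.1)) - (g p).2 * (t * (q.2 - p.2))| <= e * t.
  apply: le_trans K _.
  have -> : e * t = e / k * (t * k) by field; rewrite gt_eqF.
  by rewrite ler_wpM2l // ?divr_ge0 ?ltW //; lra.
rewrite -(ler_pM2l t0) /dot.
move: K; rewrite ler_norml => /andP[K _].
by move: C K; case: (g p) => a b /=; lra.
Qed.

Lemma gradient_monotone p q : regular p -> regular q -> 0 <= dot (g p - g q) (p - q).
Proof.
move=> rp rq; have := subgradient rp (regular_Omega rq); have := subgradient rq (regular_Omega rp).
by rewrite /dot; case: (g p) => a b; case: (g q) => c d /=; lra.
Qed.

Lemma phi_cont p : regular p -> {for p, continuous phi}.
Proof. by move=> /smooth[/differentiable_continuous]. Qed.

Lemma grad_cont p : regular p -> {for p, continuous g}.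
Proof.
move=> /smooth[_ /differentiable_continuous c1 /differentiable_continuous c2].
exact: (cvg_pair c1 c2).
Qed.

Lemma measurable_pull B : measurable B -> measurable (Omega `&` g @^-1` B).
Proof. by move=> mB; have [_ [mg _]] := brenier; apply: mg => //; exact: measurable_Omega. Qed.

Lemma area_pull B : measurable B -> lebesgue2 (Omega `&` g @^-1` B) = lebesgue2 (Theta `&` B).
Proof. by move=> mB; have [_ [_ ->]] := brenier. Qed.

Lemma continuous_flip : continuous flip.
Proof.
move=> p; have c1 : (@snd R R) @ p --> p.2 by exact: cvg_snd.
have c2 : (@fst R R) @ p --> p.1 by exact: cvg_fst.
exact: (cvg_pair c1 c2).
Qed.

Lemma measurable_halves : measurable (@halves R).
Proof. by apply: open2_measurable; exact: open_halves. Qed.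

Lemma measurable_halves_pull B : measurable B -> measurable (@halves R `&` g @^-1` B).
Proof.
move=> mB; have -> : @halves R `&` g @^-1` B = @halves R `&` (Omega `&` g @^-1` B).
  by rewrite setIA (setIidl (@halves_Omega R)).
by apply: measurableI; [exact: measurable_halves|exact: measurable_pull].
Qed.

Lemma area_halves_pull B : measurable B ->
  lebesgue2 (@halves R `&` g @^-1` B) = lebesgue2 (Theta `&` B).
Proof.
move=> mB; rewrite -(area_pull mB).
apply: (area_ae_eq _ _ (@measurable_seams R) (@area_seams R)).
- exact: measurable_halves_pull.
- exact: measurable_pull.
- by move=> p [/halves_Omega h1 h2]; left.
- by move=> p [/Omega_halves[h1|h1] h2]; [left|right].
Qed.

Lemma flip_dot p q : dot (flip p) (flip q) = dot p q.
Proof. by rewrite /dot /= addrC. Qed.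

Lemma flipB p q : flip (p - q) = flip p - flip q. Proof. by []. Qed.

(* Uniqueness of the Brenier map, applied to [phi] and its reflection. *)
Lemma grad_flip p : halves p -> g p = flip (g (flip p)).
Proof.
apply: (@gradient_unique R (@halves R) 1 phi (phi \o flip) g (flip \o g \o flip)).
- exact: open_halves.
- apply: le_lt_trans (le_area (B := [set q : R * R | -1 <= q.1 <= 1 /\ -1 <= q.2 <= 1]) _ _ _) _.
  + exact: measurable_halves.
  + exact: measurable_crect.
  + move=> q /halves_Omega/OmegaP; rewrite /clow /flip /=.
    by move=> [[h1 h2 h3]|[h1 h2 h3]]; split; lra.
  + by rewrite area_crect ?ltry //; lra.
- move=> q /halves_Omega/OmegaP; rewrite /clow /flip /= !ler_norml.
  by move=> [[h1 h2 h3]|[h1 h2 h3]]; split; lra.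
- move=> q hq; have rq := halves_regular hq; have rq' := halves_regular (halves_flip hq).
  split; [exact: phi_cont| |exact: grad_cont|].
    by apply: (@continuous_comp _ _ _ flip phi); [exact: continuous_flip|exact: phi_cont].
  apply: (@continuous_comp _ _ _ (g \o flip) flip); last exact: continuous_flip.
  by apply: (@continuous_comp _ _ _ flip g); [exact: continuous_flip|exact: grad_cont].
- by move=> q z hq hz; apply: subgradient; [exact: halves_regular|exact: halves_Omega].
- move=> q z hq hz; rewrite /= -flip_dot flipK flipB.
  by apply: subgradient; [exact/halves_regular/halves_flip|exact/halves_Omega/halves_flip].
move=> B oB; have mB := open2_measurable oB.
rewrite (area_halves_pull mB).
have -> : @halves R `&` (flip \o g \o flip) @^-1` B = flip @^-1` (@halves R `&` g @^-1` (flip @^-1` B)).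
  by apply/seteqP; split => q [h1 h2]; split => //; [exact: halves_flip|rewrite -[q]flipK; exact: halves_flip].
have mB' := measurable_flip mB.
rewrite area_flip; last exact: measurable_halves_pull.
rewrite (area_halves_pull mB') -[LHS]area_flip; last first.
  by apply: measurableI => //; exact: measurable_Theta.
congr lebesgue2; apply/seteqP; split => q [h1 h2]; split => //.
  by rewrite -[q]flipK; exact: Theta_flip.
exact: Theta_flip.
Qed.

(** The gradient is monotone between [p] and its mirror image, where by symmetry it takes the
    reflected value. *)
Lemma grad_low p : low p -> (g p).2 <= (g p).1.
Proof.
move=> lp; have hp : halves p by left.
have := gradient_monotone (halves_regular hp) (halves_regular (halves_flip hp)).
rewrite (grad_flip (halves_flip hp)) flipK /dot.
case: lp => xy _ _.
case: (g p) => a b /=.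
have -> : (a - b) * (p.1 - p.2) + (b - a) * (p.2 - p.1) = 2 * (p.1 - p.2) * (a - b) by ring.
by rewrite pmulr_rge0 ?subr_ge0 // mulr_gt0 // subr_gt0.
Qed.

Definition diagonal : set (R * R) := [set p | 1 * p.1 + (-1) * p.2 + 0 = 0].

(** The lower half is mapped to the lower piece of [Theta]: intersecting [B] with the open half
    plane below the diagonal selects it. The set where the gradient is on the diagonal is null,
    since the diagonal has no area in [Theta]. *)
Lemma area_low_pull B : measurable B ->
  lebesgue2 (@low R `&` g @^-1` B) = lebesgue2 (@Tlow R `&` B).
Proof.
move=> mB.
have mD : measurable diagonal by exact: measurable_line.
have aD : lebesgue2 diagonal = 0%E by apply: area_line0; rewrite oppr_eq0.
pose lt : set (R * R) := [set p | 0 < 1 * p.1 + (-1) * p.2 + 0].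
have mlt : measurable lt by apply: open2_measurable; exact: open_halfplane.
have mBl : measurable (B `&` lt) by exact: measurableI.
have mlow : measurable (@low R) by apply: open2_measurable; exact: open_low.
transitivity (lebesgue2 (Omega `&` g @^-1` (B `&` lt))).
  apply: (@area_ae_eq _ _ _ ((Omega `&` g @^-1` diagonal) `|` @seams R)).
  - have -> : @low R `&` g @^-1` B = @low R `&` (@halves R `&` g @^-1` B).
      by apply/seteqP; split => p; [move=> [h1 h2]; split => //; split => //; left|move=> [h1 [h2 h3]]].
    by apply: measurableI => //; exact: measurable_halves_pull.
  - exact: measurable_pull.
  - by apply: measurableU; [exact: measurable_pull|exact: measurable_seams].
  - apply: area_nullU; [exact: measurable_pull|exact: measurable_seams| |exact: area_seams].
    rewrite (area_pull mD); apply: (area_null_sub _ mD (@subIsetr _ Theta diagonal) aD).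
    by apply: measurableI => //; exact: measurable_Theta.
  - move=> p [lp Bp]; have Op : Omega p by apply: halves_Omega; left.
    have [E|n] := eqVneq (g p).2 (g p).1.
      right; left; split => //; suff : 1 * (g p).1 + (-1) * (g p).2 + 0 = 0 by [].
      by rewrite E; ring.
    left; split => //; split => //.
    have h : (g p).2 < (g p).1 by rewrite lt_neqAle n grad_low.
    suff : 0 < 1 * (g p).1 + (-1) * (g p).2 + 0 by [].
    by rewrite mul1r mulN1r addr0 subr_gt0.
  - move=> p [/Omega_halves[[hp|hp]|hp] [Bp L]]; [by left| |by right; right].
    have hp' : halves p by right.
    have {}L : 0 < 1 * (g p).1 + (-1) * (g p).2 + 0 by [].
    have := grad_low hp; rewrite (grad_flip hp') in L.
    by move: (g (flip p)) L => q /=; lra.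
rewrite (area_pull mBl).
apply: (@area_ae_eq _ _ _ diagonal) => //.
- by apply: measurableI => //; exact: measurable_Theta.
- by apply: measurableI => //; exact: measurable_Tlow.
- move=> p [+ [Bp L]]; have {}L : 0 < 1 * p.1 + (-1) * p.2 + 0 by [].
  rewrite ThetaE => -[hp|/Tlow_le hp]; first by left.
  have {}hp : p.1 <= p.2 by []; suff : p.2 < p.2 by rewrite ltxx.
  by lra.
- move=> p [Tp Bp]; have := Tlow_le Tp; rewrite le_eqVlt => /orP[/eqP E|h].
    by right; suff : 1 * p.1 + (-1) * p.2 + 0 = 0; [|rewrite E; ring].
  left; split; first by rewrite ThetaE; left.
  by split => //; suff : 0 < 1 * p.1 + (-1) * p.2 + 0; [|lra].
Qed.

Definition fskew (s n : R) : R := phi (of_skew (s, n)).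
Definition Tskew p : R * R := cone_coord (g (of_skew p)).
Definition Pskew (s n : R) : R := (Tskew (s, n)).1.
Definition Qskew (s n : R) : R := (Tskew (s, n)).2.

Lemma dot_skew p q r : dot p (of_skew q - of_skew r) = dot (cone_coord p) (q - r).
Proof. by rewrite /dot /=; ring. Qed.

Lemma pull_skew B : @Tri R `&` Tskew @^-1` B =
  @of_skew R @^-1` (@low R `&` g @^-1` (@cone_coord R @^-1` B)).
Proof. by apply/seteqP; split => p [h1 h2]; split => //; exact/low_skew. Qed.

Lemma measurable_low_pull B : measurable B -> measurable (@low R `&` g @^-1` B).
Proof.
move=> mB; have -> : @low R `&` g @^-1` B = @low R `&` (@halves R `&` g @^-1` B).
  by apply/seteqP; split => p; [move=> [h1 h2]; split => //; split => //; left|move=> [h1 [h2 h3]]].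
apply: measurableI; last exact: measurable_halves_pull.
by apply: open2_measurable; exact: open_low.
Qed.

Lemma measurable_Tskew B : measurable B -> measurable (@Tri R `&` Tskew @^-1` B).
Proof.
move=> mB; rewrite pull_skew; apply: of_skew_measurable; apply: measurable_low_pull.
exact: cone_coord_measurable.
Qed.

Lemma area_Tskew B : measurable B ->
  lebesgue2 (@Tri R `&` Tskew @^-1` B) = lebesgue2 (@Quad R `&` B).
Proof.
move=> mB; have mB' := cone_coord_measurable mB.
rewrite pull_skew area_of_skew; last exact: measurable_low_pull.
rewrite (area_low_pull mB') -[RHS]area_cone_coord //.
by apply: measurableI => //; exact: measurable_Quad.
Qed.

Lemma Tri_low p : Tri p -> low (of_skew p).
Proof. by move=> h; apply/low_skew. Qed.

Lemma Tri_regular p : Tri p -> regular (of_skew p).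
Proof. by move=> /Tri_low h; apply: halves_regular; left. Qed.

Lemma clow_skew (s n : R) : 0 <= n -> 2 * `|s| < 1 - 3 * n -> clow (of_skew (s, n)).
Proof.
move=> n0 h; have : `|s| < (1 - 3 * n) / 2 by lra.
by rewrite ltr_norml /clow /of_skew /= => h'; split; lra.
Qed.

Lemma continuous_of_skew : continuous (@of_skew R).
Proof.
rewrite (_ : @of_skew R = fun p => (1 * p.1 + (- 2^-1) * p.2 + 0, 1 * p.1 + (- (3 / 2)) * p.2 + 0)).
  exact: continuous_pair_affine.
by apply/funext => p; rewrite /of_skew; congr pair; ring.
Qed.

Lemma continuous_cone_coord : continuous (@cone_coord R).
Proof.
rewrite (_ : @cone_coord R = fun p => (1 * p.1 + 1 * p.2 + 0, (- (1 / 2)) * p.1 + (- (3 / 2)) * p.2 + 0)).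
  exact: continuous_pair_affine.
by apply/funext => p; rewrite /cone_coord; congr pair; ring.
Qed.

Lemma Tskew_cont p : regular (of_skew p) -> {for p, continuous Tskew}.
Proof.
move=> h; apply: (@continuous_comp _ _ _ (g \o @of_skew R) (@cone_coord R)); last exact: continuous_cone_coord.
by apply: (@continuous_comp _ _ _ (@of_skew R) g); [exact: continuous_of_skew|exact: grad_cont].
Qed.

Lemma open_Tri : open (@Tri R).
Proof.
have -> : @Tri R = @of_skew R @^-1` @low R by apply/seteqP; split => p /low_skew.
by have /continuousP := continuous_of_skew; apply; exact: open_low.
Qed.

Lemma open_Quad_compl : open (~` @Quad R).
Proof.
rewrite (_ : ~` _ = ([set p | 0 < 1 * p.1 + (-1) * p.2 + 0] `|` [set p | 0 < (-1) * p.1 + (-1) * p.2 + 0])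
  `|` ([set p | 0 < (1 / 2) * p.1 + 1 * p.2 + - (1 / 2)] `|` [set p | 0 < (- (1 / 2)) * p.1 + 1 * p.2 + - (1 / 2)])).
  by apply: openU; apply: openU; exact: open_halfplane.
apply/seteqP; split => p /=; rewrite /Quad /=; last first.
  move=> h /andP[q1 q2]; have n1 := ler_norm p.1; have n2 := ler_norm (- p.1); rewrite normrN in n2.
  by case: h => -[]; lra.
move/negP; rewrite negb_and -!ltNge => /orP[|] h; [left|right].
  by case: (ger0P p.1) h => _ h; [left|right]; lra.
by case: (ger0P p.1) h => _ h; [left|right]; lra.
Qed.

(** [Quad] is closed, so by continuity a gradient value outside it would occur on a non-empty open
    set, whose positive area contradicts the area identity. *)
Lemma Tskew_Quad p : Tri p -> Quad (Tskew p).
Proof.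
move=> tp; apply: contrapT => nQ.
have oX : open (@Tri R `&` Tskew @^-1` (~` @Quad R)).
  apply: open_preimage_in; [exact: open_Tri| |exact: open_Quad_compl].
  by move=> q /Tri_regular; exact: Tskew_cont.
have := @area_open_gt0 R _ p oX (conj tp nQ).
rewrite area_Tskew; last by apply: measurableC; exact: measurable_Quad.
by rewrite setICr /lebesgue2 measure0 ltxx.
Qed.

Lemma mirrorK : involutive (@mirror R).
Proof. by case=> x y; rewrite /mirror /= opprK. Qed.

Lemma Tri_mirror p : Tri p -> Tri (mirror p).
Proof. by rewrite /Tri /tri /= normrN. Qed.

Lemma continuous_mirror : continuous (@mirror R).
Proof.
rewrite (_ : @mirror R = fun p => ((-1) * p.1 + 0 * p.2 + 0, 0 * p.1 + 1 * p.2 + 0)).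
  exact: continuous_pair_affine.
by apply/funext => p; rewrite /mirror; congr pair; ring.
Qed.

Lemma skew_subgradient p q : Tri p -> Omega (of_skew q) ->
  phi (of_skew p) + dot (Tskew p) (q - p) <= phi (of_skew q).
Proof. by move=> /Tri_regular rp Oq; rewrite -dot_skew; exact: subgradient. Qed.

Lemma Tri_Omega p : Tri p -> Omega (of_skew p).
Proof. by move=> /Tri_regular/regular_Omega. Qed.

(* The hidden symmetry: the half of [Omega] and the half of [Theta] are both
   invariant under [s -> -s], which exchanges two vertices of the triangle. *)
Lemma Tskew_mirror p : Tri p -> Tskew p = mirror (Tskew (mirror p)).
Proof.
have mirror_dot q z : dot (mirror q) (mirror z) = dot q z by rewrite /dot /=; ring.
have mirrorB q z : mirror (q - z) = mirror q - mirror z.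
  by rewrite /mirror /= opprB; congr pair; rewrite /= opprK addrC.
apply: (@gradient_unique R (@Tri R) 1 (phi \o @of_skew R) (phi \o @of_skew R \o @mirror R)
  Tskew (@mirror R \o Tskew \o @mirror R)).
- exact: open_Tri.
- rewrite -ge0_fin_numE ?area_ge0 //; apply: ar_fin; last exact: Tri_box.
  by apply: open2_measurable; exact: open_Tri.
- by move=> q /Tri_box[h1 h2]; rewrite !ler_norml; split; lra.
- move=> q tq; have tq' := Tri_mirror tq.
  have cphi z : Tri z -> {for z, continuous (phi \o @of_skew R)}.
    by move=> tz; apply: (@continuous_comp _ _ _ (@of_skew R) phi); [exact: continuous_of_skew|exact/phi_cont/Tri_regular].
  split; [exact: cphi| |exact/Tskew_cont/Tri_regular|].
    by apply: (@continuous_comp _ _ _ (@mirror R) (phi \o @of_skew R)); [exact: continuous_mirror|exact: cphi].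
  apply: (@continuous_comp _ _ _ (Tskew \o @mirror R) (@mirror R)); last exact: continuous_mirror.
  by apply: (@continuous_comp _ _ _ (@mirror R) Tskew); [exact: continuous_mirror|exact/Tskew_cont/Tri_regular].
- by move=> q z tq tz; apply: skew_subgradient => //; exact: Tri_Omega.
- move=> q z tq tz; rewrite /= -mirror_dot mirrorK mirrorB.
  by apply: skew_subgradient; [exact: Tri_mirror|exact/Tri_Omega/Tri_mirror].
move=> B oB; have mB := open2_measurable oB; have mB' := mirror_measurable mB.
rewrite (area_Tskew mB).
have -> : @Tri R `&` (@mirror R \o Tskew \o @mirror R) @^-1` B
  = @mirror R @^-1` (@Tri R `&` Tskew @^-1` (@mirror R @^-1` B)).
  by apply/seteqP; split => q [h1 h2]; split => //; [exact: Tri_mirror|rewrite -[q]mirrorK; exact: Tri_mirror].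
rewrite area_mirror; last exact: measurable_Tskew.
rewrite (area_Tskew mB') -[LHS]area_mirror; last first.
  by apply: measurableI => //; exact: measurable_Quad.
congr lebesgue2; apply/seteqP; split => q [h1 h2]; split => //.
  by move: h1; rewrite /preimage /Quad /mirror /= normrN.
by rewrite /preimage /= /Quad /= normrN.
Qed.

End BrenierPotential.

Lemma le_max4 (R : realType) (a b c d : R) (m := Num.max (Num.max a b) (Num.max c d)) :
  [/\ a <= m, b <= m, c <= m & d <= m].
Proof. by split; rewrite /m !le_max lexx ?orbT. Qed.

Lemma norm_lt_coords (R : realType) (p : R * R) (d : R) : `|p| < d -> `|p.1| < d /\ `|p.2| < d.
Proof. by rewrite prod_normE gt_max => /andP[]. Qed.

(** * Verification of the half potential and the blow-up of the Hessian *)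

Section BlowUp.
Variable R : realType.
Variable phi : R * R -> R.
Hypothesis brenier : brenier_potential phi.
Hypothesis smooth : twice_differentiable_on (interior (@Omega R) `\` @diagL R) phi.
Implicit Types (p q : R * R) (s n x y : R).

Local Notation regular := (@regular R).
Local Notation g := (grad phi).
Local Notation f := (fskew phi).
Local Notation P := (Pskew phi).
Local Notation Q := (Qskew phi).

Lemma near_regular x y : regular (x, y) -> exists2 r : R, 0 < r &
  forall x' y', `|x' - x| < r -> `|y' - y| < r -> regular (x', y').
Proof.
move=> h; apply: (near_prodP (x, y) (fun x' y' => regular (x', y'))).1.
have : \forall q \near (x, y), regular q by apply: open_nbhs_nbhs; split => //; exact: open_regular.
by apply: filterS => -[].
Qed.

Lemma near_regular_skew s n : regular (of_skew (s, n)) -> exists2 r : R, 0 < r &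
  forall s' n', `|s' - s| < r -> `|n' - n| < r -> regular (of_skew (s', n')).
Proof.
move=> h; apply: (near_prodP (s, n) (fun s' n' => regular (of_skew (s', n')))).1.
have : \forall q \near (s, n), regular (of_skew q).
  by apply: continuous_of_skew; apply: open_nbhs_nbhs; split => //; exact: open_regular.
by apply: filterS => -[].
Qed.

Lemma fskew_derive s n : regular (of_skew (s, n)) -> is_derive s 1 (f ^~ n) (P s n).
Proof.
move=> h; have [dphi _ _] := smooth h.
exact: frechet_derive_l (frechet_skew (differentiable_frechet dphi)).
Qed.

(** Stated at all regular points, not just in the open triangle, so as to include the negative
    diagonal. The factor 4 is the sum [1/4 + 3/4 + 3/4 + 9/4] of the coefficients of [C]. *)
Lemma regular_hessian s n : regular (of_skew (s, n)) -> exists A B C,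
  [/\ frechet P s n A B /\ frechet Q s n B C,
      0 <= A, B ^+ 2 <= A * C, 1 <= (`|A| + `|B|) * (`|B| + `|C|) &
      0 <= C <= 4 * hess_norm phi (of_skew (s, n))].
Proof.
move=> h; set p := of_skew (s, n) in h *.
have [dphi d1 d2] := smooth h.
pose g1 x y := pd (@e1 R) phi (x, y); pose g2 x y := pd (@e2 R) phi (x, y).
pose h11 := pd (@e1 R) (pd (@e1 R) phi) p; pose h12 := pd (@e2 R) (pd (@e1 R) phi) p.
pose h21 := pd (@e1 R) (pd (@e2 R) phi) p; pose h22 := pd (@e2 R) (pd (@e2 R) phi) p.
have F1 : frechet g1 p.1 p.2 h11 h12 := differentiable_frechet d1.
have F2 : frechet g2 p.1 p.2 h21 h22 := differentiable_frechet d2.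
have sym : h12 = h21.
  have [r r0 Hr] := near_regular (x := p.1) (y := p.2) h.
  apply: (hessian_symmetric r0 _ F1 F2 (g := fun x y => phi (x, y))) => x y hx hy.
  have [dxy _ _] := smooth (Hr x y hx hy).
  have F := differentiable_frechet dxy.
  by split; [exact: frechet_derive_l F|exact: frechet_derive_r F].
pose A := (h11 + h12) + (h21 + h22).
pose B := (- (1 / 2) * h11 - 3 / 2 * h12) + (- (1 / 2) * h21 - 3 / 2 * h22).
pose C := - (1 / 2) * (- (1 / 2) * h11 - 3 / 2 * h12) + - (3 / 2) * (- (1 / 2) * h21 - 3 / 2 * h22).
have S1 : frechet (skew g1) s n _ _ := frechet_skew F1.
have S2 : frechet (skew g2) s n _ _ := frechet_skew F2.
have FP : frechet P s n A B := frechetD S1 S2.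
have FQ : frechet Q s n B C.
  have EB : - (1 / 2) * (h11 + h12) + - (3 / 2) * (h21 + h22) = B by rewrite /B sym; ring.
  rewrite -EB; have := frechetD (frechetZ (- (1 / 2)) S1) (frechetZ (- (3 / 2)) S2).
  congr frechet; apply/funext => a; apply/funext => b.
  transitivity (- (1 / 2) * skew g1 a b - 3 / 2 * skew g2 a b); last by [].
  by rewrite [- (3 / 2) * _]mulNr.
have [r r0 Hr] := near_regular_skew h.
have [A0 C0 BAC] : [/\ 0 <= A, 0 <= C & B ^+ 2 <= A * C].
  apply: (monotone_psd r0 _ FP FQ) => a b ha hb.
  have := gradient_monotone brenier smooth (Hr a b ha hb) h.
  rewrite dot_skew /dot /Pskew /Qskew /Tskew.
  move: (g (of_skew (a, b))) (g (of_skew (s, n))) => [u1 u2] [v1 v2].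
  rewrite /cone_coord /=; lra.
exists A, B, C; split; [by split|exact: A0|exact: BAC| |].
(* A square whose gradient image lies in [rect] cannot have larger area than [rect]: the area
   identity and the two unimodular changes of coordinates compare them. *)
- apply: (expansion_bound r0 _ FP FQ) => t a1 a2 b1 b2 /andP[t0 tr] a12 b12 hb.
  pose box : set (R * R) := [set q | s - t < q.1 < s + t /\ n - t < q.2 < n + t].
  pose rect : set (R * R) := [set q | a1 <= q.1 <= a2 /\ b1 <= q.2 <= b2].
  have mrect : measurable rect by exact: measurable_crect.
  have mcone := cone_coord_measurable mrect.
  have mpull := measurable_pull brenier mcone.
  have sub : box `<=` @of_skew R @^-1` (@Omega R `&` g @^-1` (@cone_coord R @^-1` rect)).
    move=> [a b] [/= ha hb'].
    have ha' : `|a - s| < t by rewrite ltr_norml; lra.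
    have hb'' : `|b - n| < t by rewrite ltr_norml; lra.
    split; last exact: hb.
    by apply: regular_Omega; apply: Hr; [exact: lt_trans ha' tr|exact: lt_trans hb'' tr].
  have K1 := le_area (measurable_rect _ _ _ _) (of_skew_measurable mpull) sub.
  have K2 := le_area (measurableI _ _ (@measurable_Theta R) mcone) mcone (@subIsetr _ _ _).
  have E1 := area_of_skew mpull; have E2 := area_pull brenier mcone; have E3 := area_cone_coord mrect.
  have K : (lebesgue2 box <= lebesgue2 rect)%E.
    by apply: le_trans K1 _; rewrite E1 E2 -E3.
  move: K; rewrite /box /rect area_rect; [|lra|lra].
  rewrite (area_crect a12 b12) lee_fin.
  by have -> : (s + t - (s - t)) * (n + t - (n - t)) = (2 * t) ^+ 2 by ring.
- rewrite C0 /=; set H := hess_norm phi p.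
  have [l1 l3 l2 l4] : [/\ `|h11| <= H, `|h21| <= H, `|h12| <= H & `|h22| <= H] := le_max4 _ _ _ _.
  rewrite /C; move: h11 h12 h21 h22 H l1 l2 l3 l4 {F1 F2 sym A B C S1 S2 FP FQ A0 C0 BAC} => a b c d m.
  by rewrite !ler_norml; lra.
Qed.

Lemma Pskew_bound s n : tri s n -> [/\ `|P s n| <= 1 / 3, 0 <= Q s n & Q s n <= 1 / 2].
Proof.
move=> t; have : Quad (P s n, Q s n) := Tskew_Quad brenier smooth (p := (s, n)) t.
move: (P s n) (Q s n) => a b; rewrite /Quad /= => /andP[h1 h2].
by have := normr_ge0 a; split; lra.
Qed.

Lemma fskew_sub s n s' n' : tri s n -> 0 <= n' -> 2 * `|s'| < 1 - 3 * n' ->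
  f s n + P s n * (s' - s) + Q s n * (n' - n) <= f s' n'.
Proof.
move=> t n0 hs; have O : Omega (of_skew (s', n')) by apply: clow_Omega; exact: clow_skew.
by have := skew_subgradient brenier smooth (p := (s, n)) t O; rewrite /dot /= addrA.
Qed.

(** Subgradients in the open half bound [f] on the diagonal only from below. For an upper bound,
    [of_skew (s, 0)] is the midpoint of [q] and its mirror image: convexity between them is combined
    with the supporting plane at [flip q], and [|P| + Q <= 1] bounds the slope. *)
Lemma fskew_diag s (t : R) : 0 < t -> tri (s + t) t -> f s 0 <= f (s + t) t + t.
Proof.
move=> t0 tt; have low1 := Tri_low (p := (s + t, t)) tt.
have hq : halves (of_skew (s + t, t)) by left.
have [hP hQ1 hQ2] := Pskew_bound tt.
set q := of_skew (s + t, t) in low1 hq.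
have tri_s : 2 * `|s| < 1 - 3 * 0.
  have /andP[_ h] := tt; have -> : s = (s + t) - t by ring.
  by have := ler_normB (s + t) t; rewrite (gtr0_norm t0); lra.
have Op : Omega (of_skew (s, 0)) by apply: clow_Omega; exact: clow_skew.
have [convex _] := brenier.
have E : of_skew (s, 0) = (1 / 2) *: q + (1 - 1 / 2) *: flip q.
  by congr pair; rewrite /= /GRing.scale /=; field.
have h2 : 0 <= (1 / 2 : R) <= 1 by lra.
have := convex q (flip q) (1 / 2) (halves_Omega hq) (halves_Omega (halves_flip hq)) h2.
rewrite -E.
have := subgradient brenier smooth (halves_regular (halves_flip hq)) Op.
rewrite (grad_flip brenier smooth (halves_flip hq)) flipK.
have -> : dot (flip (g q)) (of_skew (s, 0) - flip q) = - (P (s + t) t + Q (s + t) t) * t.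
  by rewrite /Pskew /Qskew /Tskew -/q; case: (g q) => a b; rewrite /dot /cone_coord /=; field.
rewrite /fskew -/q.
have := ler_norm (P (s + t) t); have : (P (s + t) t + Q (s + t) t) * t <= 1 * t.
  by rewrite ler_wpM2r ?(ltW t0) //; have := ler_norm (P (s + t) t); lra.
lra.
Qed.

(** From above by the subgradient inequality at [(s, n)] tested on the diagonal, from below by
    [fskew_diag] at height [|s - s0| + n] followed by the subgradient inequality there. *)
Lemma fskew_near_diag s0 s n : tri s n -> tri (s0 + (`|s - s0| + n)) (`|s - s0| + n) ->
  `|f s n - f s0 0| <= 3 * (`|s - s0| + n).
Proof.
move=> t; have /andP[n0 hs] := t.
have [d dE] : exists d, d = `|s - s0| + n by exists (`|s - s0| + n).
rewrite -dE => td.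
have d0 : 0 < d by case/andP: td.
have D := fskew_diag d0 td.
have kd : `|s - s0| <= d by rewrite dE lerDl ltW.
have nn : n <= d by rewrite dE lerDr.
have tri_s0 : 2 * `|s0| < 1 - 3 * 0.
  have /andP[_ h] := td; have -> : s0 = (s0 + d) - d by ring.
  by have := ler_normB (s0 + d) d; rewrite (gtr0_norm d0); lra.
have U := fskew_sub t (lexx 0) tri_s0.
have L := fskew_sub td (ltW n0) hs.
have [p1 q1 q2] := Pskew_bound t; have [p3 q3 q4] := Pskew_bound td.
have b1 : P s n * (s - s0) <= 1 / 3 * d.
  apply: le_trans (ler_norm _) _; rewrite normrM.
  by have := ler_pM (normr_ge0 _) (normr_ge0 _) p1 (_ : `|s - s0| <= d); exact.
have b2 : Q s n * n <= 1 / 2 * d by apply: ler_pM => //; exact: ltW.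
have b3 : P (s0 + d) d * (s0 + d - s) <= 1 / 3 * (2 * d).
  apply: le_trans (ler_norm _) _; rewrite normrM; apply: ler_pM => //.
  have -> : s0 + d - s = d - (s - s0) by ring.
  by apply: le_trans (ler_normB _ _) _; rewrite (gtr0_norm d0) mulr2n mulrDl mul1r lerD2l.
have b4 : Q (s0 + d) d * (d - n) <= 1 / 2 * d.
  by apply: ler_pM => //; [rewrite subr_ge0|rewrite lerBlDr lerDl ltW].
move: U L D b1 b2 b3 b4; move: (P s n) (Q s n) (P (s0 + d) d) (Q (s0 + d) d).
move: (f s n) (f s0 0) (f (s0 + d) d) => u1 u2 u3 v1 v2 v3 v4.
clear - brenier smooth d0 kd nn n0.
move=> *.
by rewrite ler_norml; apply/andP; split; lra.
Qed.

Lemma fskew_cont s0 (e : R) : 2 * `|s0| < 1 -> 0 < e -> exists2 d : R, 0 < d &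
  forall s n, `|s - s0| < d -> 0 <= n < d -> `|f s n - f s0 0| <= e.
Proof.
move=> hs e0; pose d := Num.min ((1 - 2 * `|s0|) / 40) (e / 20).
have d0 : 0 < d by rewrite lt_min !divr_gt0 // subr_gt0.
have d1 : d <= (1 - 2 * `|s0|) / 40 by rewrite ge_min lexx.
have d2 : d <= e / 20 by rewrite ge_min lexx orbT.
have s00 := normr_ge0 s0.
have tri_near (a b : R) : `|a - s0| < 3 * d -> 0 < b < 3 * d -> tri a b.
  move=> ha /andP[b0 hb]; rewrite /tri b0 /=; have -> : a = (a - s0) + s0 by ring.
  by have := ler_normD (a - s0) s0; lra.
have pos s n : `|s - s0| < d -> 0 < n < d -> `|f s n - f s0 0| <= 3 * (`|s - s0| + n).
  move=> h1 /andP[h2 h3]; have k := normr_ge0 (s - s0).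
  apply: fskew_near_diag; apply: tri_near; [lra|lra| |lra].
  by rewrite addrAC subrr add0r ger0_norm; lra.
exists d => // s n h1 /andP[]; rewrite le_eqVlt => /orP[/eqP <-|n0] h3; last first.
  by apply: le_trans (pos _ _ h1 _) _; [rewrite n0|lra].
have k := normr_ge0 (s - s0).
have K1 : `|f s (d / 2) - f s0 0| <= 3 * (`|s - s0| + d / 2) by apply: pos => //; lra.
have K2 : `|f s (d / 2) - f s 0| <= 3 * (`|s - s| + d / 2).
  rewrite subrr normr0 add0r.
  have := @fskew_near_diag s s (d / 2); rewrite subrr normr0 add0r; apply.
    by apply: tri_near; lra.
  apply: tri_near; last lra.
  have -> : s + d / 2 - s0 = (s - s0) + d / 2 by ring.
  by apply: le_lt_trans (ler_normD _ _) _; rewrite (gtr0_norm (x := d / 2)) ?divr_gt0 //; lra.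
rewrite subrr normr0 add0r in K2.
have -> : f s 0 - f s0 0 = (f s (d / 2) - f s0 0) - (f s (d / 2) - f s 0) by ring.
by apply: le_trans (ler_normB _ _) _; lra.
Qed.

Lemma Pskew_odd s n : tri s n -> P (- s) n = - P s n.
Proof.
move=> t; have := Tskew_mirror brenier smooth (p := (s, n)) t.
by rewrite /Pskew => ->; rewrite /= opprK.
Qed.

(** Oddness of [P] makes the derivative of [f x n - f (- x) n] vanish, and the difference is 0 at
    [x = 0]. *)
Lemma fskew_even_pos s n : tri s n -> f (- s) n = f s n.
Proof.
wlog s0 : s / 0 <= s => [W|t].
  have [|s0 t] := leP 0 s; first exact: W.
  have := W (- s); rewrite opprK => -> //; first lra.
  by rewrite /tri normrN.
move: s0; rewrite le_eqVlt => /orP[/eqP <-|s0]; first by rewrite oppr0.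
have /andP[n0 hs] := t; rewrite (gtr0_norm s0) in hs.
have tri_x x : 0 <= x <= s -> tri x n by move=> hx; rewrite /tri n0 ger0_norm //=; lra.
have [x hx|c hc E] := @MVT_derive R (fun x => f x n - f (-1 * x + 0) n) (fun x => P x n - P (-1 * x + 0) n * -1) 0 s s0.
  have tx := tri_x x hx.
  apply: (@derive_at_sub R (f ^~ n) (fun x => f (-1 * x + 0) n)).
    by apply: fskew_derive; apply: Tri_regular.
  apply: (@is_derive_affine R (f ^~ n)); apply: fskew_derive; apply: Tri_regular.
  by rewrite /Tri /= addr0 mulN1r /tri normrN.
have tc : tri c n by apply: tri_x; case/andP: hc => *; apply/andP; split; exact: ltW.
move: E; rewrite !addr0 !mulN1r oppr0 subrr subr0 (Pskew_odd tc) mulrN1 opprK subrr mul0r.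
by move/eqP; rewrite subr_eq0 => /eqP.
Qed.

Lemma fskew_even s n : 0 <= n -> 2 * `|s| < 1 - 3 * n -> f (- s) n = f s n.
Proof.
rewrite le_eqVlt => /orP[/eqP <- {n}|n0] hs; last by apply: fskew_even_pos; rewrite /tri n0.
(* On the diagonal no derivative is available; the identity is inherited from small positive [n] by
   continuity. *)
apply/eqP; rewrite -subr_eq0 -normr_eq0; apply/negPn/negP => N.
have e0 : 0 < `|f (- s) 0 - f s 0| / 4 by rewrite divr_gt0 // lt_neqAle eq_sym N normr_ge0.
have h1 : 2 * `|s| < 1 by lra.
have h2 : 2 * `|- s| < 1 by rewrite normrN.
have [d1 d10 D1] := fskew_cont h1 e0; have [d2 d20 D2] := fskew_cont h2 e0.
have d30 : 0 < (1 - 2 * `|s|) / 3 by rewrite divr_gt0 // subr_gt0.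
have [n n0 [n1 n2 n3]] := exists_pos_lt3 d10 d20 d30.
have K1 := D1 s n (ltac:(rewrite subrr normr0 //)) (ltac:(rewrite n1 ltW //)).
have K2 := D2 (- s) n (ltac:(rewrite subrr normr0 //)) (ltac:(rewrite n2 ltW //)).
have E : f (- s) n = f s n by apply: fskew_even_pos; rewrite /tri n0 /=; lra.
rewrite E in K2.
have : `|f (- s) 0 - f s 0| <= `|f s n - f s 0| + `|f s n - f (- s) 0|.
  have -> : f (- s) 0 - f s 0 = (f s n - f s 0) - (f s n - f (- s) 0) by ring.
  exact: ler_normB.
lra.
Qed.

Lemma half_potential_skew : half_potential f P Q.
Proof.
split.
- exact: fskew_sub.
- move=> s n t; have [A [B [C [[FP FQ] A0 BAC AC _]]]] := regular_hessian (Tri_regular (p := (s, n)) t).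
  exists A, B, C; split => //.
  (* [A = 0] would force [B = 0], and then the expansion bound would read [1 <= 0]. *)
  rewrite lt_neqAle A0 andbT; apply/eqP => E.
  have B0 : B = 0.
    apply/eqP; rewrite -sqrf_eq0; apply/eqP/le_anti; rewrite sqr_ge0 andbT.
    by move: BAC; rewrite -E mul0r.
  by move: AC; rewrite -E B0 normr0 addr0 mul0r ler10.
- by move=> s n t; exact: (Tskew_Quad brenier smooth (p := (s, n)) t).
- exact: fskew_even.
- exact: Pskew_odd.
- exact: fskew_cont.
- move=> B mB; have := measurable_Tskew brenier mB.
  by congr measurable; apply/seteqP; split => -[s n].
- by move=> B mB; rewrite -(area_Tskew brenier smooth mB); congr lebesgue2.
Qed.

(** The derivative of the potential along [(1, 1)]. It is [P] in the original coordinates and makes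
    sense on both sides of the diagonal. *)
Definition trace_grad x y : R := (g (x, y)).1 + (g (x, y)).2.

Lemma trace_grad_flat (e : R) : 0 < e -> exists2 d : R, 0 < d &
  forall x y (t : R), `|x| < d -> `|y| < d -> `|x + t| < d -> `|y + t| < d -> 0 < t ->
    regular (x, y) -> regular (x + t, y + t) ->
    trace_grad (x + t) (y + t) - trace_grad x y <= e * t.
Proof.
move=> e0; have [d d0 D] := P_slope_vanishes half_potential_skew e0.
pose r := Num.min (d / 2) (1 / 20).
have r0 : 0 < r by rewrite lt_min; apply/andP; split; lra.
have rd : r <= d / 2 by rewrite ge_min lexx.
have r20 : r <= 1 / 20 by rewrite ge_min lexx orbT.
have PE x y : trace_grad x y = P ((3 * x - y) / 2) (x - y).
  rewrite /trace_grad /Pskew /Tskew /cone_coord /=.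
  by have -> : of_skew ((3 * x - y) / 2, x - y) = (x, y) by congr pair; rewrite /=; field.
have lowK x y t : `|x| < r -> `|y| < r -> `|x + t| < r -> `|y + t| < r -> 0 < t -> y < x ->
    trace_grad (x + t) (y + t) - trace_grad x y <= e * t.
  rewrite !ltr_norml => hx hy hx' hy' t0 xy; rewrite !PE.
  have -> : x + t - (y + t) = x - y by ring.
  rewrite [X in e * X](_ : t = (3 * (x + t) - (y + t)) / 2 - (3 * x - y) / 2); last by field.
  by apply: D; rewrite ?ltr_norml; lra.
have halfK x y : `|x| < r -> `|y| < r -> y < x -> halves (x, y).
  by rewrite !ltr_norml => hx hy xy; left; split => /=; lra.
have flipE x y : `|x| < r -> `|y| < r -> x < y -> trace_grad x y = trace_grad y x.
  move=> hx hy xy; rewrite /trace_grad (grad_flip brenier smooth (p := (x, y))); last first.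
    exact: (halves_flip (halfK y x hy hx xy)).
  by rewrite /= addrC.
exists r => // x y t hx hy hx' hy' t0 R1 R2.
have [xy|xy|xy] := ltrgtP y x; first exact: lowK.
  by rewrite (flipE x y) // (flipE (x + t) (y + t)) ?ltrD2r //; exact: lowK.
(* Regular points on the diagonal are approached from below by [(x + k, x - k)], using continuity of
   the gradient at both ends. *)
rewrite {}xy in R1 R2 hy hy' *.
have C a b : regular (a, b) -> forall e1, 0 < e1 -> exists2 k : R, 0 < k &
    forall a' b', `|a' - a| < k -> `|b' - b| < k -> `|trace_grad a' b' - trace_grad a b| <= e1.
  move=> /smooth[_ c1 c2] e1 e10.
  exact: (frechet_cont (frechetD (differentiable_frechet c1) (differentiable_frechet c2)) e10).
apply/ler_addgt0Pr => e1 e10; have e2 : 0 < e1 / 2 by rewrite divr_gt0.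
have [k1 k10 K1] := C _ _ R1 _ e2; have [k2 k20 K2] := C _ _ R2 _ e2.
have r3 : 0 < Num.min (r - `|x|) (r - `|x + t|) by rewrite lt_min !subr_gt0 hx.
have [k k0 [h1 h2]] := exists_pos_lt3 k10 k20 r3; rewrite lt_min => /andP[h3 h4].
have E1 (a : R) : `|a + k - a| = k by rewrite addrAC subrr add0r gtr0_norm.
have E2 (a : R) : `|a - k - a| = k by rewrite addrAC subrr add0r normrN gtr0_norm.
have b1 (a : R) : `|a + k| <= `|a| + k by rewrite -{2}(gtr0_norm k0); exact: ler_normD.
have b2 (a : R) : `|a - k| <= `|a| + k by rewrite -{2}(gtr0_norm k0); exact: ler_normB.
have := K1 (x + k) (x - k); rewrite E1 E2 => /(_ h1 h1).
have := K2 (x + t + k) (x + t - k); rewrite E1 E2 => /(_ h2 h2).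
have := lowK (x + k) (x - k) t.
have -> : x + k + t = x + t + k by ring.
have -> : x - k + t = x + t - k by ring.
move=> L; have {}L : trace_grad (x + t + k) (x + t - k) - trace_grad (x + k) (x - k) <= e * t.
  apply: L => //; last by rewrite ltrD2l (lt_trans _ k0) // oppr_lt0.
  - by apply: le_lt_trans (b1 _) _; rewrite -ltrBrDl.
  - by apply: le_lt_trans (b2 _) _; rewrite -ltrBrDl.
  - by apply: le_lt_trans (b1 _) _; rewrite -ltrBrDl.
  - by apply: le_lt_trans (b2 _) _; rewrite -ltrBrDl.
rewrite !ler_norml; move: (trace_grad _ _) (trace_grad _ _) (trace_grad _ _) (trace_grad _ _) L.
by clear - brenier smooth; move=> *; lra.
Qed.

Lemma small_regular p : `|p.1| < 1 / 40 -> `|p.2| < 1 / 40 -> ~ diagL p -> regular p.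
Proof.
move=> h1 h2 nd; split => //; apply/nbhs_ballP; exists (1 / 40) => /=; first lra.
move=> [x y] [/=]; rewrite /ball /= => k1 k2.
move: h1 h2 k1 k2; rewrite !ltr_norml => h1 h2 k1 k2.
apply/OmegaP; have [xy|xy] := leP y x; first by left; split => /=; lra.
by right; split => /=; lra.
Qed.

Lemma hessian_blow_up (M : R) : exists2 delta : R, 0 < delta &
  forall p, (@Omega R `\` @diagL R) p -> `|p| < delta -> M < hess_norm phi p.
Proof.
(* The maximum keeps [K] positive when [M] is not. *)
pose K := 4 * Num.max M 1.
have K4 : 4 <= K by rewrite /K; have : 1 <= Num.max M 1 by [rewrite le_max lexx orbT]; lra.
have MK : 4 * M <= K by rewrite /K; have : M <= Num.max M 1 by [rewrite le_max lexx]; lra.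
(* If [C <= K], then [A <= e] gives [|B| <= eta], so the expansion product is at most
   [2 * eta * (K + 1) = 1 / 2], against its lower bound 1. *)
pose eta := (4 * (K + 1))^-1.
have eta0 : 0 < eta by rewrite invr_gt0; lra.
have etaK : eta * (K + 1) = 1 / 4 by rewrite /eta; field; rewrite gt_eqF //; lra.
have eta1 : eta <= 1 by nra.
pose e := eta ^+ 2 / (K + 1).
have e0 : 0 < e by rewrite divr_gt0 ?exprn_gt0 //; lra.
have eK : e * (K + 1) = eta ^+ 2 by rewrite /e divfK // gt_eqF //; lra.
have e_eta : e <= eta by nra.
have [d d0 D] := trace_grad_flat e0.
exists (Num.min (d / 2) (1 / 40)); first by rewrite lt_min; apply/andP; split; lra.
move=> [x y] [_ nd]; rewrite lt_min => /andP[/norm_lt_coords[/= x1 y1] /norm_lt_coords[/= x2 y2]].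
have rp : regular (x, y) by apply: small_regular.
have E : of_skew ((3 * x - y) / 2, x - y) = (x, y) by congr pair; rewrite /=; field.
have rs : regular (of_skew ((3 * x - y) / 2, x - y)) by rewrite E.
have [A [B [C [[FP _] A0 BAC AC]]]] := regular_hessian rs.
rewrite E => /andP[C0 CH]; rewrite ltNge; apply/negP => HM.
have {}CH : C <= K by lra.
(* [A] is the derivative of [P] in [s], a limit of difference quotients of [trace_grad] along
   [(1, 1)]. *)
have Ae : A <= e.
  apply/ler_addgt0Pr => e1 e10.
  have [r1 r10 D1] := near_regular rp; have [r2 r20 D2] := FP e1 e10.
  have d2 : 0 < d / 2 by rewrite divr_gt0.
  have [t t0 [t1 t2 td]] := exists_pos_lt3 r10 r20 d2.
  have nt (a : R) : `|a + t - a| = t by rewrite addrAC subrr add0r gtr0_norm.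
  have nl (a : R) : `|a| < d / 2 -> `|a + t| < d.
    by move=> ha; apply: le_lt_trans (ler_normD _ _) _; rewrite (gtr0_norm t0) [d]splitr ltrD.
  have := D x y t; rewrite (nl x) // (nl y) // => L.
  have {}L : trace_grad (x + t) (y + t) - trace_grad x y <= e * t.
    have hd a : `|a| < d / 2 -> `|a| < d by move=> /lt_le_trans; apply; move: d0; clear - brenier smooth; lra.
    by apply: L => //; [exact: hd|exact: hd|apply: D1; rewrite nt].
  have := D2 ((3 * x - y) / 2 + t) (x - y); rewrite nt subrr normr0 mulr0 subr0 addr0.
  move=> /(_ t2 r20).
  have -> : P ((3 * x - y) / 2 + t) (x - y) = trace_grad (x + t) (y + t).
    rewrite /trace_grad /Pskew /Tskew /cone_coord /=.
    by have -> : of_skew ((3 * x - y) / 2 + t, x - y) = (x + t, y + t) by congr pair; rewrite /=; field.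
  have -> : P ((3 * x - y) / 2) (x - y) = trace_grad x y.
    by rewrite /trace_grad /Pskew /Tskew /cone_coord /= E.
  have -> : (3 * x - y) / 2 + t - (3 * x - y) / 2 = t by ring.
  rewrite ler_norml => /andP[L2 _].
  rewrite -(ler_pM2r t0); move: L L2; move: (trace_grad _ _) (trace_grad _ _).
  by clear - brenier smooth; move=> *; lra.
have hB : `|B| <= eta.
  rewrite -(ler_pXn2r (n := 2)) ?nnegrE // ?(ltW eta0) // real_normK ?num_real //.
  apply: le_trans BAC _; rewrite -eK; apply: ler_pM => //; lra.
move: AC; rewrite (ger0_norm A0) (ger0_norm C0) leNgt => /negP; apply.
have := normr_ge0 B => B0.
move: A0 C0 Ae e_eta CH hB B0 eta1 etaK; clear - brenier smooth K4 eta0 => *.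
have : (A + `|B|) * (`|B| + C) <= (eta + eta) * (eta + K) by apply: ler_pM; lra.
have : (eta + eta) * (eta + K) <= (eta + eta) * (K + 1) by apply: ler_wpM2l; lra.
lra.
Qed.

End BlowUp.

Theorem theorem4p7 (R : realType) (phi : R * R -> R) :
  brenier_potential phi ->
  twice_differentiable_on (interior (@Omega R) `\` @diagL R) phi ->
  forall M : R, exists2 delta : R, 0 < delta &
    forall p : R * R, (@Omega R `\` @diagL R) p -> `|p| < delta ->
      M < hess_norm phi p.
Proof. by move=> brenier smooth M; exact: hessian_blow_up. Qed.
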